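(* Let $Z$ be a sequence in $\mathbb{D}$. Suppose that $Z$ can be partitioned as $Z=\bigcup_kZ_k$ and that there exist $\lambda_k\in\mathbb{T}$ such that, setting $$a_k=2\sum_{z\in Z_k}\frac{|\lambda_k-z|^2}{1-|z|^2}\quad\text{and}\quad\mu=\sum_ka_k\delta_{\lambda_k},$$ we have that $\sum_ka_k<\infty$ and $S_\mu$ is an inner factor of $\mathcal{D}$. Then $Z$ is a zero set for the Dirichlet space $\mathcal{D}$.
   Context: $\mathbb{D}$ is the open unit disc in $\mathbb{C}$, $\mathbb{T}$ the unit circle, $\delta_\lambda$ the unit point mass at $\lambda$. The Dirichlet space $\mathcal{D}$ is the space of analytic functions $f$ on $\mathbb{D}$ with $\int_{\mathbb{D}}|f'|^2\,dA<\infty$ ($A$ normalized area measure); it is contained in the Hardy space $H^2$. For a positive finite Borel measure $\mu$ on $\mathbb{T}$ singular with respect to Lebesgue measure, $S_\mu(z)=\exp\left(-\int_{\mathbb{T}}\frac{w+z}{w-z}\,d\mu(w)\right)$. An inner function $I$ is an inner factor of $\mathcal{D}$ if it occurs as the inner factor of some non-zero function in $\mathcal{D}$, i.e. if $IH^2\cap\mathcal{D}\neq(0)$. Sequences may contain each point finitely many times, repetitions encoding multiplicities; sums over $Z_k$ count repetitions. A sequence $Z$ is a zero set for $\mathcal{D}$ if there is $f\in\mathcal{D}$ which has a zero of multiplicity exactly $m$ at each $z$ repeated $m$ times in $Z$ and satisfies $f(z)\ne0$ for all $z\in\mathbb{D}\setminus Z$. *)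

(* Defs.v *)
From HB Require Import structures.
From mathcomp Require Import all_boot all_order all_algebra.
From mathcomp Require Import all_classical all_reals all_analysis.
From mathcomp Require Import complex.

Set Implicit Arguments.
Unset Strict Implicit.
Unset Printing Implicit Defensive.

Import Order.TTheory GRing.Theory Num.Theory.
Import numFieldNormedType.Exports.

Local Open Scope classical_set_scope.
Local Open Scope ring_scope.

(* Complex numbers, packed as a numClosedFieldType: the topology and normed
   module structures of numFieldNormedType are found on [C R], whereas they are
   not inferred on the bare type [R[i]]. *)
Definition C (R : realType) : numClosedFieldType := R[i].

Section Complex.
Context {R : realType}.

Definition mkC (x y : R) : C R := (x +i* y)%C.
Definition reC (z : C R) : R := complex.Re z.
Definition imC (z : C R) : R := complex.Im z.
Definition absC (z : C R) : R := ComplexField.Normc.normc z.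

Definition polarC (r t : R) : C R := mkC (r * cos t) (r * sin t).
Definition expC (z : C R) : C R := polarC (expR (reC z)) (imC z).

Definition disc : set (C R) := [set z | absC z < 1].
Definition circle : set (C R) := [set z | absC z = 1].

End Complex.

Section FunctionSpaces.
Context {R : realType}.
Implicit Types f g h I : C R -> C R.

(* Functions on the disc are total functions on [C R] whose values outside the
   disc are irrelevant. *)
Definition analytic f : Prop := forall z, disc z -> derivable f z 1.

Definition dirichlet_integral f : \bar R :=
  ((pi : R)^-1%:E *
   \int[(@lebesgue_measure R \x @lebesgue_measure R)%E]_(p in
       [set p : R * R | disc (mkC p.1 p.2)])
     (absC (derive1 f (mkC p.1 p.2)) ^+ 2)%:E)%E.

Definition dirichlet_space : set (C R -> C R) :=
  [set f | analytic f /\ (dirichlet_integral f < +oo)%E].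

Definition hardy2 : set (C R -> C R) :=
  [set f | analytic f /\ exists M : R, forall r : R, 0 <= r < 1 ->
    (((2 * pi)^-1)%:E *
     \int[@lebesgue_measure R]_(t in `[0%R, (2 * pi)%R]%classic)
       (absC (f (polarC r t)) ^+ 2)%:E <= M%:E)%E].

Definition inner I : Prop :=
  [/\ analytic I,
      forall z, disc z -> absC (I z) <= 1 &
      {ae @lebesgue_measure R, forall t : R,
        exists2 l : C R, circle l & I (polarC r t) @[r --> (1 : R)^'-] --> l}].

Definition inner_factor I : Prop :=
  inner I /\
  exists f, [/\ dirichlet_space f,
                exists2 z, disc z & f z <> 0 &
                exists2 h, hardy2 h & forall z, disc z -> f z = I z * h z].

Definition zero_of_multiplicity f (z : C R) (m : nat) : Prop :=
  exists g, [/\ analytic g, g z <> 0 &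
                forall w, disc w -> f w = (w - z) ^+ m * g w].

End FunctionSpaces.

Section SingularInner.
Context {R : realType}.

(* The plane with its Borel sigma-algebra; a measure on the unit circle is a
   measure on [borelC] integrated over [circle]. *)
Definition borelC := g_sigma_algebraType (@open (C R)).

Definition singular_inner (mu : {measure set borelC -> \bar R}) (z : C R) :
    C R :=
  let herglotz (w : borelC) : C R := ((w : C R) + z) / ((w : C R) - z) in
  expC (- mkC (\int[mu]_(w in circle) reC (herglotz w))
              (\int[mu]_(w in circle) imC (herglotz w))).

Definition point_masses (a : nat -> {nonneg R}) (lambda : nat -> C R) :
    {measure set borelC -> \bar R} :=
  mseries (fun k => mscale (a k) (@dirac _ borelC (lambda k) R)) 0.

End SingularInner.

(* A sequence of points, possibly finite or empty, is a map [Z : nat -> C R]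
   restricted to an index set [J]; repetitions encode multiplicities. *)
Section Sequences.
Context {R : realType}.
Implicit Types (J : set nat) (Z : nat -> C R).

Definition occurrences J Z (z : C R) : set nat := [set n | J n /\ Z n = z].

Definition disc_sequence J Z : Prop :=
  (forall n, J n -> disc (Z n)) /\ (forall z, finite_set (occurrences J Z z)).

Definition dirichlet_zero_set J Z : Prop :=
  exists f, [/\ dirichlet_space f,
    forall n, J n -> exists2 m, (occurrences J Z (Z n) #= `I_m)%card &
                                zero_of_multiplicity f (Z n) m &
    forall z, disc z -> (forall n, J n -> Z n <> z) -> f z <> 0].

End Sequences.

(* Main.v *)
(* Write the given member of the Dirichlet space as F = S h, where S is the singular inner
   function and h is in H^2.  On the disc, |S|^2 = exp (- s) with s twice the Poisson integral
   of mu, and the choice of the weights a_k makes s dominate sum_n (1 - |b_n|^2), hence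
   1 - |B|^2, for every finite product B of the Blaschke factors b_n of Z.  As
   exp (- s) (1 + s) <= 1, this gives |F|^2 - |B F|^2 <= |h|^2 - |F|^2 pointwise; integrating
   over circles, where S being inner makes F and h have the same mass in the limit, the
   Dirichlet integral of B F is at most twice that of F, uniformly in B.
   A limit along an ultrafilter then yields functions in the Dirichlet space vanishing on all
   of Z.  Among those satisfying the same bounds, one maximising |g p| at a point p outside Z
   has no further zeros: dividing it by a Blaschke factor would preserve the bounds and
   increase |g p|.

   The Dirichlet integral is handled through Taylor coefficients, as sum_n n |c_n|^2, and the
   latter through the growth of the circle means of |f|^2 at radius 1. *)

Require Import Defs.
From HB Require Import structures.
From mathcomp Require Import all_boot all_order all_algebra.
From mathcomp Require Import all_classical all_reals all_analysis.
From mathcomp Require Import measurable_realfun complex ring lra.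

Set Implicit Arguments.
Unset Strict Implicit.
Unset Printing Implicit Defensive.

Import Order.TTheory GRing.Theory Num.Theory.
Import numFieldNormedType.Exports.

Local Open Scope classical_set_scope.
Local Open Scope ring_scope.

(** * Complex arithmetic and derivatives *)

Section ComplexBasics.
Context {R : realType}.
Implicit Types (z w : C R) (y t r : R).

(** A product B F keeps the zeros of F, so a limit of such products may vanish outside Z. This is
    why an extremal problem is solved, over a class closed under division by single Blaschke
    factors. The class is cut out by sum |c_n|^2 <= L and sum n |c_n|^2 <= K. When L is the exact
    first sum, the second bound is equivalent to L - M(r) <= K (1 - r^2) for all r < 1, M(r) being
    the mean of |f|^2 at radius r. Functions are thus compared on circles inside the disc, without
    boundary values.

    The obstacle is the mass of h, whose boundary behaviour is unknown. It is paired with a dilation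
    h(r^2 w), which is bounded; the pairing is again a mean of |h|^2, and the defect 1 - |S|^2
    enters it only against a bounded factor.

    The 2 in a_k matches two constants: a Blaschke factor with zero z loses at most 4 |v - z|^2 / (1
    - |z|^2) times the Poisson kernel at v, for any v on the circle, while |S|^2 has exponent 2 sum
    a_k P(lambda_k).

    The extremal value is positive because the total loss at p is finite, which keeps |B p| away
    from 0 for all finite products B. *)

Definition rC (x : R) : C R := mkC x 0.
Definition eC (t : R) : C R := mkC (cos t) (sin t).
Definition cjC (z : C R) : C R := mkC (reC z) (- imC z).

Lemma mkCE z : z = mkC (reC z) (imC z). Proof. by case: z. Qed.
Lemma C_eq z w : reC z = reC w -> imC z = imC w -> z = w.
Proof. by case: z w => [a b] [c d] /= -> ->. Qed.
Lemma reC_mk x y : reC (mkC x y) = x. Proof. by []. Qed.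
Lemma imC_mk x y : imC (mkC x y) = y. Proof. by []. Qed.
Lemma reC0 : reC (0 : C R) = 0. Proof. by []. Qed.
Lemma imC0 : imC (0 : C R) = 0. Proof. by []. Qed.
Lemma reC1 : reC (1 : C R) = 1. Proof. by []. Qed.
Lemma imC1 : imC (1 : C R) = 0. Proof. by []. Qed.
Lemma reCD z w : reC (z + w) = reC z + reC w. Proof. by case: z w => [a b] []. Qed.
Lemma imCD z w : imC (z + w) = imC z + imC w. Proof. by case: z w => [a b] []. Qed.
Lemma reCN z : reC (- z) = - reC z. Proof. by case: z. Qed.
Lemma imCN z : imC (- z) = - imC z. Proof. by case: z. Qed.
Lemma reCB z w : reC (z - w) = reC z - reC w. Proof. by rewrite reCD reCN. Qed.
Lemma imCB z w : imC (z - w) = imC z - imC w. Proof. by rewrite imCD imCN. Qed.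
Lemma reCM z w : reC (z * w) = reC z * reC w - imC z * imC w.
Proof. by case: z w => [a b] []. Qed.
Lemma imCM z w : imC (z * w) = reC z * imC w + imC z * reC w.
Proof. by case: z w => [a b] []. Qed.
Definition CE := (reC_mk, imC_mk, reC0, imC0, reC1, imC1, reCD, imCD, reCN, imCN, reCM, imCM).

Lemma absCE z : absC z = Num.sqrt (reC z ^+ 2 + imC z ^+ 2).
Proof. by case: z. Qed.
Lemma absC2 z : absC z ^+ 2 = reC z ^+ 2 + imC z ^+ 2.
Proof. by rewrite absCE sqr_sqrtr // addr_ge0 // sqr_ge0. Qed.
Lemma absC_ge0 z : 0 <= absC z. Proof. by rewrite absCE sqrtr_ge0. Qed.
Lemma absC0 : absC (0 : C R) = 0.
Proof. by rewrite absCE !CE expr0n /= addr0 sqrtr0. Qed.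
Lemma absC1 : absC (1 : C R) = 1.
Proof. by rewrite absCE !CE expr0n /= expr1n addr0 sqrtr1. Qed.
Lemma absCM z w : absC (z * w) = absC z * absC w.
Proof. exact: ComplexField.Normc.normcM. Qed.
Lemma absCX z n : absC (z ^+ n) = absC z ^+ n.
Proof. by elim: n => [|n ih]; rewrite ?expr0 ?absC1 // !exprS absCM ih. Qed.
Lemma absCN z : absC (- z) = absC z.
Proof. by rewrite !absCE !CE !sqrrN. Qed.
Lemma absCV z : absC (z^-1) = (absC z)^-1.
Proof. exact: ComplexField.Normc.normcV. Qed.
Lemma absC_dist z w : absC (z - w) = absC (w - z).
Proof. by rewrite -absCN opprB. Qed.
Lemma absCD z w : absC (z + w) <= absC z + absC w.
Proof. exact: le_normcD. Qed.
Lemma absCB z w : absC (z - w) <= absC z + absC w.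
Proof. by rewrite -(absCN w) absCD. Qed.
Lemma absC_sub z w : absC z - absC w <= absC (z - w).
Proof. by rewrite lerBlDr; apply: le_trans (absCD _ _); rewrite subrK. Qed.
Lemma absC_eq0 z : (absC z == 0) = (z == 0).
Proof.
by apply/eqP/eqP => [|->]; [exact: ComplexField.Normc.eq0_normc|exact: absC0].
Qed.
Lemma absC_gt0 z : (0 < absC z) = (z != 0).
Proof. by rewrite lt_neqAle absC_ge0 andbT eq_sym absC_eq0. Qed.
Lemma absC_rC x : absC (rC x) = `|x|.
Proof. by rewrite absCE /= expr0n /= addr0 sqrtr_sqr. Qed.
Lemma reC_le z : `|reC z| <= absC z.
Proof. by rewrite -sqrtr_sqr absCE ler_wsqrtr // lerDl sqr_ge0. Qed.
Lemma imC_le z : `|imC z| <= absC z.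
Proof. by rewrite -sqrtr_sqr absCE ler_wsqrtr // lerDr sqr_ge0. Qed.
Lemma absC_le z : absC z <= `|reC z| + `|imC z|.
Proof.
rewrite -(ler_pXn2r (n := 2)) // ?nnegrE ?absC_ge0 ?addr_ge0 //.
by rewrite absC2 sqrrD !real_normK ?num_real // lerD2r lerDl mulrn_wge0 // mulr_ge0.
Qed.
Lemma absC_sum (I : Type) (s : seq I) (P : pred I) (F : I -> C R) :
  absC (\sum_(i <- s | P i) F i) <= \sum_(i <- s | P i) absC (F i).
Proof.
elim/big_rec2 : _ => [|i x z _ h]; first by rewrite absC0.
by apply: le_trans (absCD _ _) _; rewrite lerD2l.
Qed.

Lemma normCE z : `|z| = (rC (absC z) : C R). Proof. by case: z. Qed.
Lemma rCD x y : rC (x + y) = rC x + rC y.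
Proof. by apply: C_eq; rewrite !CE ?addr0. Qed.
Lemma rCM x y : rC (x * y) = rC x * rC y.
Proof. by apply: C_eq; rewrite !CE; ring. Qed.
Lemma rCX x n : rC (x ^+ n) = rC x ^+ n.
Proof. by elim: n => [|n ih] //; rewrite !exprS rCM ih. Qed.
Lemma rCB x y : rC (x - y) = rC x - rC y.
Proof. by apply: C_eq; rewrite !CE ?subr0. Qed.
Lemma rCV x : rC (x^-1) = (rC x)^-1.
Proof.
have [->|x0] := eqVneq x 0; first by rewrite invr0 (_ : rC 0 = 0) ?invr0.
have rx0 : rC x != 0 by rewrite -absC_eq0 absC_rC normr_eq0.
by apply: (mulIf rx0); rewrite mulVf // -rCM mulVf.
Qed.

Lemma eCD t s : eC (t + s) = eC t * eC s.
Proof. by apply: C_eq; rewrite !CE ?cosD ?sinD; ring. Qed.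
Lemma absC_eC t : absC (eC t) = 1.
Proof. by rewrite absCE /= cos2Dsin2 sqrtr1. Qed.
Lemma eC_neq0 t : eC t != 0.
Proof. by rewrite -absC_gt0 absC_eC. Qed.
Lemma eC_2pi t : eC (t + 2 * pi) = eC t.
Proof.
by apply: C_eq; rewrite /= mulr_natl ?cosD2pi ?sinD2pi.
Qed.
Lemma polarCE r t : polarC r t = rC r * eC t.
Proof. by apply: C_eq; rewrite /= ?mul0r ?subr0 ?addr0. Qed.
Lemma absC_polar r t : absC (polarC r t) = `|r|.
Proof. by rewrite polarCE absCM absC_eC mulr1 absC_rC. Qed.
Lemma absC_polar_ge0 r t : 0 <= r -> absC (polarC r t) = r.
Proof. by move=> r0; rewrite absC_polar ger0_norm. Qed.
Lemma absC_expC z : absC (expC z) = expR (reC z).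
Proof. by rewrite absC_polar ger0_norm // expR_ge0. Qed.
Lemma expCD z w : expC (z + w) = expC z * expC w.
Proof. by rewrite /expC !polarCE !CE expRD rCM eCD; ring. Qed.

Lemma discE z : disc z <-> absC z < 1. Proof. by []. Qed.

Lemma mulC_cj z : z * cjC z = rC (absC z ^+ 2).
Proof. by apply: C_eq; rewrite /= ?absC2 !CE; ring. Qed.
Lemma absC_cj z : absC (cjC z) = absC z.
Proof. by rewrite !absCE !CE sqrrN. Qed.

(* 1 - |(w-z)/(1-z~w)|^2 = (1-|z|^2)(1-|w|^2)/|1-z~w|^2, cleared of denominators *)
Lemma moebius_id z w : absC (1 - cjC z * w) ^+ 2 - absC (w - z) ^+ 2 =
  (1 - absC z ^+ 2) * (1 - absC w ^+ 2).
Proof. by rewrite !absC2 !CE; ring. Qed.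

(** The norm of [C R] takes its values in [C R], so balls have complex radii. A positive complex
    number is real, which lets every later estimate use real radii and [absC]. *)
Lemma nbhsC_P (w : C R) (P : set (C R)) :
  nbhs w P <-> exists2 e : R, 0 < e & forall v, absC (v - w) < e -> P v.
Proof.
split.
  move/nbhs_ballP => [e /= e0 eP].
  have rE : 0 < reC e /\ imC e = 0.
    move: e0; case: e {eP} => a b; rewrite ltcE /= => /andP[/eqP -> ?].
    by split.
  exists (reC e); first exact: rE.1.
  move=> v vw; apply: eP; rewrite /ball /= normCE absC_dist ltcE /=.
  by case: rE => _; case: e {e0} vw => a b /= ? -> ; rewrite eqxx.
move=> [e e0 eP]; apply/nbhs_ballP; exists (rC e) => /=.
  by rewrite /rC /mkC ltcE /= eqxx.
move=> v; rewrite /ball /= normCE ltcE /= eqxx /= => h.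
by apply: eP; rewrite absC_dist.
Qed.

Lemma cvgCP (T : Type) (F : set_system T) {FF : Filter F} (f : T -> C R) (l : C R) :
  f @ F --> l <-> forall e : R, 0 < e -> \forall x \near F, absC (f x - l) < e.
Proof.
split => [fl e e0|h A].
  by apply: (fl [set v | absC (v - l) < e]); apply/nbhsC_P; exists e.
move/nbhsC_P => [e e0 eA]; have := h e e0.
by apply: filterS => x; exact: eA.
Qed.

Lemma cvgC_abs (T : Type) (F : set_system T) {FF : Filter F} (f : T -> C R) (l : C R) :
  f @ F --> l <-> (fun x : T => absC (f x - l)) @ F --> (0 : R).
Proof.
rewrite cvgCP; split => h.
  apply/cvgrPdist_lt => e e0; have := h e e0; apply: filterS => x.
  by rewrite sub0r normrN ger0_norm ?absC_ge0.
move=> e e0; move/cvgrPdist_lt: h => /(_ e e0); apply: filterS => x.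
by rewrite sub0r normrN ger0_norm ?absC_ge0.
Qed.

Lemma cvg_reC (T : Type) (F : set_system T) {FF : Filter F} (f : T -> C R) (l : C R) :
  f @ F --> l -> (reC \o f) @ F --> reC l.
Proof.
move/cvgCP => h; apply/cvgrPdist_lt => e e0; have := h e e0; apply: filterS => x.
by apply: le_lt_trans; rewrite distrC -reCB; exact: reC_le.
Qed.

Lemma cvg_imC (T : Type) (F : set_system T) {FF : Filter F} (f : T -> C R) (l : C R) :
  f @ F --> l -> (imC \o f) @ F --> imC l.
Proof.
move/cvgCP => h; apply/cvgrPdist_lt => e e0; have := h e e0; apply: filterS => x.
by apply: le_lt_trans; rewrite distrC -imCB; exact: imC_le.
Qed.

Lemma cvg_absC (T : Type) (F : set_system T) {FF : Filter F} (f : T -> C R) (l : C R) :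
  f @ F --> l -> (absC \o f) @ F --> absC l.
Proof.
move/cvgCP => h; apply/cvgrPdist_lt => e e0; have := h e e0; apply: filterS => x.
apply: le_lt_trans; rewrite /= ler_norml.
have := absC_sub (f x) l; have := absC_sub l (f x); rewrite (absC_dist l).
by move=> *; apply/andP; split; lra.
Qed.

Lemma cvg_mkC (T : Type) (F : set_system T) {FF : Filter F} (f g : T -> R) (a b : R) :
  f @ F --> a -> g @ F --> b -> (fun x : T => mkC (f x) (g x)) @ F --> mkC a b.
Proof.
move=> /cvgrPdist_lt fa /cvgrPdist_lt gb; apply/cvgCP => e e0.
have e2 : 0 < e / 2 by rewrite divr_gt0.
apply: filterS2 (fa _ e2) (gb _ e2) => x h1 h2.
apply: le_lt_trans (absC_le _) _; rewrite reCB imCB /=.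
by rewrite (splitr e) ltrD // distrC.
Qed.

(** The first-order expansion needs no division by h and includes h = 0, which suits composition and
    estimates better than the difference quotient. *)
Lemma derivC_P (f : C R -> C R) z (d : C R) : is_derive z 1 f d <->
  forall e : R, 0 < e -> exists2 k : R, 0 < k &
    forall h, absC h < k -> absC (f (z + h) - f z - d * h) <= e * absC h.
Proof.
have key (d' h : C R) : h != 0 ->
    absC (h^-1 *: ((f \o shift z) (h *: 1) - f z) - d') * absC h =
    absC (f (z + h) - f z - d' * h).
  move=> h0; rewrite -absCM mulrBl -[X in X * h - _]/(h^-1 * _) mulrAC mulVf //.
  by rewrite mul1r /= -[h *: 1]/(h * 1) mulr1 [h + z]addrC.
split.
  move=> [df <-] e e0.
  have /cvgCP/(_ e e0) : (fun h => h^-1 *: ((f \o shift z) (h *: 1) - f z)) @ 0^' -->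
    'D_1 f z by exact: df.
  move=> /nbhsC_P[k k0 kP]; exists k => // h hk.
  have [->|h0] := eqVneq h 0.
    by rewrite addr0 subrr mulr0 subr0 absC0 mulr0.
  have := kP h; rewrite subr0 => /(_ hk h0) /ltW/= he.
  by rewrite -key // ler_wpM2r // absC_ge0.
move=> hd.
have cv : (fun h => h^-1 *: ((f \o shift z) (h *: 1) - f z)) @ 0^' --> d.
  apply/cvgCP => e e0; have [k k0 kP] := hd (e / 2) (divr_gt0 e0 (ltr0n _ 2)).
  apply/nbhsC_P; exists k => // h; rewrite subr0 => hk h0.
  have hp : 0 < absC h by rewrite absC_gt0.
  have := kP h hk; rewrite -key // ler_pM2r // => /le_lt_trans; apply.
  by rewrite ltr_pdivrMr // ltr_pMr // ltr1n.
split; first by apply/cvg_ex; exists d.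
exact: cvg_lim cv.
Qed.

Lemma cont_deriv (f : C R -> C R) z : derivable f z 1 -> {for z, continuous f}.
Proof. by move/derivable1_diffP/differentiable_continuous. Qed.

Lemma derivC_cont (f : C R -> C R) z (d : C R) : is_derive z 1 f d -> {for z, continuous f}.
Proof. by case=> df _; exact: cont_deriv. Qed.

Lemma derivC_comp (f g : C R -> C R) z (a b : C R) :
  is_derive z 1 g a -> is_derive (g z) 1 f b -> is_derive z 1 (f \o g) (b * a).
Proof.
move=> ga fb; apply/derivC_P => e e0.
(* The two errors add up to at most e' (|a| + e' + |b|) |h|, and e' <= 1 makes this at most e' M
   |h|. *)
pose M := absC a + absC b + 2.
have M0 : 0 < M by rewrite /M; have := absC_ge0 a; have := absC_ge0 b; lra.
pose e' := Num.min 1 (e / M).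
have e'0 : 0 < e' by rewrite lt_min ltr01 divr_gt0.
have e'1 : e' <= 1 by rewrite ge_min lexx.
have e'M : e' * M <= e by rewrite -ler_pdivlMr // ge_min lexx orbT.
move/derivC_P: ga => /(_ e' e'0) [k k0 kP].
move/derivC_P: fb => /(_ e' e'0) [k' k'0 k'P].
exists (Num.min k (k' / M)); first by rewrite lt_min k0 divr_gt0.
move=> h; rewrite lt_min => /andP[hk hk'].
have h1 := kP h hk; rewrite ltr_pdivlMr // in hk'.
set u := g (z + h) - g z.
have hu : absC u <= (absC a + e') * absC h.
  have -> : u = (u - a * h) + a * h by ring.
  apply: le_trans (absCD _ _) _; rewrite absCM.
  by rewrite mulrDl addrC lerD2l.
have hu' : absC u <= M * absC h.
  apply: le_trans hu _; rewrite ler_wpM2r ?absC_ge0 // /M.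
  by have := absC_ge0 b; move: e'1; lra.
have huk : absC u < k' by apply: le_lt_trans hu' _; rewrite mulrC.
have h2 := k'P u huk.
rewrite /= (_ : g (z + h) = g z + u); last by rewrite /u; ring.
rewrite (_ : _ - _ = (f (g z + u) - f (g z) - b * u) + b * (u - a * h)); last by ring.
apply: le_trans (absCD _ _) _; rewrite absCM.
have ha := absC_ge0 a; have hb := absC_ge0 b; have hh := absC_ge0 h.
apply: (@le_trans _ _ (e' * ((absC a + e') * absC h) + absC b * (e' * absC h))).
  apply: lerD.
    by apply: le_trans h2 _; rewrite ler_wpM2l // ltW.
  by rewrite ler_wpM2l.
apply: (@le_trans _ _ (e' * M * absC h)); last by rewrite ler_wpM2r.
rewrite -subr_ge0 (_ : _ - _ = e' * absC h * (2 - e')); last by rewrite /M; ring.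
by apply: mulr_ge0; [apply: mulr_ge0 => //; exact: ltW|lra].
Qed.

Lemma is_derive_real (f : R -> R) (x d : R) : is_derive x 1 f d ->
  forall e : R, 0 < e -> exists2 k : R, 0 < k &
    forall h, `|h| < k -> `|f (x + h) - f x - d * h| <= e * `|h|.
Proof.
move=> [df <-] e e0.
have /cvgrPdist_lt/(_ e e0) : (fun h => h^-1 *: ((f \o shift x) (h *: 1) - f x)) @ 0^' -->
    'D_1 f x by exact: df.
move=> /nbhs_ballP[k /= k0 kP]; exists k => // h hk.
have [->|h0] := eqVneq h 0.
  by rewrite addr0 subrr mulr0 subr0 normr0 mulr0.
have := kP h; rewrite /ball /= sub0r normrN => /(_ hk h0) /ltW.
rewrite distrC => he.
have -> : f (x + h) - f x - 'D_1 f x * h =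
    (h^-1 * (f (h * 1 + x) - f x) - 'D_1 f x) * h.
  by rewrite mulr1 [h + x]addrC mulrBl mulrAC mulVf // mul1r.
by rewrite normrM ler_wpM2r.
Qed.

Lemma is_derive_expC (z : C R) : is_derive z 1 expC (expC z).
Proof.
(* By the addition formula it is enough to differentiate at 0, where the real derivatives of exp,
   cos and sin are combined. *)
have key : forall e : R, 0 < e -> exists2 k : R, 0 < k &
    forall h : C R, absC h < k -> absC (expC h - 1 - h) <= e * absC h.
  move=> e e0.
  have E1 : is_derive (0 : R) 1 expR 1 by have := is_derive_expR (0 : R); rewrite expR0.
  have E2 : is_derive (0 : R) 1 cos 0 by have := is_derive_cos (0 : R); rewrite sin0 oppr0.
  have E3 : is_derive (0 : R) 1 sin 1 by have := is_derive_sin (0 : R); rewrite cos0.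
  (* The error splits into three parts, bounded by 1, 2 and 6 times (e / 10) |h|. *)
  have e4 : 0 < Num.min 1 (e / 10) by rewrite lt_min ltr01 /=; lra.
  have [k1 k10 h1] := is_derive_real E1 e4.
  have [k2 k20 h2] := is_derive_real E2 e4.
  have [k3 k30 h3] := is_derive_real E3 e4.
  exists (Num.min (Num.min (e / 10) k1) (Num.min k2 k3)).
    by rewrite !lt_min k10 k20 k30 !andbT; lra.
  move=> h; rewrite !lt_min => /andP[/andP[he hk1] /andP[hk2 hk3]].
  set a := reC h; set b := imC h.
  have ha : `|a| <= absC h := reC_le h.
  have hb : `|b| <= absC h := imC_le h.
  have {}h1 := h1 a (le_lt_trans ha hk1).
  have {}h2 := h2 b (le_lt_trans hb hk2).
  have {}h3 := h3 b (le_lt_trans hb hk3).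
  rewrite add0r expR0 mul1r in h1.
  rewrite add0r cos0 mul0r subr0 in h2.
  rewrite add0r sin0 mul1r subr0 in h3.
  have m1 : Num.min 1 (e / 10) <= 1 by rewrite ge_min lexx.
  have m2 : Num.min 1 (e / 10) <= e / 10 by rewrite ge_min lexx orbT.
  set m := Num.min 1 (e / 10) in h1 h2 h3 m1 m2 e4.
  rewrite (_ : expC h - 1 - h = (expC h - eC b - rC a) + (eC b - 1 - mkC 0 b)); last first.
    by rewrite {2}(mkCE h); apply: C_eq; rewrite !CE; ring.
  have E : expC h - eC b - rC a = rC (expR a - 1 - a) + rC (expR a - 1) * (eC b - 1).
    by apply: C_eq; rewrite !CE /=; ring.
  have F1 : absC (rC (expR a - 1 - a)) <= e / 10 * absC h.
    rewrite absC_rC; apply: le_trans h1 _; apply: ler_pM => //; exact: ltW.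
  have F2 : absC (eC b - 1 - mkC 0 b) <= 2 * (e / 10 * absC h).
    apply: le_trans (absC_le _) _; rewrite !CE /= oppr0 !addr0 mulr_natl mulr2n.
    apply: lerD.
      by apply: le_trans h2 _; apply: ler_pM => //; exact: ltW.
    by apply: le_trans h3 _; apply: ler_pM => //; exact: ltW.
  have F3 : absC (rC (expR a - 1)) <= 2 * absC h.
    rewrite absC_rC (_ : expR a - 1 = (expR a - 1 - a) + a); last by ring.
    apply: le_trans (ler_normD _ _) _.
    rewrite mulr_natl mulr2n; apply: lerD => //; apply: le_trans h1 _.
    by rewrite -[leRHS]mul1r; apply: ler_pM => //; exact: ltW.
  have F4 : absC (eC b - 1) <= 3 * absC h.
    apply: le_trans (absC_le _) _; rewrite !CE /= subr0.
    rewrite (_ : sin b = (sin b - b) + b); last by ring.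
    have := ler_normD (sin b - b) b.
    have : m * `|b| <= 1 * absC h by apply: ler_pM => //; exact: ltW.
    by move: h2 h3 hb; lra.
  have F5 : absC (rC (expR a - 1) * (eC b - 1)) <= 6 * (e / 10) * absC h.
    rewrite absCM; apply: (@le_trans _ _ ((2 * absC h) * (3 * absC h))).
      by apply: ler_pM => //; exact: absC_ge0.
    have -> : 2 * absC h * (3 * absC h) = 6 * absC h * absC h by ring.
    rewrite ler_wpM2r ?absC_ge0 //; move: he; lra.
  rewrite E; apply: le_trans (absCD _ _) _.
  have := absCD (rC (expR a - 1 - a)) (rC (expR a - 1) * (eC b - 1)).
  have : 0 <= e * absC h by rewrite mulr_ge0 ?absC_ge0 // ltW.
  by move: F1 F2 F5; lra.
apply/derivC_P => e e0.
have ez : 0 < absC (expC z) by rewrite absC_expC expR_gt0.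
have [k k0 kP] := key (e / absC (expC z)) (divr_gt0 e0 ez).
exists k => // h /kP; rewrite expCD => hh.
rewrite (_ : _ - _ = expC z * (expC h - 1 - h)); last by ring.
rewrite absCM; apply: le_trans (ler_wpM2l (ltW ez) hh) _.
by rewrite mulrA mulrCA divff ?mulr1 // gt_eqF.
Qed.

Lemma cont_eC : continuous (eC : R -> C R).
Proof.
by move=> t; apply: cvg_mkC; [exact: continuous_cos|exact: continuous_sin].
Qed.
Lemma cont_reC : continuous (reC : C R -> R).
Proof. by move=> z; apply: (@cvg_reC _ (nbhs z) _ id z); exact: cvg_id. Qed.
Lemma cont_imC : continuous (imC : C R -> R).
Proof. by move=> z; apply: (@cvg_imC _ (nbhs z) _ id z); exact: cvg_id. Qed.
Lemma cont_absC : continuous (absC : C R -> R).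
Proof. by move=> z; apply: (@cvg_absC _ (nbhs z) _ id z); exact: cvg_id. Qed.
Lemma cont_cjC : continuous (cjC : C R -> C R).
Proof.
move=> z; apply: (@cvg_mkC _ (nbhs z) _ reC (fun z => - imC z)); first exact: cont_reC.
by apply: (@cvgN _ _ _ (nbhs z) _ imC); exact: cont_imC.
Qed.

End ComplexBasics.

(** * Integrals and Goursat theorem *)

Section Integral.
Context {R : realType}.
Implicit Types (f g : R -> R) (a b c : R).
Notation mu := (@lebesgue_measure R).

Definition itg (a b : R) (f : R -> R) : R := \int[mu]_(x in `[a, b]) f x.
Definition con (a b : R) (f : R -> R) : Prop :=
  forall x, a <= x <= b -> {for x, continuous f}.

Lemma conB a b f g : con a b f -> con a b g -> con a b (fun x => f x - g x).
Proof. by move=> hf hg x hx; apply: cvgB; [exact: hf|exact: hg]. Qed.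
Lemma con_cst a b (k : R) : con a b (fun=> k).
Proof. by move=> x _; exact: cvg_cst. Qed.

Lemma con_integrable a b f : con a b f -> mu.-integrable `[a, b] (EFin \o f).
Proof.
move=> h; apply: continuous_compact_integrable; first exact: segment_compact.
by apply: continuous_in_subspaceT => x; rewrite inE /= in_itv /= => hx; exact: h.
Qed.

Lemma eq_itg a b f g : (forall x, a <= x <= b -> f x = g x) -> itg a b f = itg a b g.
Proof. by move=> h; apply: eq_Rintegral => x; rewrite inE /= in_itv /= => /h. Qed.
Lemma itgD a b f g : con a b f -> con a b g ->
  itg a b (fun x => f x + g x) = itg a b f + itg a b g.
Proof. by move=> hf hg; apply: RintegralD => //; exact: con_integrable. Qed.
Lemma itgB a b f g : con a b f -> con a b g ->
  itg a b (fun x => f x - g x) = itg a b f - itg a b g.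
Proof. by move=> hf hg; apply: RintegralB => //; exact: con_integrable. Qed.
Lemma itgZ a b f (k : R) : con a b f -> itg a b (fun x => k * f x) = k * itg a b f.
Proof. by move=> hf; apply: RintegralZl => //; exact: con_integrable. Qed.
Lemma itg_cst a b (k : R) : a <= b -> itg a b (fun=> k) = k * (b - a).
Proof.
move=> ab; rewrite /itg Rintegral_cst //= lebesgue_measure_itv /= lte_fin.
case: ltP => // ba; have -> : b = a by apply/eqP; rewrite eq_le ab ba.
by rewrite subrr.
Qed.
Lemma itg_le a b f g : con a b f -> con a b g ->
  (forall x, a <= x <= b -> f x <= g x) -> itg a b f <= itg a b g.
Proof.
by move=> hf hg h; apply: le_Rintegral => //; exact: con_integrable.
Qed.
Lemma itg_ge0 a b f : (forall x, a <= x <= b -> 0 <= f x) -> 0 <= itg a b f.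
Proof. by move=> h; apply: Rintegral_ge0 => x; rewrite /= in_itv /= => /h. Qed.

Lemma itg_near a b f (k M : R) : a <= b -> con a b f ->
  (forall x, a <= x <= b -> `|f x - k| <= M) -> `|itg a b f - k * (b - a)| <= M * (b - a).
Proof.
move=> ab hf h.
have h1 : itg a b f <= itg a b (fun=> k + M).
  apply: itg_le => //; first exact: con_cst.
  by move=> x /h; rewrite ler_norml => /andP[_]; lra.
have h2 : itg a b (fun=> k - M) <= itg a b f.
  apply: itg_le => //; first exact: con_cst.
  by move=> x /h; rewrite ler_norml => /andP[+ _]; lra.
move: h1 h2; rewrite !itg_cst // mulrDl mulrBl => h1 h2.
by rewrite ler_norml; apply/andP; split; lra.
Qed.

Lemma itg_split a b c f : a <= c -> c <= b -> con a b f ->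
  itg a b f = itg a c f + itg c b f.
Proof.
move=> ac cb hf.
have := @Rintegral_itvB R f (BLeft a) (BRight b) c (con_integrable hf).
rewrite !bnd_simp => /(_ ac cb) h.
have {}h : itg a b f - itg a c f = \int[mu]_(t in `]c, b]) f t := h.
rewrite Rintegral_itv_obnd_cbnd in h; first by rewrite -/(itg c b f) in h; lra.
apply: integrableS (con_integrable hf) => //.
by apply: subset_itv; rewrite bnd_simp.
Qed.

Lemma itg_FTC a b f (F : R -> R) : a < b -> con a b f ->
  (forall x, a <= x <= b -> is_derive x 1 F (f x)) -> itg a b f = F b - F a.
Proof.
move=> ab hf hF.
have cF x : a <= x <= b -> {for x, continuous F}.
  by move=> hx; apply/differentiable_continuous/derivable1_diffP; case: (hF x hx).
have := @continuous_FTC2 R f F a b ab.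
rewrite /itg /Rintegral => -> //.
- by apply: continuous_in_subspaceT => x; rewrite inE /= in_itv /= => hx; exact: hf.
- split.
  + by move=> x; rewrite in_itv /= => /andP[ax xb]; case: (hF x _) => //; rewrite !ltW.
  + by apply: cvg_at_right_filter; apply: cF; rewrite lexx ltW.
  + by apply: cvg_at_left_filter; apply: cF; rewrite lexx ltW.
- move=> x; rewrite in_itv /= => /andP[ax xb].
  rewrite derive1E; apply: derive_val; apply: hF.
  by rewrite !ltW.
Qed.

Lemma nested_itv (u v : nat -> R) : (forall n, u n <= u n.+1) ->
  (forall n, v n.+1 <= v n) -> (forall n, u n <= v n) ->
  exists x, forall n, u n <= x <= v n.
Proof.
move=> hu hv huv.
have uh : {homo u : n m / (n <= m)%N >-> n <= m} := homo_leq (@lexx _ _) (@le_trans _ _) hu.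
have vh : {homo v : n m / (n <= m)%N >-> n >= m}.
  by apply: (homo_leq (r := fun x y => y <= x)) => // y x z h1 h2; exact: le_trans h2 h1.
have uv n m : u n <= v m.
  apply: (@le_trans _ _ (u (maxn n m))); first by apply: uh; exact: leq_maxl.
  by apply: le_trans (huv _) _; apply: vh; exact: leq_maxr.
have hs : has_sup (range u).
  by split; [exists (u 0%N); exists 0%N|exists (v 0%N) => _ [n _ <-]].
exists (sup (range u)) => n; apply/andP; split.
  by apply: sup_upper_bound => //; exists n.
by apply: ge_sup; [exact: hs.1|move=> _ [m _ <-]].
Qed.

End Integral.

(** * Goursat's theorem for closed forms on rectangles, by quartering *)

Section Goursat.
Context {R : realType}.
Variables P Q : R -> R -> R.

Lemma norm_itv (x u a b : R) : a <= u <= b -> a <= x <= b -> `|u - x| <= b - a.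
Proof. by move=> /andP[? ?] /andP[? ?]; rewrite ler_norml; apply/andP; split; lra. Qed.

Lemma norm_double (x y e L : R) : `|x| <= e / 2 * L -> `|y| <= e / 2 * L -> `|x - y| <= e * L.
Proof. by rewrite !ler_norml => /andP[? ?] /andP[? ?]; apply/andP; split; lra. Qed.

Lemma norm_cancel (x y w X Y : R) : `|x + w| <= X -> `|y - w| <= Y -> `|x + y| <= X + Y.
Proof. by rewrite !ler_norml => /andP[? ?] /andP[? ?]; apply/andP; split; lra. Qed.

Definition diff2 (P : R -> R -> R) (x y a b : R) := forall e, 0 < e ->
  exists2 k, 0 < k & forall h l, `|h| < k -> `|l| < k ->
    `|P (x + h) (y + l) - P x y - a * h - b * l| <= e * (`|h| + `|l|).

Lemma diff2_cont (P' : R -> R -> R) x y a b : diff2 P' x y a b ->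
  {for x, continuous (P'^~ y)} /\ {for y, continuous (P' x)}.
Proof.
move=> h; have [k k0 kP] := h 1 ltr01.
have M0 : 0 < 1 + `|a| + `|b| by rewrite ltr_wpDr // ltr_wpDr.
have key (d : R) : 0 < d -> 0 < Num.min k (d / (1 + `|a| + `|b|)).
  by move=> d0; rewrite lt_min k0 divr_gt0.
split; apply/cvgrPdist_lt => d d0; apply/nbhs_ballP;
  exists (Num.min k (d / (1 + `|a| + `|b|))); rewrite /= ?key //= => t;
  rewrite /ball /= distrC lt_min => /andP[tk td].
  have := kP (t - x) 0 tk; rewrite normr0 => /(_ k0).
  rewrite addr0 mulr0 subr0 mul1r addr0 [x + _]addrC subrK => ht.
  rewrite distrC (_ : P' t y - P' x y = (P' t y - P' x y - a * (t - x)) + a * (t - x)); last by ring.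
  apply: le_lt_trans (ler_normD _ _) _; rewrite normrM.
  move: td; rewrite ltr_pdivlMr // => td.
  have : 0 <= `|t - x| * `|b| by rewrite mulr_ge0.
  by move: ht td; lra.
have := kP 0 (t - y); rewrite normr0 => /(_ k0 tk).
rewrite addr0 mulr0 subr0 mul1r add0r [y + _]addrC subrK => ht.
rewrite distrC (_ : P' x t - P' x y = (P' x t - P' x y - b * (t - y)) + b * (t - y)); last by ring.
apply: le_lt_trans (ler_normD _ _) _; rewrite normrM.
move: td; rewrite ltr_pdivlMr // => td.
have : 0 <= `|t - y| * `|a| by rewrite mulr_ge0.
by move: ht td; lra.
Qed.

(** The integral of the form P dx + Q dy around the rectangle [a, b] x [c, d], counterclockwise. *)
Definition loop (a b c d : R) : R :=
  itg a b (fun x => P x c - P x d) + itg c d (fun y => Q b y - Q a y).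

Variables A B C D : R.
(** The shared b says that the partial derivatives P_y and Q_x agree: the form is closed at each
    point, with no continuity of the derivatives assumed. *)
Hypothesis hPQ : forall x y, A <= x <= B -> C <= y <= D ->
  exists a b d, diff2 P x y a b /\ diff2 Q x y b d.

Let inr (r : R * R * (R * R)) := [/\ A <= r.1.1, r.1.1 <= r.1.2, r.1.2 <= B &
  [/\ C <= r.2.1, r.2.1 <= r.2.2 & r.2.2 <= D]].

Let conP a b y : A <= a -> b <= B -> C <= y <= D -> con a b (P^~ y).
Proof.
move=> Aa bB hy x /andP[ax xb].
have hx : A <= x <= B by rewrite (le_trans Aa) ?(le_trans xb).
by have [p [q [s [/diff2_cont[]]]]] := hPQ hx hy.
Qed.
Let conQ c d x : C <= c -> d <= D -> A <= x <= B -> con c d (Q x).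
Proof.
move=> Cc dD hx y /andP[cy yd].
have hy : C <= y <= D by rewrite (le_trans Cc) ?(le_trans yd).
by have [p [q [s [_ /diff2_cont[]]]]] := hPQ hx hy.
Qed.

Lemma loop_splitx a m b c d : inr ((a, b), (c, d)) -> a <= m <= b ->
  loop a b c d = loop a m c d + loop m b c d.
Proof.
move=> [/= Aa ab bB [Cc cd dD]] /andP[am mb].
have hc : C <= c <= D by rewrite Cc (le_trans cd).
have hd : C <= d <= D by rewrite dD (le_trans Cc).
have ha : A <= a <= B by rewrite Aa (le_trans ab).
have hb : A <= b <= B by rewrite bB (le_trans Aa).
have hm : A <= m <= B by rewrite (le_trans Aa) ?(le_trans mb).
rewrite /loop (itg_split am mb); last by apply: conB; exact: conP.
have e (x y : R) : A <= x <= B -> A <= y <= B ->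
    itg c d (fun t => Q x t - Q y t) = itg c d (Q x) - itg c d (Q y).
  by move=> hx hy; apply: itgB; exact: conQ.
by rewrite !e //; ring.
Qed.
Lemma loop_splity a b c n d : inr ((a, b), (c, d)) -> c <= n <= d ->
  loop a b c d = loop a b c n + loop a b n d.
Proof.
move=> [/= Aa ab bB [Cc cd dD]] /andP[cn nd].
have hc : C <= c <= D by rewrite Cc (le_trans cd).
have hd : C <= d <= D by rewrite dD (le_trans Cc).
have ha : A <= a <= B by rewrite Aa (le_trans ab).
have hb : A <= b <= B by rewrite bB (le_trans Aa).
have hn : C <= n <= D by rewrite (le_trans Cc) ?(le_trans nd).
rewrite /loop (itg_split cn nd); last by apply: conB; exact: conQ.
have e (x y : R) : C <= x <= D -> C <= y <= D ->
    itg a b (fun t => P t x - P t y) = itg a b (P^~ x) - itg a b (P^~ y).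
  by move=> hx hy; apply: itgB; exact: conP.
by rewrite !e //; ring.
Qed.

Variable e : R.
Hypothesis e0 : 0 < e.

(** The threshold is e times the square of the half-perimeter, which a quartering divides by exactly
    4. *)
Let bad (r : R * R * (R * R)) : bool :=
  e * ((r.1.2 - r.1.1) + (r.2.2 - r.2.1)) ^+ 2 < `|loop r.1.1 r.1.2 r.2.1 r.2.2|.

Let step (r : R * R * (R * R)) : R * R * (R * R) :=
  let: ((a, b), (c, d)) := r in
  let m := (a + b) / 2 in let n := (c + d) / 2 in
  if bad ((a, m), (c, n)) then ((a, m), (c, n)) else
  if bad ((m, b), (c, n)) then ((m, b), (c, n)) else
  if bad ((a, m), (n, d)) then ((a, m), (n, d)) else ((m, b), (n, d)).

(** The loop of a rectangle is the sum of the loops of its quarters, so four good quarters would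
    make a good rectangle. Hence the fourth quarter, which [step] takes by default, is bad when the
    other three are not. *)
Let stepP r : inr r -> bad r ->
  [/\ bad (step r), r.1.1 <= (step r).1.1, (step r).1.2 <= r.1.2,
      r.2.1 <= (step r).2.1 & (step r).2.2 <= r.2.2] /\
  [/\ (step r).1.2 - (step r).1.1 = (r.1.2 - r.1.1) / 2,
      (step r).2.2 - (step r).2.1 = (r.2.2 - r.2.1) / 2 & inr (step r)].
Proof.
case: r => [[a b] [c d]] ir br; have [/= Aa ab bB [Cc cd dD]] := ir.
rewrite /step; set m := (a + b) / 2; set n := (c + d) / 2.
have am : a <= m by rewrite /m; lra.
have mb : m <= b by rewrite /m; lra.
have cn : c <= n by rewrite /n; lra.
have nd : n <= d by rewrite /n; lra.
have E1 : m - a = (b - a) / 2 by rewrite /m; lra.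
have E2 : b - m = (b - a) / 2 by rewrite /m; lra.
have E3 : n - c = (d - c) / 2 by rewrite /n; lra.
have E4 : d - n = (d - c) / 2 by rewrite /n; lra.
have i1 : inr ((a, m), (c, n)) by do !split => //=; lra.
have i2 : inr ((m, b), (c, n)) by do !split => //=; lra.
have i3 : inr ((a, m), (n, d)) by do !split => //=; lra.
have i4 : inr ((m, b), (n, d)) by do !split => //=; lra.
case: ifPn => [b1|b1]; first by do !split => //=.
case: ifPn => [b2|b2]; first by do !split => //=.
case: ifPn => [b3|b3]; first by do !split => //=.
suff b4 : bad ((m, b), (n, d)) by do !split => //=.
apply: contraT => b4; move: br; rewrite /bad /= ltNge => /negP; case.
move: b1 b2 b3 b4; rewrite /bad /= -!leNgt E1 E2 E3 E4.
rewrite (loop_splitx ir (m := m)) ?am ?mb //.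
rewrite (loop_splity (a := a) (b := m) (c := c) (d := d) (n := n)); first last.
- by rewrite cn.
- by do !split => //=; lra.
rewrite (loop_splity (a := m) (b := b) (c := c) (d := d) (n := n)); first last.
- by rewrite cn.
- by do !split => //=; lra.
rewrite -mulrDl exprMn => h1 h2 h3 h4.
have := ler_normD (loop a m c n) (loop a m n d).
have := ler_normD (loop m b c n) (loop m b n d).
have := ler_normD (loop a m c n + loop a m n d) (loop m b c n + loop m b n d).
set X := (b - a + (d - c)) ^+ 2 in h1 h2 h3 h4 *.
by lra.
Qed.

(** Bad quarters would shrink to a point. Near it P and Q are affine up to e / 2 times the
    half-perimeter [L]; the affine parts cancel around the loop because the mixed derivatives agree,
    and what is left is at most e [L] ^ 2. *)
Lemma loop_small r : inr r -> ~~ bad r.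
Proof.
move=> ir; apply/negP => br.
pose s n := iter n step r.
have sP n : inr (s n) /\ bad (s n).
  elim: n => [|n [i b]] //=; have [[b' _ _ _ _] [_ _ i']] := stepP i b.
  by split.
have [x hx] := @nested_itv R (fun n => (s n).1.1) (fun n => (s n).1.2)
  (fun n => let: conj (And5 _ h _ _ _) _ := stepP (sP n).1 (sP n).2 in h)
  (fun n => let: conj (And5 _ _ h _ _) _ := stepP (sP n).1 (sP n).2 in h)
  (fun n => let: And4 _ h _ _ := (sP n).1 in h).
have [y hy] := @nested_itv R (fun n => (s n).2.1) (fun n => (s n).2.2)
  (fun n => let: conj (And5 _ _ _ h _) _ := stepP (sP n).1 (sP n).2 in h)
  (fun n => let: conj (And5 _ _ _ _ h) _ := stepP (sP n).1 (sP n).2 in h)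
  (fun n => let: And4 _ _ _ (And3 _ h _) := (sP n).1 in h).
have szx n : (s n).1.2 - (s n).1.1 = (r.1.2 - r.1.1) * 2^-1 ^+ n.
  elim: n => [|n ih]; first by rewrite expr0 mulr1.
  by have [_ [h _ _]] := stepP (sP n).1 (sP n).2; rewrite /= h ih exprSr mulrA.
have szy n : (s n).2.2 - (s n).2.1 = (r.2.2 - r.2.1) * 2^-1 ^+ n.
  elim: n => [|n ih]; first by rewrite expr0 mulr1.
  by have [_ [_ h _]] := stepP (sP n).1 (sP n).2; rewrite /= h ih exprSr mulrA.
have [Aa ab bB [Cc cd dD]] := ir.
have hxr : A <= x <= B by have /andP[/= ? ?] := hx 0%N; apply/andP; split; lra.
have hyr : C <= y <= D by have /andP[/= ? ?] := hy 0%N; apply/andP; split; lra.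
have [p [q [t [dP dQ]]]] := hPQ hxr hyr.
have e2 : 0 < e / 2 by rewrite divr_gt0.
have [k1 k10 k1P] := dP _ e2.
have [k2 k20 k2P] := dQ _ e2.
have [n hn] : exists n, (r.1.2 - r.1.1 + (r.2.2 - r.2.1)) * 2^-1 ^+ n < Num.min k1 k2.
  have L0 : 0 < Num.min k1 k2 by rewrite lt_min k10.
  have cv : (fun n => (r.1.2 - r.1.1 + (r.2.2 - r.2.1)) * 2^-1 ^+ n) @ \oo --> (0 : R).
    rewrite -(mulr0 (r.1.2 - r.1.1 + (r.2.2 - r.2.1))).
    by apply: cvgM; [exact: cvg_cst|apply: cvg_expr; rewrite gtr0_norm //; lra].
  have /cvgrPdist_lt/(_ _ L0)[N _ /(_ N (leqnn N))] := cv.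
  by rewrite sub0r normrN => h; exists N; apply: le_lt_trans h; exact: ler_norm.
have [[ha hab hb [hc hcd hd]] bn] := sP n.
move: (hx n) (hy n) (szx n) (szy n) bn => /andP[x1 x2] /andP[y1 y2].
case: (s n) ha hab hb hc hcd hd x1 x2 y1 y2 => [[a b] [c d]] /= ha hab hb hc hcd hd x1 x2 y1 y2 sx sy.
have hL : b - a + (d - c) < Num.min k1 k2 by rewrite sx sy -mulrDl.
have [L1 L2] : b - a + (d - c) < k1 /\ b - a + (d - c) < k2.
  by move: hL; rewrite lt_min => /andP[].
rewrite /bad /= ltNge => /negP; apply.
set L := b - a + (d - c).
have nx u : a <= u <= b -> `|u - x| <= b - a.
  by move=> hu; apply: norm_itv hu _; rewrite x1.
have ny u : c <= u <= d -> `|u - y| <= d - c.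
  by move=> hu; apply: norm_itv hu _; rewrite y1.
have eP u v : a <= u <= b -> c <= v <= d ->
    `|P u v - P x y - p * (u - x) - q * (v - y)| <= e / 2 * L.
  move=> hu hv; have := k1P (u - x) (v - y); rewrite ![_ + (_ - _)]addrC !subrK.
  move/(_ _ _)/le_trans; apply.
  - by apply: le_lt_trans L1; apply: le_trans (nx _ hu) _; rewrite lerDl subr_ge0.
  - by apply: le_lt_trans L1; apply: le_trans (ny _ hv) _; rewrite lerDr subr_ge0.
  by apply: ler_wpM2l; [exact: ltW|apply: lerD; [exact: nx|exact: ny]].
have eQ u v : a <= u <= b -> c <= v <= d ->
    `|Q u v - Q x y - q * (u - x) - t * (v - y)| <= e / 2 * L.
  move=> hu hv; have := k2P (u - x) (v - y); rewrite ![_ + (_ - _)]addrC !subrK.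
  move/(_ _ _)/le_trans; apply.
  - by apply: le_lt_trans L2; apply: le_trans (nx _ hu) _; rewrite lerDl subr_ge0.
  - by apply: le_lt_trans L2; apply: le_trans (ny _ hv) _; rewrite lerDr subr_ge0.
  by apply: ler_wpM2l; [exact: ltW|apply: lerD; [exact: nx|exact: ny]].
have hcc : c <= c <= d by rewrite lexx.
have hdd : c <= d <= d by rewrite lexx andbT.
have haa : a <= a <= b by rewrite lexx.
have hbb : a <= b <= b by rewrite lexx andbT.
have F1 : `|itg a b (fun u => P u c - P u d) - q * (c - d) * (b - a)| <= e * L * (b - a).
  apply: itg_near => //.
    by apply: conB; apply: conP => //; rewrite ?hc ?hd /= ?(le_trans hcd) ?(le_trans hc).
  move=> u hu; apply: le_trans (norm_double (eP u c hu hcc) (eP u d hu hdd)).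
  by rewrite le_eqVlt; apply/orP; left; apply/eqP; congr (`|_|); ring.
have F2 : `|itg c d (fun u => Q b u - Q a u) - q * (b - a) * (d - c)| <= e * L * (d - c).
  apply: itg_near => //.
    by apply: conB; apply: conQ => //; rewrite ?ha ?hb /= ?(le_trans hab) ?(le_trans ha).
  move=> u hu; apply: le_trans (norm_double (eQ b u hbb hu) (eQ a u haa hu)).
  by rewrite le_eqVlt; apply/orP; left; apply/eqP; congr (`|_|); ring.
rewrite /loop.
have -> : e * L ^+ 2 = e * L * (b - a) + e * L * (d - c) by rewrite /L; ring.
move: F1 F2; set I1 := itg _ _ _; set I2 := itg _ _ _.
set X := e * L * (b - a); set Y := e * L * (d - c).
have -> : q * (c - d) * (b - a) = - (q * (b - a) * (d - c)) by ring.
set W := q * (b - a) * (d - c).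
by rewrite opprK => h1 h2; exact: norm_cancel h1 h2.
Qed.

End Goursat.

(** * Cauchy-Riemann equations and means of periodic functions *)

Section GoursatC.
Context {R : realType}.

Lemma loop0 (P Q : R -> R -> R) (A B C D : R) : A <= B -> C <= D ->
  (forall x y, A <= x <= B -> C <= y <= D ->
    exists a b d, diff2 P x y a b /\ diff2 Q x y b d) -> loop P Q A B C D = 0.
Proof.
move=> AB CD h; apply/eqP; rewrite -normr_eq0 eq_le normr_ge0 andbT.
apply/ler_addgt0Pl => d d0; rewrite addr0.
set L := ((B - A) + (D - C)) ^+ 2 + 1.
have L0 : 0 < L by rewrite ltr_wpDl // sqr_ge0.
have := @loop_small R P Q A B C D h (d / L) (divr_gt0 d0 L0) ((A, B), (C, D)).
rewrite /= -leNgt => /(_ _)/le_trans; apply => //.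
rewrite mulrAC ler_pdivrMr //; apply: ler_wpM2l; first exact: ltW.
by rewrite /L lerDl.
Qed.

(** The Cauchy-Riemann equations, read off the complex first-order expansion in coordinates. *)
Lemma diff2_re (K : C R -> C R) x y (d : C R) : is_derive (mkC x y) 1 K d ->
  diff2 (fun x y => reC (K (mkC x y))) x y (reC d) (- imC d) /\
  diff2 (fun x y => imC (K (mkC x y))) x y (imC d) (reC d).
Proof.
move=> /derivC_P h.
split=> e e0; have [k k0 kP] := h e e0; exists (k / 2); rewrite ?divr_gt0 // => u v hu hv.
- have hh : absC (mkC u v) <= `|u| + `|v| := absC_le _.
  have huv : absC (mkC u v) < k by lra.
  apply: (le_trans _ (ler_wpM2l (ltW e0) hh)).
  apply: (le_trans _ (kP _ huv)); apply: (le_trans _ (reC_le _)).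
  rewrite -[mkC x y + mkC u v]/(mkC (x + u) (y + v)) !CE.
  by rewrite le_eqVlt; apply/orP; left; apply/eqP; congr `|_|; ring.
- have hh : absC (mkC u v) <= `|u| + `|v| := absC_le _.
  have huv : absC (mkC u v) < k by lra.
  apply: (le_trans _ (ler_wpM2l (ltW e0) hh)).
  apply: (le_trans _ (kP _ huv)); apply: (le_trans _ (imC_le _)).
  rewrite -[mkC x y + mkC u v]/(mkC (x + u) (y + v)) !CE.
  by rewrite le_eqVlt; apply/orP; left; apply/eqP; congr `|_|; ring.
Qed.

Lemma diff2_opp (P : R -> R -> R) x y a b : diff2 P x y a b ->
  diff2 (fun x y => - P x y) x y (- a) (- b).
Proof.
move=> h e e0; have [k k0 kP] := h e e0; exists k => // u v hu hv.
have := kP u v hu hv; rewrite -normrN; apply: le_trans.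
by rewrite le_eqVlt; apply/orP; left; apply/eqP; congr `|_|; ring.
Qed.

(** The forms Im K dx + Re K dy and Re K dx - Im K dy are closed. Periodicity cancels the horizontal
    sides of the rectangle, so the vertical sides carry equal integrals. *)
Lemma periodic_mean (K : C R -> C R) (A B T : R) : A <= B -> 0 <= T ->
  (forall x y, A <= x <= B -> derivable K (mkC x y) 1) ->
  (forall x, K (mkC x T) = K (mkC x 0)) ->
  itg 0 T (fun y => reC (K (mkC A y))) = itg 0 T (fun y => reC (K (mkC B y))) /\
  itg 0 T (fun y => imC (K (mkC A y))) = itg 0 T (fun y => imC (K (mkC B y))).
Proof.
move=> AB T0 dK pK.
have dK' x y : A <= x <= B -> is_derive (mkC x y) 1 K ('D_1 K (mkC x y)).
  by move=> /(dK x y) /derivableP.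
have cre x : A <= x <= B -> con 0 T (fun y => reC (K (mkC x y))).
  by move=> hx y _; have [/diff2_cont[_ +] _] := diff2_re (dK' x y hx).
have cim x : A <= x <= B -> con 0 T (fun y => imC (K (mkC x y))).
  by move=> hx y _; have [_ /diff2_cont[_ +]] := diff2_re (dK' x y hx).
have hA : A <= A <= B by rewrite lexx.
have hB : A <= B <= B by rewrite lexx andbT.
split.
  have : loop (fun x y => imC (K (mkC x y))) (fun x y => reC (K (mkC x y))) A B 0 T = 0.
    apply: loop0 => // x y hx _; set d := 'D_1 K (mkC x y).
    exists (imC d), (reC d), (- imC d).
    by have [h1 h2] := diff2_re (dK' x y hx).
  rewrite /loop (@eq_itg _ _ _ _ (fun=> 0)); last by move=> x _; rewrite pK subrr.
  by rewrite itg_cst // mul0r add0r itgB; [lra|exact: cre|exact: cre].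
have : loop (fun x y => reC (K (mkC x y))) (fun x y => - imC (K (mkC x y))) A B 0 T = 0.
  apply: loop0 => // x y hx _; set d := 'D_1 K (mkC x y).
  exists (reC d), (- imC d), (- reC d).
  have [h1 h2] := diff2_re (dK' x y hx); split => //.
  exact: diff2_opp.
rewrite /loop (@eq_itg _ _ _ _ (fun=> 0)); last by move=> x _; rewrite pK subrr.
rewrite itg_cst // mul0r add0r.
rewrite (@eq_itg _ _ _ _ (fun y => imC (K (mkC A y)) - imC (K (mkC B y)))); last first.
  by move=> y _; rewrite opprK addrC.
by rewrite itgB; [lra|exact: cim|exact: cim].
Qed.

End GoursatC.

(** * Circle means and Cauchy formula *)

Section Averages.
Context {R : realType}.
Notation mu := (@lebesgue_measure R).
Implicit Types (f g : R -> R) (p q : R -> C R).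

Definition avg (f : R -> R) : R := (2 * pi)^-1 * itg 0 (2 * pi) f.
Definition avgC (p : R -> C R) : C R :=
  mkC (avg (fun t => reC (p t))) (avg (fun t => imC (p t))).

Lemma twopi_gt0 : 0 < 2 * pi :> R. Proof. by rewrite mulr_gt0 // pi_gt0. Qed.
Lemma twopi_ge0 : 0 <= 2 * pi :> R. Proof. exact: ltW twopi_gt0. Qed.

Lemma cont_con a b f : continuous f -> con a b f.
Proof. by move=> h x _; exact: h. Qed.

Lemma eq_avg f g : f =1 g -> avg f = avg g.
Proof. by move=> h; rewrite /avg (eq_itg (g := g)). Qed.
Lemma avgD f g : continuous f -> continuous g ->
  avg (fun t => f t + g t) = avg f + avg g.
Proof. by move=> hf hg; rewrite /avg itgD ?mulrDr //; exact: cont_con. Qed.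
Lemma avgB f g : continuous f -> continuous g ->
  avg (fun t => f t - g t) = avg f - avg g.
Proof. by move=> hf hg; rewrite /avg itgB ?mulrBr //; exact: cont_con. Qed.
Lemma avgZ (k : R) f : continuous f -> avg (fun t => k * f t) = k * avg f.
Proof. by move=> hf; rewrite /avg itgZ 1?mulrCA //; exact: cont_con. Qed.
Lemma avg_cst (k : R) : avg (fun=> k) = k.
Proof.
by rewrite /avg itg_cst ?twopi_ge0 // subr0 mulrC mulfK // gt_eqF // twopi_gt0.
Qed.
Lemma avg_le f g : continuous f -> continuous g -> (forall t, f t <= g t) ->
  avg f <= avg g.
Proof.
move=> hf hg h; rewrite /avg ler_wpM2l ?invr_ge0 ?twopi_ge0 //.
by apply: itg_le => //; exact: cont_con.
Qed.
Lemma avg_ge0 f : (forall t, 0 <= f t) -> 0 <= avg f.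
Proof. by move=> h; rewrite /avg mulr_ge0 ?invr_ge0 ?twopi_ge0 // itg_ge0. Qed.

Lemma cont_reP p : continuous p -> continuous (fun t => reC (p t)).
Proof. by move=> h t; apply: (@cvg_reC _ _ (nbhs t) _ p); exact: h. Qed.
Lemma cont_imP p : continuous p -> continuous (fun t => imC (p t)).
Proof. by move=> h t; apply: (@cvg_imC _ _ (nbhs t) _ p); exact: h. Qed.
Lemma cont_absP p : continuous p -> continuous (fun t => absC (p t)).
Proof. by move=> h t; apply: (@cvg_absC _ _ (nbhs t) _ p); exact: h. Qed.
Lemma contD p q : continuous p -> continuous q -> continuous (fun t => p t + q t).
Proof. by move=> hp hq t; apply: cvgD; [exact: hp|exact: hq]. Qed.
Lemma contB p q : continuous p -> continuous q -> continuous (fun t => p t - q t).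
Proof. by move=> hp hq t; apply: cvgB; [exact: hp|exact: hq]. Qed.
Lemma contM p q : continuous p -> continuous q -> continuous (fun t => p t * q t).
Proof. by move=> hp hq t; apply: cvgM; [exact: hp|exact: hq]. Qed.
Lemma contK (k : C R) : continuous (fun _ : R => k).
Proof. by move=> t; exact: cvg_cst. Qed.
Lemma contX p n : continuous p -> continuous (fun t => p t ^+ n).
Proof.
move=> hp; elim: n => [|n ih]; first by move=> t; exact: cvg_cst.
rewrite (_ : (fun t => p t ^+ n.+1) = fun t => p t * p t ^+ n); first exact: contM.
by apply/funext => t; rewrite exprS.
Qed.
Lemma contMr f g : continuous f -> continuous g -> continuous (fun t => f t * g t).
Proof. by move=> hf hg t; apply: cvgM; [exact: hf|exact: hg]. Qed.
Lemma contDr f g : continuous f -> continuous g -> continuous (fun t => f t + g t).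
Proof. by move=> hf hg t; apply: cvgD; [exact: hf|exact: hg]. Qed.
Lemma contBr f g : continuous f -> continuous g -> continuous (fun t => f t - g t).
Proof. by move=> hf hg t; apply: cvgB; [exact: hf|exact: hg]. Qed.
Lemma contKr (k : R) : continuous (fun _ : R => k).
Proof. by move=> t; exact: cvg_cst. Qed.
Lemma cont_abs2P p : continuous p -> continuous (fun t => absC (p t) ^+ 2).
Proof.
by move=> h; under eq_fun do rewrite expr2; apply: contMr; exact: cont_absP.
Qed.

Lemma eq_avgC p q : p =1 q -> avgC p = avgC q.
Proof. by move=> h; congr mkC; apply: eq_avg => t; rewrite h. Qed.
Lemma avgCD p q : continuous p -> continuous q ->
  avgC (fun t => p t + q t) = avgC p + avgC q.
Proof.
move=> hp hq; apply: C_eq; rewrite !CE -avgD; try exact: cont_reP; try exact: cont_imP.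
  by apply: eq_avg => t; rewrite reCD.
by apply: eq_avg => t; rewrite imCD.
Qed.
Lemma avgCZ (k : C R) p : continuous p -> avgC (fun t => k * p t) = k * avgC p.
Proof.
move=> hp; have hr := cont_reP hp; have hi := cont_imP hp.
apply: C_eq; rewrite !CE -!avgZ //.
  rewrite -avgB; try by apply: contMr => //; exact: contKr.
  by apply: eq_avg => t; rewrite reCM.
rewrite -avgD; try by apply: contMr => //; exact: contKr.
by apply: eq_avg => t; rewrite imCM.
Qed.
Lemma avgC_cst (k : C R) : avgC (fun=> k) = k.
Proof. by apply: C_eq; rewrite !CE avg_cst. Qed.
Lemma avgCB p q : continuous p -> continuous q ->
  avgC (fun t => p t - q t) = avgC p - avgC q.
Proof.
move=> hp hq; rewrite (@eq_avgC _ (fun t => p t + (-1) * q t)).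
  have hk : continuous (fun _ : R => -1 : C R) by exact: contK.
  by rewrite (avgCD hp (contM hk hq)) (avgCZ _ hq) mulN1r.
by move=> t; rewrite mulN1r.
Qed.
Lemma avg_abs f (M : R) : continuous f -> (forall t, `|f t| <= M) -> `|avg f| <= M.
Proof.
move=> hf h; rewrite ler_norml -{1}(avg_cst (-M)) -{2}(avg_cst M); apply/andP.
by split; apply: avg_le => //; try exact: contKr; move=> t; have := h t;
  rewrite ler_norml => /andP[].
Qed.
(** The factor 2 comes from bounding the real and imaginary parts separately. *)
Lemma avgC_abs p (M : R) : continuous p -> (forall t, absC (p t) <= M) ->
  absC (avgC p) <= 2 * M.
Proof.
move=> hp h; apply: le_trans (absC_le _) _; rewrite mulr_natl mulr2n /=.
apply: lerD; apply: avg_abs; try exact: cont_reP; try exact: cont_imP.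
  by move=> t; apply: le_trans (reC_le _) _.
by move=> t; apply: le_trans (imC_le _) _.
Qed.
Lemma cont_sum n (F : 'I_n -> R -> C R) : (forall i, continuous (F i)) ->
  continuous (fun t => \sum_i F i t).
Proof.
elim: n F => [|n ih] F h.
  by under eq_fun do rewrite big_ord0; exact: contK.
under eq_fun do rewrite big_ord_recr.
by apply: contD; [apply: (ih (fun i => F (widen_ord (leqnSn n) i))) => i|]; exact: h.
Qed.
Lemma avgC_sum n (F : 'I_n -> R -> C R) : (forall i, continuous (F i)) ->
  avgC (fun t => \sum_i F i t) = \sum_i avgC (F i).
Proof.
elim: n F => [|n ih] F h.
  rewrite big_ord0 (eq_avgC (q := fun=> 0)) ?avgC_cst // => t.
  by rewrite big_ord0.
have cs : continuous (fun t => \sum_(i < n) F (widen_ord (leqnSn n) i) t).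
  by apply: cont_sum => i; exact: h.
rewrite big_ord_recr /= -ih; last by move=> i; exact: h.
by rewrite -(avgCD cs (h ord_max)); apply: eq_avgC => t; rewrite big_ord_recr.
Qed.
End Averages.

(** * Circle means of holomorphic functions and of difference quotients *)

Section Cauchy.
Context {R : realType}.

Lemma derivCB (f g : C R -> C R) w : derivable f w 1 -> derivable g w 1 ->
  derivable (fun v => f v - g v) w 1.
Proof. exact: derivableB. Qed.
Lemma derivCM (f g : C R -> C R) w : derivable f w 1 -> derivable g w 1 ->
  derivable (fun v => f v * g v) w 1.
Proof. exact: derivableM. Qed.
Lemma derivCV (f : C R -> C R) w : f w != 0 -> derivable f w 1 ->
  derivable (fun v => (f v)^-1) w 1.
Proof. exact: derivableV. Qed.
Lemma derivC_id w : derivable (fun v : C R => v) w 1.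
Proof. exact: derivable_id. Qed.
Lemma derivC_cst (k w : C R) : derivable (fun _ : C R => k) w 1.
Proof. exact: derivable_cst. Qed.
Lemma derivCX (f : C R -> C R) w n : derivable f w 1 ->
  derivable (fun v => f v ^+ n) w 1.
Proof.
move=> df; elim: n => [|n ih].
  have -> : (fun v => f v ^+ 0) = (fun=> 1) by apply/funext => v; rewrite expr0.
  exact: derivC_cst.
have -> : (fun v => f v ^+ n.+1) = (fun v => f v * f v ^+ n).
  by apply/funext => v; rewrite exprS.
exact: derivCM df ih.
Qed.

Lemma contC_P (f : C R -> C R) z : {for z, continuous f} <->
  forall e : R, 0 < e -> exists2 k : R, 0 < k &
    forall v, absC (v - z) < k -> absC (f v - f z) < e.
Proof.
split=> [h e e0|h].
  have /(_ e e0) := (@cvgCP _ _ (nbhs z) (nbhs_filter z) f (f z)).1 h.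
  by move/nbhsC_P.
by apply/(@cvgCP _ _ (nbhs z) (nbhs_filter z) f (f z)) => e /h ?; apply/nbhsC_P.
Qed.

Lemma cont_polar (r : R) : continuous (polarC r : R -> C R).
Proof.
rewrite (_ : polarC r = fun t => rC r * eC t); last by apply/funext => t; rewrite polarCE.
by apply: contM; [exact: contK|exact: cont_eC].
Qed.

Lemma cont_circ (f : C R -> C R) (r : R) : 0 <= r ->
  (forall w, absC w = r -> {for w, continuous f}) -> continuous (fun t => f (polarC r t)).
Proof.
move=> r0 h t; apply: continuous_comp; first exact: cont_polar.
by apply: h; rewrite absC_polar ger0_norm.
Qed.

(* Goursat's theorem for g (exp s) on a rectangle in the s-plane, whose horizontal sides cancel by periodicity *)
Lemma circ_mean (g : C R -> C R) (r1 r2 : R) : 0 < r1 -> r1 <= r2 ->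
  (forall w, r1 <= absC w <= r2 -> derivable g w 1) ->
  avgC (fun t => g (polarC r1 t)) = avgC (fun t => g (polarC r2 t)).
Proof.
move=> r10 r12 dg; have r20 := lt_le_trans r10 r12.
have pol r y : 0 < r -> expC (mkC (ln r) y) = polarC r y.
  by move=> r0; rewrite /expC /= lnK // posrE.
have [||||h1 h2] := @periodic_mean R (g \o expC) (ln r1) (ln r2) (2 * pi).
- by rewrite ler_ln ?posrE.
- exact: twopi_ge0.
- move=> x y /andP[x1 x2].
  have dge : derivable g (expC (mkC x y)) 1.
    apply: dg; rewrite absC_expC /= -{1}(lnK r10) -(lnK r20).
    by rewrite !ler_expR x1 x2.
  by have [] := derivC_comp (is_derive_expC (mkC x y)) (derivableP dge).
- move=> x /=; congr g; rewrite /expC /= !polarCE.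
  by rewrite -[2 * pi]add0r eC_2pi.
have E (F : C R -> R) r : 0 < r -> avg (fun t => F (g (polarC r t))) =
    (2 * pi)^-1 * itg 0 (2 * pi) (fun y => F ((g \o expC) (mkC (ln r) y))).
  by move=> r0; congr (_ * _); apply: eq_itg => y _; rewrite /= pol.
congr mkC.
  exact: (etrans (E (@reC R) _ r10) (etrans (congr1 _ h1) (esym (E (@reC R) _ r20)))).
exact: (etrans (E (@imC R) _ r10) (etrans (congr1 _ h2) (esym (E (@imC R) _ r20)))).
Qed.

Lemma is_derive_near (f g : C R -> C R) (w d : C R) (k : R) : 0 < k ->
  (forall v, absC (v - w) < k -> f v = g v) -> is_derive w 1 g d -> is_derive w 1 f d.
Proof.
move=> k0 fg /derivC_P h; apply/derivC_P => e /h[k' k'0 k'P].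
exists (Num.min k k'); first by rewrite lt_min k0.
move=> u; rewrite lt_min => /andP[uk /k'P]; rewrite !fg //.
  by rewrite subrr absC0.
by rewrite [w + u]addrC addrK.
Qed.

(** Compactness is taken in the real plane, from a closed square cut by a closed condition, and
    transported by (x, y) -> x + i y. *)
Lemma disc_bounded (g : C R -> C R) (r : R) :
  (forall w, absC w <= r -> {for w, continuous g}) ->
  exists M, forall w, absC w <= r -> absC (g w) <= M.
Proof.
move=> cg; have [r0|r0] := leP 0 r; last first.
  by exists 0 => w wr; have := absC_ge0 w; lra.
pose m (p : R * R) : C R := mkC p.1 p.2.
have cm : continuous m.
  by move=> p; apply: (@cvg_mkC _ _ (nbhs p) _ fst snd); [exact: cvg_fst|exact: cvg_snd].
pose A := (`[- r, r]%classic `*` `[- r, r]%classic) `&` [set p | absC (m p) <= r].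
have cA : compact A.
  apply: compact_closedI.
    by apply: compact_setX; exact: segment_compact.
  apply: (@preimage_closed _ _ (absC \o m) [set x | x <= r]); last exact: closed_le.
  by move=> p _; apply: continuous_comp; [exact: cm|exact: cont_absC].
have A0 : A !=set0.
  exists (0, 0); split; last by change (absC (0 : C R) <= r); rewrite absC0.
  by split; rewrite /= in_itv /=; lra.
have cgA : {within A, continuous (fun p => absC (g (m p)))}.
  apply: continuous_in_subspaceT => p; rewrite inE => -[_ /= pr].
  apply: continuous_comp; last exact: cont_absC.
  by apply: continuous_comp; [exact: cm|exact: cg].
have [c _ cP] := compact_EVT_max A0 cA cgA.
exists (absC (g (m c))) => w wr.
have := cP (reC w, imC w); rewrite /m /= -mkCE; apply.
rewrite inE; split; last by change (absC (mkC (reC w) (imC w)) <= r); rewrite -mkCE.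
have := reC_le w; have := imC_le w; rewrite !ler_norml => /andP[? ?] /andP[? ?].
by split; rewrite /= in_itv /=; apply/andP; split; lra.
Qed.

(** The difference quotient of f at z times w, completed at w = z by its limit. The factor w comes
    from dw = i w dt when Cauchy's integral is written as a mean over t; it also makes the function
    vanish at 0. *)
Definition cquot (f : C R -> C R) (z d w : C R) : C R :=
  if w == z then d * z else (f w - f z) * (w / (w - z)).

Lemma cquot_deriv (f : C R -> C R) (z d w : C R) : w != z -> derivable f w 1 ->
  derivable (cquot f z d) w 1.
Proof.
move=> wz df.
have hwz : w - z != 0 by rewrite subr_eq0.
have hg : derivable (fun v => (f v - f z) * (v / (v - z))) w 1.
  apply: derivCM.
    by apply: derivCB; [exact: df|exact: derivC_cst].
  apply: derivCM; first exact: derivC_id.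
  apply: derivCV; first exact: hwz.
  by apply: derivCB; [exact: derivC_id|exact: derivC_cst].
have k0 : 0 < absC (w - z) by rewrite absC_gt0.
have [] // := @is_derive_near (cquot f z d) _ w _ _ k0 _ (derivableP hg).
move=> v vw; rewrite /cquot; case: eqP => // vz.
by move: vw; rewrite vz absC_dist ltxx.
Qed.

Lemma cquot_cont (f : C R -> C R) (z d : C R) : is_derive z 1 f d ->
  {for z, continuous (cquot f z d)}.
Proof.
move=> /derivC_P df; apply/contC_P => e e0.
rewrite /cquot eqxx.
have M0 : 0 < absC z + absC d + 1.
  by have := absC_ge0 z; have := absC_ge0 d; lra.
set M := absC z + absC d + 1 in M0.
have eM : 0 < Num.min 1 (e / (2 * M)) by rewrite lt_min ltr01 divr_gt0 // mulr_gt0.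
set e' := Num.min 1 (e / (2 * M)) in eM.
have [k k0 kP] := df e' eM.
have e'1 : e' <= 1 by rewrite ge_min lexx.
have e'2 : e' * (2 * M) <= e by rewrite -ler_pdivlMr ?mulr_gt0 // ge_min lexx orbT.
exists (Num.min k e'); first by rewrite lt_min k0.
move=> v; rewrite lt_min => /andP[vk ve].
case: eqP => [_|/eqP vz]; first by rewrite subrr absC0.
have hwz : v - z != 0 by rewrite subr_eq0.
set h := v - z in vk ve hwz.
have hp : 0 < absC h by rewrite absC_gt0.
have := kP h vk; rewrite (_ : z + h = v); last by rewrite /h; ring.
move=> hk.
have -> : (f v - f z) * (v / h) - d * z =
   (f v - f z - d * h) * (v / h) + d * h.
  by rewrite (_ : d * z = d * v - d * h); [field|rewrite /h; ring].
apply: le_lt_trans (absCD _ _) _; rewrite !absCM absCV.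
have hv : absC v <= absC z + 1.
  rewrite (_ : v = z + h); last by rewrite /h; ring.
  by apply: le_trans (absCD _ _) _; lra.
have F1 : absC (f v - f z - d * h) * (absC v / absC h) <= e' * (absC z + 1).
  rewrite mulrA ler_pdivrMr //.
  apply: (@le_trans _ _ (e' * absC h * (absC z + 1))).
    by apply: ler_pM => //; exact: absC_ge0.
  by rewrite mulrAC.
have F2 : absC d * absC h <= absC d * e'.
  by apply: ler_wpM2l; [exact: absC_ge0|exact: ltW].
apply: (@le_lt_trans _ _ (e' * M)); first by rewrite /M; lra.
have : 0 < e' * M by rewrite mulr_gt0.
by lra.
Qed.

Lemma avgC_cont (q : C R -> C R) (r0 : R) : 0 < r0 < 1 ->
  (forall w, disc w -> {for w, continuous q}) ->
  {for r0, continuous (fun r => avgC (fun t => q (polarC r t)))}.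
Proof.
move=> /andP[r00 r01] cq.
pose u := r0 / 2; pose v := (r0 + 1) / 2.
have [u0 ur0 r0v v1] : [/\ 0 < u, u < r0, r0 < v & v < 1] by rewrite /u /v; split; lra.
have [M MP] : exists M, forall w, absC w <= v -> absC (q w) <= M.
  by apply: disc_bounded => w wv; apply: cq; exact: le_lt_trans v1.
have gen (F : C R -> R) : (forall w, `|F w| <= absC w) -> continuous F ->
    {for r0, continuous (fun r => avg (fun t => F (q (polarC r t))))}.
  move=> FM cF.
  have cFq r : 0 <= r -> r < 1 -> continuous (fun t => F (q (polarC r t))).
    move=> rr r1 t; apply: (continuous_comp (f := fun t => q (polarC r t)) (g := F)).
      by apply: cont_circ rr _ t => w wr; apply: cq; rewrite /disc /= wr.
    exact: cF.
  apply: (@cvgM _ _ (nbhs r0)); first exact: cvg_cst.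
  have := @continuity_under_integral R _ _ (@lebesgue_measure R)
    (fun r t => F (q (polarC r t))) `[0, 2 * pi]%classic _ u v _ _ (cst M) _ _ r0.
  apply => //.
  - move=> r /=; rewrite in_itv /= => /andP[ur rv].
    by apply: con_integrable; apply: cont_con; apply: cFq; lra.
  - apply: aeW => t _ r; rewrite inE /= in_itv /= => /andP[ur rv].
    apply: continuous_comp; last exact: cF.
    apply: continuous_comp.
      apply: (@cvg_mkC _ _ (nbhs r) _ (fun r => r * cos t) (fun r => r * sin t));
        by apply: cvgM; [exact: cvg_id|exact: cvg_cst].
    apply: cq; change (absC (polarC r t) < 1).
    by rewrite absC_polar gtr0_norm; lra.
  - by apply: (@con_integrable R 0 (2 * pi) (cst M)); apply: cont_con; exact: contKr.
  - move=> r /=; rewrite in_itv /= => /andP[ur rv]; apply: aeW => t _.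
    by apply: le_trans (FM _) _; apply: MP; rewrite absC_polar gtr0_norm; lra.
  - by rewrite inE /= in_itv /= ur0.
apply: (@cvg_mkC _ _ (nbhs r0) _).
  by apply: gen; [exact: reC_le|exact: cont_reC].
by apply: gen; [exact: imC_le|exact: cont_imC].
Qed.

(* The circle means of the quotient do not depend on the radius, so they equal its value 0
   at the origin; this is Cauchy's formula for f z. *)
Lemma cquot_mean0 (f : C R -> C R) (z d : C R) (r : R) : analytic f -> disc z ->
  is_derive z 1 f d -> absC z < r < 1 -> avgC (fun t => cquot f z d (polarC r t)) = 0.
Proof.
move=> af dz df /andP[zr r1].
set q := cquot f z d.
have cq w : disc w -> {for w, continuous q}.
  move=> dw; have [->|wz] := eqVneq w z; first exact: cquot_cont.
  by apply: cont_deriv; apply: cquot_deriv => //; exact: af.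
have dq w : disc w -> w != z -> derivable q w 1.
  by move=> dw wz; apply: cquot_deriv => //; exact: af.
pose m s := avgC (fun t => q (polarC s t)).
have cm s : 0 < s < 1 -> {for s, continuous m} by move=> hs; exact: avgC_cont.
have z0 := absC_ge0 z.
(* the circle through z, where q is only continuous, is crossed by continuity of the means *)
have m1 s t : 0 < s -> s <= t -> t < 1 -> t < absC z \/ absC z < s -> m s = m t.
  move=> s0 st t1 hz; apply: circ_mean => // w /andP[sw wt].
  apply: dq; first exact: le_lt_trans t1.
  by apply: contraTneq isT => wz; rewrite wz in sw wt; case: hz; lra.
have mz s : 0 < s -> s <= absC z -> m s = m (absC z).
  move=> s0; rewrite le_eqVlt => /predU1P[-> //|sz].
  have cv : m x @[x --> (absC z)^'-] --> m (absC z).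
    by apply: cvg_at_left_filter; apply: cm; rewrite (lt_trans s0).
  have cv' : m x @[x --> (absC z)^'-] --> m s.
    apply: (@cvg_trans _ ((fun=> m s) x @[x --> (absC z)^'-])); last exact: cvg_cst.
    apply: near_eq_cvg; near=> x; apply: m1 => //.
    - by apply: ltW; near: x; exact: nbhs_left_gt.
    - by apply: lt_trans dz; near: x; exact: nbhs_left_lt.
    - by left; near: x; exact: nbhs_left_lt.
  exact: (cvg_unique _ cv' cv).
have mz' s : absC z < s -> s < 1 -> 0 < absC z -> m s = m (absC z).
  move=> sz s1 zp.
  have cv : m x @[x --> (absC z)^'+] --> m (absC z).
    by apply: cvg_at_right_filter; apply: cm; rewrite zp.
  have cv' : m x @[x --> (absC z)^'+] --> m s.
    apply: (@cvg_trans _ ((fun=> m s) x @[x --> (absC z)^'+])); last exact: cvg_cst.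
    apply: near_eq_cvg; near=> x; apply/esym; apply: m1 => //.
    - by apply: lt_trans zp _; near: x; exact: nbhs_right_gt.
    - by apply: ltW; near: x; exact: nbhs_right_lt.
    - by right; near: x; exact: nbhs_right_gt.
  exact: (cvg_unique _ cv' cv).
have mr s : 0 < s -> s < r -> m s = m r.
  move=> s0 sr; have [z00|zp] := eqVneq (absC z) 0.
    by apply: m1 => //; [exact: ltW|right; rewrite z00].
  have zp0 : 0 < absC z by rewrite lt_neqAle eq_sym zp.
  have [sz|sz] := leP s (absC z); first by rewrite (mz s s0 sz) (mz' r).
  exact: (m1 _ _ s0 (ltW sr) _ (or_intror sz)).
have q0 : q 0 = 0.
  rewrite /q /cquot; case: eqP => [<-|_]; first by rewrite mulr0.
  by rewrite mul0r mulr0.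
apply/eqP; rewrite -absC_eq0 eq_le absC_ge0 andbT.
apply/ler_addgt0Pl => e e0; rewrite addr0.
have d0 : disc (0 : C R) by rewrite discE absC0 ltr01.
have /contC_P/(_ (e / 2)) := cq 0 d0.
rewrite divr_gt0 // => /(_ isT)[k k0 kP].
have rp : 0 < r by lra.
pose s := Num.min (k / 2) (r / 2).
have [s0 sk sr] : [/\ 0 < s, s < k & s < r].
  split; first by rewrite lt_min !divr_gt0.
    by rewrite gt_min; apply/orP; left; lra.
  by rewrite gt_min; apply/orP; right; lra.
rewrite -[avgC _]/(m r) -(mr s) //.
rewrite (_ : e = 2 * (e / 2)); last by field.
apply: avgC_abs.
  apply: cont_circ; first exact: ltW.
  by move=> w ws; apply: cq; rewrite /disc /= ws; lra.
move=> t; have := kP (polarC s t); rewrite q0 !subr0 => /(_ _)/ltW; apply.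
by rewrite absC_polar_ge0 // ltW.
Unshelve. all: by end_near.
Qed.

End Cauchy.

(** * Taylor coefficients and power series expansion *)

Section CauchyPS.
Context {R : realType}.

(** Cauchy's coefficient integral, on the circle of radius 1/2 for definiteness; [coefE] frees the
    radius. *)
Definition coef (f : C R -> C R) (n : nat) : C R :=
  avgC (fun t => f (polarC 2^-1 t) * ((polarC 2^-1 t)^-1) ^+ n).

Lemma coefE (f : C R -> C R) n (r : R) : analytic f -> 0 < r < 1 ->
  coef f n = avgC (fun t => f (polarC r t) * ((polarC r t)^-1) ^+ n).
Proof.
move=> af /andP[r0 r1].
pose g := fun w : C R => f w * (w^-1) ^+ n.
have dg w : 0 < absC w < 1 -> derivable g w 1.
  move=> /andP[w0 w1]; apply: derivCM; first exact: af.
  apply: derivCX; apply: derivCV; last exact: derivC_id.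
  by rewrite -absC_gt0.
have [h|/ltW h] := leP 2^-1 r.
  by apply: (@circ_mean R g); [lra|exact: h|move=> w /andP[? ?]; apply: dg; apply/andP; split; lra].
by apply/esym; apply: (@circ_mean R g);
  [exact: r0|exact: h|move=> w /andP[? ?]; apply: dg; apply/andP; split; lra].
Qed.

Lemma coef_bound (f : C R -> C R) (r : R) : analytic f -> 0 < r < 1 ->
  exists M, forall n, absC (coef f n) * r ^+ n <= M.
Proof.
move=> af /andP[r0 r1].
have cf w : disc w -> {for w, continuous f} by move=> /af /cont_deriv.
have [M MP] : exists M, forall w, absC w <= r -> absC (f w) <= M.
  by apply: disc_bounded => w wr; apply: cf; exact: le_lt_trans r1.
exists (2 * M) => n; rewrite (@coefE f n r) ?r0 //.
rewrite -ler_pdivlMr ?exprn_gt0 // -mulrA; apply: avgC_abs.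
  apply: (@cont_circ R (fun w => f w * (w^-1) ^+ n)); first exact: ltW.
  move=> w wr; apply: cont_deriv; apply: derivCM; first by apply: af; rewrite /disc /= wr.
  apply: derivCX; apply: derivCV; last exact: derivC_id.
  by rewrite -absC_gt0 wr.
move=> t; rewrite absCM absCX absCV absC_polar_ge0 ?(ltW r0) // exprVn.
rewrite ler_wpM2r ?invr_ge0 ?exprn_ge0 ?(ltW r0) //; apply: MP.
by rewrite absC_polar_ge0 // ltW.
Qed.

Definition psum (c : nat -> C R) (N : nat) (w : C R) : C R := \sum_(n < N) c n * w ^+ n.
Definition is_ps (c : nat -> C R) (f : C R -> C R) : Prop :=
  forall w, disc w -> psum c N w @[N --> \oo] --> f w.

(** The mean of w ^ n over a circle does not depend on the radius, yet it scales as its n-th power;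
    comparing the radii 1/4 and 1/2 forces it to be 0. *)
Lemma avgC_eX n : (0 < n)%N -> avgC (fun t : R => eC t ^+ n) = 0.
Proof.
move=> n0; set A := avgC _.
have E (s : R) : avgC (fun t => polarC s t ^+ n) = rC s ^+ n * A.
  rewrite -avgCZ; last by apply: contX; exact: cont_eC.
  by apply: eq_avgC => t; rewrite polarCE exprMn.
clearbody A; have := @circ_mean R (fun w => w ^+ n) 4^-1 2^-1; rewrite !E => h.
have {}h : rC (4^-1) ^+ n * A = rC (2^-1) ^+ n * A.
  by apply: h; [lra|lra|move=> w _; apply: derivCX; exact: derivC_id].
have {}h : absC A * (4^-1 ^+ n) = absC A * (2^-1 ^+ n).
  have aM (x : R) (v : C R) : 0 <= x -> absC (rC x ^+ n * v) = absC v * x ^+ n.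
    by move=> x0; rewrite absCM absCX absC_rC ger0_norm // mulrC.
  have q4 : 0 <= 4^-1 :> R by rewrite invr_ge0.
  have q2 : 0 <= 2^-1 :> R by rewrite invr_ge0.
  by rewrite -(aM _ A q4) -(aM _ A q2) h.
apply/eqP; rewrite -absC_eq0; apply/negPn/negP => A0.
have /eqP := mulfI A0 h; rewrite eqrXn2 //; lra.
Qed.

Lemma eCV (t : R) : (eC t)^-1 = cjC (eC t).
Proof.
apply: (mulfI (eC_neq0 t)); rewrite divff ?eC_neq0 // mulC_cj absC_eC expr1n.
by [].
Qed.

Lemma cjCX (z : C R) n : cjC (z ^+ n) = cjC z ^+ n.
Proof.
elim: n => [|n ih]; first by apply: C_eq; rewrite !expr0 /= ?oppr0.
by rewrite !exprS -ih; apply: C_eq; rewrite !CE; ring.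
Qed.

Lemma avgC_eXV n : (0 < n)%N -> avgC (fun t : R => (eC t)^-1 ^+ n) = 0.
Proof.
move=> n0.
have h := avgC_eX n0.
have hr : avg (fun t : R => reC (eC t ^+ n)) = 0 by exact: (congr1 reC h).
have hi : avg (fun t : R => imC (eC t ^+ n)) = 0 by exact: (congr1 imC h).
have ci : continuous (fun t : R => imC (eC t ^+ n)).
  by apply: cont_imP; apply: contX; exact: cont_eC.
apply: C_eq => /=; rewrite ?CE.
  by rewrite -[RHS]hr; apply: eq_avg => t; rewrite eCV -cjCX.
rewrite -(mulr0 (-1)) -hi -avgZ //.
by apply: eq_avg => t; rewrite eCV -cjCX /= mulN1r.
Qed.

(** Meant for G = f W - f z, V = 1 / W and U = W / (W - z) on a circle W. The finite geometric
    expansion of U is averaged against G; as G U has mean 0, the partial sum is minus the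
    remainder. *)
Lemma cauchy_key (G V U : R -> C R) (z : C R) N : continuous G -> continuous V ->
  continuous U ->
  (forall t, U t = \sum_(n < N) z ^+ n * V t ^+ n + z ^+ N * V t ^+ N * U t) ->
  avgC (fun t => G t * U t) = 0 ->
  \sum_(n < N) z ^+ n * avgC (fun t => G t * V t ^+ n) =
  - avgC (fun t => z ^+ N * (V t ^+ N * (G t * U t))).
Proof.
move=> cG cV cU geo m0.
have cn n : continuous (fun t => G t * V t ^+ n) := contM cG (contX cV).
have cS n : continuous (fun t => z ^+ n * (G t * V t ^+ n)) := contM (@contK _ (z ^+ n)) (cn n).
have cSS : continuous (fun t => \sum_(n < N) z ^+ n * (G t * V t ^+ n)).
  by apply: (cont_sum (F := fun (n : 'I_N) t => z ^+ n * (G t * V t ^+ n))) => i; exact: cS.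
have cR : continuous (fun t => z ^+ N * (V t ^+ N * (G t * U t))) :=
  contM (@contK _ (z ^+ N)) (contM (contX cV) (contM cG cU)).
apply/eqP; rewrite -addr_eq0; apply/eqP; rewrite -[RHS]m0.
rewrite [RHS](@eq_avgC _ _ (fun t => (\sum_(n < N) z ^+ n * (G t * V t ^+ n)) +
     z ^+ N * (V t ^+ N * (G t * U t)))).
  rewrite (avgCD cSS cR) (avgC_sum (F := fun (n : 'I_N) t => z ^+ n * (G t * V t ^+ n))).
    have E (i : 'I_N) : true -> avgC (fun t => z ^+ i * (G t * V t ^+ i)) =
        z ^+ i * avgC (fun t => G t * V t ^+ i) by move=> _; exact: avgCZ (cn i).
    by rewrite (eq_bigr _ E).
  by move=> i; exact: cS.
move=> t; rewrite {1}(geo t) mulrDr mulr_sumr; congr (_ + _).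
  by apply: eq_bigr => n _; ring.
by ring.
Qed.

(** On a circle of radius r between |z| and 1, the vanishing mean of [cquot] leaves a remainder of
    order (|z| / r) ^ N. *)
Lemma cauchy_ps (f : C R -> C R) : analytic f -> is_ps (coef f) f.
Proof.
move=> af z dz.
have /derivableP df := af z dz; set d := 'D_1 f z in df.
pose r := (absC z + 1) / 2.
have [z0 zr r1] : [/\ 0 <= absC z, absC z < r & r < 1].
  by move: dz; rewrite /disc /= /r => ?; split; [exact: absC_ge0|lra|lra].
have r0 : 0 < r by lra.
have cf w : disc w -> {for w, continuous f} by move=> /af /cont_deriv.
pose W t := polarC r t.
have aW t : absC (W t) = r by rewrite absC_polar_ge0 // ltW.
have Wn0 t : W t != 0 by rewrite -absC_gt0 aW.
have Wz t : W t - z != 0.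
  rewrite subr_eq0; apply/eqP => e; have := aW t; rewrite e => e'; lra.
have m0 := @cquot_mean0 R f z d r af dz df; rewrite zr r1 in m0; have {}m0 := m0 isT.
have cW : continuous W by exact: cont_polar.
have cfW : continuous (fun t => f (W t)).
  apply: cont_circ; first exact: ltW.
  by move=> w wr; apply: cf; rewrite /disc /= wr.
have cV : continuous (fun t => (W t)^-1).
  apply: (@cont_circ R (fun w => w^-1)); first exact: ltW.
  move=> w wr; apply: cont_deriv; apply: derivCV; last exact: derivC_id.
  by rewrite -absC_gt0 wr.
have cU : continuous (fun t => W t / (W t - z)).
  apply: (@cont_circ R (fun w => w / (w - z))); first exact: ltW.
  move=> w wr; apply: cont_deriv; apply: derivCM; first exact: derivC_id.
  apply: derivCV.
    by rewrite subr_eq0; apply/eqP => e; rewrite e in wr; lra.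
  by apply: derivCB; [exact: derivC_id|exact: derivC_cst].
have cq t : cquot f z d (W t) = (f (W t) - f z) * (W t / (W t - z)).
  by rewrite /cquot -subr_eq0 (negbTE (Wz t)).
have geo N t : W t / (W t - z) =
    \sum_(n < N) z ^+ n * ((W t)^-1) ^+ n + (z ^+ N * ((W t)^-1) ^+ N) * (W t / (W t - z)).
  elim: N => [|N ih]; first by rewrite big_ord0 !expr0 add0r !mul1r.
  rewrite {1}ih big_ord_recr /= -addrA; congr (_ + _).
  by rewrite !exprS; set X := z ^+ N; set Y := _ ^+ N; field; rewrite Wn0 Wz.
have e1 n : avgC (fun t => ((W t)^-1) ^+ n) = (n == 0%N)%:R.
  have E : avgC (fun t => ((W t)^-1) ^+ n) = (rC r)^-1 ^+ n * avgC (fun t => (eC t)^-1 ^+ n).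
    rewrite -avgCZ; last first.
      apply: contX; under eq_fun do rewrite eCV.
      by move=> t; apply: continuous_comp; [exact: cont_eC|exact: cont_cjC].
    by apply: eq_avgC => t; rewrite /W polarCE invfM exprMn.
  rewrite E; case: n {E} => [|n]; last by rewrite avgC_eXV // mulr0.
  by rewrite expr0 mul1r /= -[RHS](avgC_cst 1); apply: eq_avgC => t; rewrite expr0.
have cG : continuous (fun t => f (W t) - f z) by apply: contB; [exact: cfW|exact: contK].
(* Subtracting the constant f z affects the coefficient of index 0 only. *)
have an n : avgC (fun t => (f (W t) - f z) * (W t)^-1 ^+ n) = coef f n - f z * (n == 0%N)%:R.
  have cVn : continuous (fun t => (W t)^-1 ^+ n) by apply: contX; exact: cV.
  have c1 : continuous (fun t => f (W t) * (W t)^-1 ^+ n) := contM cfW cVn.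
  have c2 : continuous (fun t => f z * (W t)^-1 ^+ n) := contM (@contK _ (f z)) cVn.
  rewrite (@coefE f n r) ?r0 // -(e1 n) -(avgCZ _ cVn) -(avgCB c1 c2).
  by apply: eq_avgC => t; rewrite mulrBl.
have mean0 : avgC (fun t => (f (W t) - f z) * (W t / (W t - z))) = 0.
  by rewrite -m0; apply: eq_avgC => t; rewrite -cq.
have [M MP] : exists M, forall w, absC w <= r -> absC (f w) <= M.
  by apply: disc_bounded => w wr; apply: cf; exact: le_lt_trans r1.
have M0 : 0 <= M by apply: le_trans (absC_ge0 _) (MP 0 _); rewrite absC0 ltW.
pose L := (2 * M) * (r / (r - absC z)).
have UP t : absC ((f (W t) - f z) * (W t / (W t - z))) <= L.
  rewrite absCM; apply: ler_pM; try exact: absC_ge0.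
    apply: le_trans (absCB _ _) _; rewrite mulr_natl mulr2n.
    by apply: lerD; apply: MP; [rewrite aW|exact: ltW].
  rewrite absCM absCV aW; apply: ler_wpM2l; first exact: ltW.
  have hz := absC_sub (W t) z; rewrite aW in hz.
  by rewrite lef_pV2 ?posrE //; lra.
(* The term of index 0 must be present to absorb - f z, hence [N.+1]. *)
have key N : absC (psum (coef f) N.+1 z - f z) <= 2 * (L * (absC z / r) ^+ N.+1).
  have h := cauchy_key cG cV cU (geo N.+1) mean0.
  have -> : psum (coef f) N.+1 z - f z = \sum_(n < N.+1) z ^+ n *
      avgC (fun t => (f (W t) - f z) * (W t)^-1 ^+ n).
    rewrite /psum [RHS]big_ord_recl [X in X - _]big_ord_recl an /= !expr0 mulr1 mul1r.
    rewrite addrAC; congr (_ + _); first by rewrite mulr1.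
    by apply: eq_bigr => i _; rewrite an /= mulr0 subr0 mulrC.
  rewrite h absCN; apply: avgC_abs.
    apply: contM; first exact: contK.
    apply: contM; first by apply: contX; exact: cV.
    by apply: contM; [exact: cG|exact: cU].
  move=> t; rewrite absCM [absC (_ * (_ * _))]absCM !absCX absCV aW mulrA -exprMn mulrC.
  by apply: ler_wpM2r; [rewrite exprn_ge0 // divr_ge0 // ltW|exact: UP].
apply/cvgC_abs; rewrite -(cvg_shiftS (fun N => absC (psum (coef f) N z - f z))).
apply: (@squeeze_cvgr _ _ _ _ (fun=> 0) (fun N => 2 * (L * (absC z / r) ^+ N.+1))).
- by apply: nearW => N; rewrite absC_ge0 key.
- exact: cvg_cst.
rewrite -(mulr0 2); apply: (@cvgM _ _ \oo _ (fun=> 2)); first exact: cvg_cst.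
rewrite -(mulr0 L); apply: (@cvgM _ _ \oo _ (fun=> L)); first exact: cvg_cst.
rewrite (cvg_shiftS (fun N => (absC z / r) ^+ N)); apply: cvg_expr.
have zr1 : absC z / r < 1 by rewrite ltr_pdivrMr // mul1r.
by rewrite ger0_norm // divr_ge0 // ltW.
Qed.

End CauchyPS.

(** * Power series and Parseval identity *)

Section PowerSeries.
Context {R : realType}.
Implicit Types (c d : nat -> C R) (f g : C R -> C R) (w h : C R) (r : R).

(** The radius of convergence is at least 1, stated through Cauchy's estimates. *)
Definition pbd c := forall r, 0 < r < 1 -> exists M, forall n, absC (c n) * r ^+ n <= M.

Lemma coef_pbd f : analytic f -> pbd (coef f).
Proof. by move=> af r; exact: coef_bound. Qed.

Lemma bounded_pbd c (M : R) : (forall n, absC (c n) <= M) -> pbd c.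
Proof.
move=> h r /andP[r0 r1]; exists M => n; apply: le_trans (h n).
by rewrite -[leRHS]mulr1 ler_wpM2l ?absC_ge0 // exprn_ile1 // ltW.
Qed.

Lemma geo_sum_le (x : R) N : 0 <= x < 1 -> \sum_(n < N) x ^+ n <= (1 - x)^-1.
Proof.
move=> /andP[x0 x1]; have h : 0 < 1 - x by rewrite subr_gt0.
rewrite -[leRHS]mul1r ler_pdivlMr // mulrC -opprB mulNr -subrX1 opprB lerBlDr lerDl.
exact: exprn_ge0.
Qed.

Lemma nx_bound (x : R) n : 0 <= x < 1 -> n%:R * x ^+ n <= (1 - x)^-1.
Proof.
move=> hx; apply: le_trans (geo_sum_le n hx); case/andP: hx => x0 x1.
have -> : n%:R * x ^+ n = \sum_(i < n) x ^+ n by rewrite sumr_const card_ord mulr_natl.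
by apply: ler_sum => i _; apply: ler_wiXn2l; [exact: x0|exact: ltW|exact: ltnW].
Qed.

Lemma absC_nat n : absC (n%:R : C R) = n%:R.
Proof.
rewrite (_ : n%:R = rC n%:R) ?absC_rC ?ger0_norm //.
by elim: n => [|n ih] //; rewrite -!nat1r ih rCD.
Qed.

(** Using the bound at some s between r and 1 leaves a factor n (r / s) ^ n, which stays bounded. *)
Lemma pbd_mulN c : pbd c -> pbd (fun n => n%:R * c n).
Proof.
move=> hc r /andP[r0 r1]; pose s := (r + 1) / 2.
have [rs s1] : r < s /\ s < 1 by rewrite /s; split; lra.
have s0 : 0 < s by lra.
have hs : 0 < s < 1 by rewrite s0.
have [M MP] := hc s hs.
exists ((1 - r / s)^-1 * M) => n.
have x0 : 0 <= r / s < 1 by rewrite divr_ge0 ?ltW //= ltr_pdivrMr // mul1r.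
rewrite absCM absC_nat.
rewrite (_ : r ^+ n = (r / s) ^+ n * s ^+ n); last first.
  by rewrite -exprMn divfK // gt_eqF.
rewrite (_ : _ * _ = (n%:R * (r / s) ^+ n) * (absC (c n) * s ^+ n)); last by ring.
apply: ler_pM => //; last exact: nx_bound.
- by rewrite mulr_ge0 // exprn_ge0 //; case/andP: x0.
- by rewrite mulr_ge0 ?absC_ge0 // exprn_ge0 // ltW.
Qed.

Lemma pbd_shift c : pbd c -> pbd (fun n => c n.+1).
Proof.
move=> hc r hr; have [M MP] := hc r hr; have /andP[r0 r1] := hr.
exists (M / r) => n; rewrite ler_pdivlMr // -mulrA -exprSr; exact: MP.
Qed.

Lemma pbdD c d : pbd c -> pbd d -> pbd (fun n => c n + d n).
Proof.
move=> hc hd r hr; have [M MP] := hc r hr; have [L LP] := hd r hr.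
have /andP[r0 r1] := hr; exists (M + L) => n.
apply: le_trans (lerD (MP n) (LP n)); rewrite -mulrDl ler_wpM2r ?absCD //.
by rewrite exprn_ge0 // ltW.
Qed.

Lemma pbdZ (k : C R) c : pbd c -> pbd (fun n => k * c n).
Proof.
move=> hc r hr; have [M MP] := hc r hr; exists (absC k * M) => n.
by rewrite absCM -mulrA ler_wpM2l // absC_ge0.
Qed.

Lemma pbd_geo c r : pbd c -> 0 <= r < 1 -> exists M q, [/\ 0 <= M, 0 <= q < 1 &
  forall n w, absC w <= r -> absC (c n * w ^+ n) <= M * q ^+ n].
Proof.
move=> hc /andP[r0 r1]; pose s := (r + 1) / 2.
have [rs s1] : r < s /\ s < 1 by rewrite /s; split; lra.
have s0 : 0 < s by lra.
have hs : 0 < s < 1 by rewrite s0.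
have [M MP] := hc s hs.
have x0 : 0 <= r / s < 1 by rewrite divr_ge0 ?(ltW s0) //= ltr_pdivrMr // mul1r.
exists M, (r / s); split => //.
  by apply: le_trans (MP 0%N); rewrite expr0 mulr1 absC_ge0.
move=> n w wr; rewrite absCM absCX.
apply: (@le_trans _ _ (absC (c n) * r ^+ n)).
  by rewrite ler_wpM2l ?absC_ge0 // lerXn2r // nnegrE ?absC_ge0.
rewrite (_ : r ^+ n = s ^+ n * (r / s) ^+ n); last first.
  by rewrite -exprMn mulrC divfK // gt_eqF.
by rewrite mulrA ler_wpM2r // exprn_ge0 //; case/andP: x0.
Qed.

Lemma pbd_sum c r : pbd c -> 0 <= r < 1 ->
  exists B, forall N, \sum_(n < N) absC (c n) * r ^+ n <= B.
Proof.
move=> hc hr; have [M [q [M0 q1 MP]]] := pbd_geo hc hr.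
exists (M * (1 - q)^-1) => N.
apply: (@le_trans _ _ (\sum_(n < N) M * q ^+ n)).
  apply: ler_sum => i _; have := MP i (rC r); rewrite absCM absCX absC_rC ger0_norm.
    by apply.
  by case/andP: hr.
by rewrite -mulr_sumr ler_wpM2l // geo_sum_le.
Qed.

Lemma psumS c N w : psum c N.+1 w = psum c N w + c N * w ^+ N.
Proof. by rewrite /psum big_ord_recr. Qed.

Lemma psum_tail c r : pbd c -> 0 <= r < 1 -> exists M q, [/\ 0 <= M, 0 <= q < 1 &
  forall w, absC w <= r -> forall N k, absC (psum c (N + k) w - psum c N w) <= M * q ^+ N].
Proof.
move=> hc hr; have [M [q [M0 q1 MP]]] := pbd_geo hc hr.
have /andP[q0 q1'] := q1.
exists (M * (1 - q)^-1), q; split => //.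
  by rewrite mulr_ge0 // invr_ge0 subr_ge0 ltW.
move=> w wr N k.
have : absC (psum c (N + k) w - psum c N w) <= \sum_(i < k) M * q ^+ (N + i).
  elim: k => [|k ih]; first by rewrite addn0 subrr absC0 big_ord0.
  rewrite addnS psumS big_ord_recr /= addrAC.
  by apply: le_trans (absCD _ _) _; apply: lerD => //; exact: MP.
move/le_trans; apply; under eq_bigr do rewrite exprD mulrCA mulrC.
rewrite -mulr_suml -mulr_sumr; apply: ler_wpM2r; first exact: exprn_ge0.
by apply: ler_wpM2l => //; exact: geo_sum_le.
Qed.

Definition pser c w : C R :=
  mkC (limn (fun N => reC (psum c N w))) (limn (fun N => imC (psum c N w))).

Lemma cvg_psum_part (F : C R -> R) c w : {morph F : x y / x + y} -> F 0 = 0 ->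
  (forall v, `|F v| <= absC v) -> pbd c -> disc w -> cvgn (fun N => F (psum c N w)).
Proof.
move=> FD F0 FM hc dw.
have hw : 0 <= absC w < 1 by rewrite absC_ge0.
have [M [q [M0 /andP[q0 q1] MP]]] := pbd_geo hc hw.
have -> : (fun N => F (psum c N w)) = series (fun n => F (c n * w ^+ n)).
  apply/funext => N; rewrite /series /= big_mkord /psum.
  by apply: (big_morph F).
apply: normed_cvg; apply: (@series_le_cvg _ _ (geometric M q)) => [n|n|n|].
- exact: normr_ge0.
- by rewrite /geometric /= mulr_ge0 // exprn_ge0.
- by apply: le_trans (FM _) _; exact: MP.
- by apply: is_cvg_geometric_series; rewrite ger0_norm.
Qed.

Lemma pser_ps c : pbd c -> is_ps c (pser c).
Proof.
move=> hc w dw.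
have -> : (fun N => psum c N w) = (fun N => mkC (reC (psum c N w)) (imC (psum c N w))).
  by apply/funext => N; rewrite -mkCE.
apply: cvg_mkC.
  by apply: (@cvg_psum_part (@reC R)) => //; [exact: reCD|exact: reC_le].
by apply: (@cvg_psum_part (@imC R)) => //; [exact: imCD|exact: imC_le].
Qed.

(** Stated for a general proper filter because it serves along the integers, at radius 1 from the
    left, and along an ultrafilter. *)
Lemma cvg_ub (T : Type) (F : set_system T) {PF : ProperFilter F} (u : T -> R) (a b : R) :
  u @ F --> a -> (\forall n \near F, u n <= b) -> a <= b.
Proof.
move=> /cvgrPdist_lt ua ub; apply/ler_addgt0Pr => e e0.
have [n [h1 h2]] := filter_ex (filterI (ua e e0) ub).
by move: h1; rewrite ltr_norml => /andP[_]; lra.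
Qed.

Lemma cvg_uniqC (T : Type) (F : set_system T) {PF : ProperFilter F} (u : T -> C R) (a b : C R) :
  u @ F --> a -> u @ F --> b -> a = b.
Proof.
move=> /cvgCP ua /cvgCP ub; apply/eqP; rewrite -subr_eq0 -absC_eq0 eq_le absC_ge0 andbT.
apply/ler_addgt0Pr => e e0; rewrite add0r.
have e2 : 0 < e / 2 by rewrite divr_gt0.
have [n [h1 h2]] := filter_ex (filterI (ua _ e2) (ub _ e2)).
rewrite (_ : a - b = (u n - b) - (u n - a)); last by ring.
by apply: le_trans (absCB _ _) _; lra.
Qed.

Lemma is_ps_fun_uniq c f g : is_ps c f -> is_ps c g -> forall w, disc w -> f w = g w.
Proof. by move=> hf hg w dw; exact: cvg_uniqC (hf w dw) (hg w dw). Qed.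

Lemma is_ps_ext c f g : is_ps c f -> (forall w, disc w -> f w = g w) -> is_ps c g.
Proof. by move=> hf h w dw; rewrite -h //; exact: hf. Qed.

Lemma is_psZ (k : C R) c f : is_ps c f -> is_ps (fun n => k * c n) (fun w => k * f w).
Proof.
move=> hf w dw.
have -> : (fun N => psum (fun n => k * c n) N w) = (fun N => k * psum c N w).
  by apply/funext => N; rewrite /psum mulr_sumr; apply: eq_bigr => i _; rewrite mulrA.
by apply: (@cvgM _ _ \oo _ (fun=> k)); [exact: cvg_cst|exact: hf].
Qed.

Lemma is_psB c d f g : is_ps c f -> is_ps d g ->
  is_ps (fun n => c n - d n) (fun w => f w - g w).
Proof.
move=> hf hg w dw.
have -> : (fun N => psum (fun n => c n - d n) N w) = (fun N => psum c N w - psum d N w).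
  by apply/funext => N; rewrite /psum -sumrB; apply: eq_bigr => i _; rewrite mulrBl.
by apply: cvgB; [exact: hf|exact: hg].
Qed.

Lemma is_ps_tail c f r : pbd c -> is_ps c f -> 0 <= r < 1 ->
  exists M q, [/\ 0 <= M, 0 <= q < 1 &
  forall w, absC w <= r -> forall N, absC (f w - psum c N w) <= M * q ^+ N].
Proof.
move=> hc hf hr; have [M [q [M0 q1 MP]]] := psum_tail hc hr.
exists M, q; split => // w wr N.
have dw : disc w by apply: le_lt_trans wr _; case/andP: hr.
have cv : absC (psum c k w - psum c N w) @[k --> \oo] --> absC (f w - psum c N w).
  apply: (@cvg_absC _ _ \oo); apply: (@cvgB _ _ _ \oo); first exact: hf.
  exact: cvg_cst.
apply: (cvg_ub cv); exists N => // k /= Nk.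
by have := MP w wr N (k - N)%N; rewrite subnKC.
Qed.

(** The Taylor coefficients of the derivative. *)
Definition dco c n : C R := n.+1%:R * c n.+1.

Lemma dco_pbd c : pbd c -> pbd (dco c).
Proof. by move=> hc; apply: (@pbd_shift (fun n => n%:R * c n)); exact: pbd_mulN. Qed.

(** The remainder E_n satisfies E_(n+1) = (w + h) E_n + n w ^ (n-1) h ^ 2, whence the bound by
    induction. The factor r ^ 2 on the left avoids the exponent n - 2. *)
Lemma pow_taylor (w h : C R) r n : 0 < r -> absC w <= r -> absC (w + h) <= r ->
  r ^+ 2 * absC ((w + h) ^+ n - w ^+ n - n%:R * w ^+ n.-1 * h) <=
  n%:R ^+ 2 * r ^+ n * absC h ^+ 2.
Proof.
move=> r0 wr whr; elim: n => [|n ih].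
  by rewrite !expr0 subrr mul0r mul0r subr0 absC0 mulr0 expr0n /= !mul0r.
have -> : (w + h) ^+ n.+1 - w ^+ n.+1 - n.+1%:R * w ^+ n.+1.-1 * h =
    (w + h) * ((w + h) ^+ n - w ^+ n - n%:R * w ^+ n.-1 * h) + n%:R * w ^+ n.-1 * h ^+ 2.
  case: n {ih} => [|n] /=; first by rewrite !expr0 !expr1; ring.
  by rewrite !exprS -!nat1r; ring.
have h2 : r ^+ 2 * absC (n%:R * w ^+ n.-1 * h ^+ 2) <= n%:R * r ^+ n.+1 * absC h ^+ 2.
  rewrite !absCM !absCX absC_nat; case: n {ih} => [|n]; first by rewrite !mul0r mulr0.
  rewrite /= [leLHS](_ : _ = n.+1%:R * (r ^+ 2 * absC w ^+ n) * absC h ^+ 2); last by ring.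
  rewrite ler_wpM2r ?exprn_ge0 ?absC_ge0 // ler_wpM2l //.
  rewrite (_ : r ^+ n.+2 = r ^+ 2 * r ^+ n); last by rewrite -exprD.
  rewrite ler_wpM2l ?exprn_ge0 ?(ltW r0) // lerXn2r // nnegrE ?absC_ge0 //; exact: ltW.
have h1 : r ^+ 2 * absC ((w + h) * ((w + h) ^+ n - w ^+ n - n%:R * w ^+ n.-1 * h)) <=
    n%:R ^+ 2 * r ^+ n.+1 * absC h ^+ 2.
  rewrite absCM mulrCA; apply: (@le_trans _ _ (r * (n%:R ^+ 2 * r ^+ n * absC h ^+ 2))).
    by apply: ler_pM => //; rewrite ?absC_ge0 // mulr_ge0 ?absC_ge0 // exprn_ge0 // ltW.
  by rewrite [r ^+ n.+1]exprS le_eqVlt; apply/orP; left; apply/eqP; ring.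
apply: (@le_trans _ _ (n%:R ^+ 2 * r ^+ n.+1 * absC h ^+ 2 + n%:R * r ^+ n.+1 * absC h ^+ 2)).
  apply: le_trans (lerD h1 h2); rewrite -mulrDr ler_wpM2l ?absCD //.
  by rewrite exprn_ge0 // ltW.
have X0 : 0 <= r ^+ n.+1 * absC h ^+ 2.
  by apply: mulr_ge0; apply: exprn_ge0; [exact: ltW|exact: absC_ge0].
by rewrite -nat1r; have : 0 <= n%:R :> R by []; set x := n%:R => x0; nra.
Qed.

(** The second-order remainders of the single powers add up to at most B |h| ^ 2 / r ^ 2, where B
    bounds the sums of n ^ 2 |c n| r ^ n. *)
Lemma ps_deriv c f w : pbd c -> is_ps c f -> disc w -> is_derive w 1 f (pser (dco c) w).
Proof.
move=> hc hf dw.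
pose r := (absC w + 1) / 2.
have [z0 zr r1] : [/\ 0 <= absC w, absC w < r & r < 1].
  by move: dw; rewrite /disc /= /r => ?; split; [exact: absC_ge0|lra|lra].
have r0 : 0 < r by lra.
have hr : 0 <= r < 1 by rewrite (ltW r0).
have [B BP] := pbd_sum (pbd_mulN (pbd_mulN hc)) hr.
have hB h : absC h < r - absC w ->
    r ^+ 2 * absC (f (w + h) - f w - pser (dco c) w * h) <= B * absC h ^+ 2.
  move=> hh.
  have whr : absC (w + h) <= r by apply: le_trans (absCD _ _) _; lra.
  have dwh : disc (w + h) by exact: le_lt_trans r1.
  have hS v : disc v -> (fun N => psum c N.+1 v) @ \oo --> f v.
    by move=> dv; rewrite (cvg_shiftS (fun N => psum c N v)); exact: hf.
  have cv : (fun N => r ^+ 2 * absC (psum c N.+1 (w + h) - psum c N.+1 w - psum (dco c) N w * h))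
       @ \oo --> r ^+ 2 * absC (f (w + h) - f w - pser (dco c) w * h).
    apply: (@cvgM _ _ \oo _ (fun=> r ^+ 2)); first exact: cvg_cst.
    apply: (@cvg_absC _ _ \oo); apply: (@cvgB _ _ _ \oo).
      by apply: (@cvgB _ _ _ \oo); [exact: hS dwh|exact: hS dw].
    apply: (@cvgM _ _ \oo _ _ (fun=> h)); last exact: cvg_cst.
    exact: pser_ps (dco_pbd hc) _ dw.
  apply: (cvg_ub cv); apply: nearW => N.
  have -> : psum c N.+1 (w + h) - psum c N.+1 w - psum (dco c) N w * h =
      \sum_(n < N.+1) c n * ((w + h) ^+ n - w ^+ n - n%:R * w ^+ n.-1 * h).
    rewrite {3}/psum mulr_suml.
    have -> : \sum_(i < N) dco c i * w ^+ i * h = \sum_(n < N.+1) c n * (n%:R * w ^+ n.-1 * h).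
      rewrite big_ord_recl /= !mul0r mulr0 add0r; apply: eq_bigr => i _.
      by rewrite /dco /bump leq0n add1n add0n; ring.
    by rewrite /psum -!sumrB; apply: eq_bigr => i _; ring.
  apply: (@le_trans _ _ (\sum_(n < N.+1) absC (c n) * (n%:R ^+ 2 * r ^+ n * absC h ^+ 2))).
    apply: le_trans (ler_wpM2l _ (absC_sum _ _ _)) _; first by rewrite exprn_ge0 // ltW.
    rewrite mulr_sumr; apply: ler_sum => n _; rewrite absCM mulrCA.
    by rewrite ler_wpM2l ?absC_ge0 //; apply: pow_taylor => //; exact: ltW.
  apply: (@le_trans _ _ ((\sum_(n < N.+1) absC (n%:R * (n%:R * c n)) * r ^+ n) * absC h ^+ 2)).
    rewrite mulr_suml; apply: ler_sum => n _; rewrite !absCM absC_nat.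
    by rewrite le_eqVlt; apply/orP; left; apply/eqP; ring.
  by rewrite ler_wpM2r // exprn_ge0 // absC_ge0.
apply/derivC_P => e e0.
have B0 : 0 <= B by apply: le_trans (BP 0%N); rewrite big_ord0.
exists (Num.min (r - absC w) (e * r ^+ 2 / (B + 1))).
  by rewrite lt_min subr_gt0 zr divr_gt0 // ?mulr_gt0 ?exprn_gt0 //; lra.
move=> h; rewrite lt_min => /andP[h1 h2].
rewrite -(ler_pM2l (exprn_gt0 2 r0)); apply: le_trans (hB h h1) _.
rewrite ltr_pdivlMr in h2; last by lra.
rewrite expr2 mulrA [_ ^+ 2 * _]mulrA ler_wpM2r ?absC_ge0 //.
have := absC_ge0 h; move: h2; rewrite mulrDr mulr1 => h2 h3.
by rewrite [_ ^+ 2 * e]mulrC mulrC; lra.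
Qed.

Lemma ps_analytic c f : pbd c -> is_ps c f -> analytic f.
Proof. by move=> hc hf w dw; case: (ps_deriv hc hf dw). Qed.

Lemma ps_cont c f w : pbd c -> is_ps c f -> disc w -> {for w, continuous f}.
Proof. by move=> hc hf dw; exact: derivC_cont (ps_deriv hc hf dw). Qed.

End PowerSeries.

(** * Parseval's identity on circles *)

Section Parseval.
Context {R : realType}.
Implicit Types (c d : nat -> C R) (f g : C R -> C R) (w h : C R) (r : R).

Definition Nf f r : R := avg (fun t => absC (f (polarC r t)) ^+ 2).
Definition S2 c (x : R) (N : nat) : R := \sum_(n < N) absC (c n) ^+ 2 * x ^+ n.

Lemma S2S c x N : S2 c x N.+1 = S2 c x N + absC (c N) ^+ 2 * x ^+ N.
Proof. by rewrite /S2 big_ord_recr. Qed.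

Lemma absC_add2 w h : absC (w + h) ^+ 2 = absC w ^+ 2 + absC h ^+ 2 + 2 * reC (cjC h * w).
Proof. by rewrite !absC2 !CE; ring. Qed.

Lemma cont_psum c N r : continuous (fun t => psum c N (polarC r t)).
Proof.
apply: (cont_sum (F := fun (n : 'I_N) t => c n * polarC r t ^+ n)) => i.
by apply: contM; [exact: contK|apply: contX; exact: cont_polar].
Qed.

(** Each term of the product has frequency m - N < 0 in t, so its mean is 0. *)
Lemma cross0 c N r : avg (fun t => reC (cjC (c N * polarC r t ^+ N) * psum c N (polarC r t))) = 0.
Proof.
have cE : continuous (fun t : R => (eC t)^-1).
  under eq_fun do rewrite eCV.
  by move=> t; apply: continuous_comp; [exact: cont_eC|exact: cont_cjC].
pose k (m : nat) := cjC (c N) * rC r ^+ (N + m) * c m.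
have cF (m : 'I_N) : continuous (fun t => k m * (eC t)^-1 ^+ (N - m)).
  by apply: contM; [exact: contK|apply: contX; exact: cE].
have E : avgC (fun t => \sum_(m < N) k m * (eC t)^-1 ^+ (N - m)) = 0.
  rewrite (avgC_sum (F := fun (m : 'I_N) t => k m * (eC t)^-1 ^+ (N - m)) cF).
  rewrite big1 // => m _; rewrite avgCZ; last by apply: contX; exact: cE.
  by rewrite avgC_eXV ?mulr0 // subn_gt0.
rewrite -[RHS]/(reC (0 : C R)) -E; apply: eq_avg => t; congr reC.
rewrite /psum mulr_sumr; apply: eq_bigr => m _.
have -> : cjC (c N * polarC r t ^+ N) = cjC (c N) * (rC r ^+ N * (eC t)^-1 ^+ N).
  rewrite eCV -cjCX -rCX polarCE exprMn -rCX.
  by apply: C_eq; rewrite !CE; ring.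
rewrite polarCE exprMn /k exprD.
have e2 : (eC t)^-1 ^+ N = (eC t)^-1 ^+ (N - m) * (eC t)^-1 ^+ m.
  by rewrite -exprD subnK // ltnW.
have e1 : (eC t)^-1 ^+ m * eC t ^+ m = 1 by rewrite -exprMn mulVf ?expr1n // eC_neq0.
rewrite e2; move: e1; move: ((eC t)^-1 ^+ (N - m)) ((eC t)^-1 ^+ m) (eC t ^+ m) => X Y Z e1.
by rewrite -[RHS]mulr1 -e1; ring.
Qed.

Lemma parseval_poly c N r : 
  avg (fun t => absC (psum c N (polarC r t)) ^+ 2) = S2 c (r ^+ 2) N.
Proof.
elim: N => [|N ih].
  rewrite /S2 big_ord0 -[RHS](avg_cst 0); apply: eq_avg => t.
  by rewrite /psum big_ord0 absC0 expr0n.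
have cp := @cont_psum c N r.
have cm : continuous (fun t => c N * polarC r t ^+ N).
  by apply: contM; [exact: contK|apply: contX; exact: cont_polar].
have ccm : continuous (fun t => cjC (c N * polarC r t ^+ N)).
  by move=> t; apply: continuous_comp; [exact: cm|exact: cont_cjC].
have cx : continuous (fun t => reC (cjC (c N * polarC r t ^+ N) * psum c N (polarC r t))).
  by apply: cont_reP; apply: contM; [exact: ccm|exact: cp].
have c2 := cont_abs2P cp; have c3 := cont_abs2P cm.
rewrite (@eq_avg _ _ (fun t => (absC (psum c N (polarC r t)) ^+ 2 + absC (c N * polarC r t ^+ N) ^+ 2) +
   2 * reC (cjC (c N * polarC r t ^+ N) * psum c N (polarC r t)))); last first.
  by move=> t; rewrite psumS absC_add2.
rewrite (avgD (contDr c2 c3) (contMr (@contKr _ 2) cx)) (avgD c2 c3) (avgZ _ cx) cross0 ih.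
rewrite mulr0 addr0 S2S; congr (_ + _); rewrite -[RHS]avg_cst; apply: eq_avg => t.
by rewrite absCM absCX absC_polar exprMn [_ ^+ N ^+ 2]exprAC real_normK ?num_real.
Qed.

Lemma cont_circ_ps c f r : pbd c -> is_ps c f -> 0 <= r < 1 -> continuous (fun t => f (polarC r t)).
Proof.
move=> hc hf /andP[r0 r1]; apply: cont_circ => // w wr; apply: ps_cont hc hf _.
by rewrite /disc /= wr.
Qed.

Lemma ps_disc_bounded c f r : pbd c -> is_ps c f -> r < 1 ->
  exists M, forall w, absC w <= r -> absC (f w) <= M.
Proof.
move=> hc hf r1; apply: disc_bounded => w wr; apply: ps_cont hc hf _.
exact: le_lt_trans r1.
Qed.

Lemma parseval c f r : pbd c -> is_ps c f -> 0 <= r < 1 ->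
  S2 c (r ^+ 2) N @[N --> \oo] --> Nf f r.
Proof.
move=> hc hf hr; have /andP[r0 r1] := hr.
have [M [q [M0 /andP[q0 q1] MP]]] := is_ps_tail hc hf hr.
have [L LP] := ps_disc_bounded hc hf r1.
have L0 : 0 <= L by apply: le_trans (absC_ge0 _) (LP 0 _); rewrite absC0.
have cf := cont_circ_ps hc hf hr.
have key N : `|Nf f r - S2 c (r ^+ 2) N| <= M * (2 * L + M) * q ^+ N.
  rewrite -parseval_poly -(avgB (cont_abs2P cf) (cont_abs2P (@cont_psum c N r))).
  apply: avg_abs; first by apply: contBr; [exact: cont_abs2P cf|exact: cont_abs2P (@cont_psum c N r)].
  move=> t; set a := f _; set b := psum _ _ _.
  have hw : absC (polarC r t) <= r by rewrite absC_polar_ge0.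
  have hab : absC (a - b) <= M * q ^+ N := MP _ hw N.
  have ha : absC a <= L := LP _ hw.
  have hq : q ^+ N <= 1 by rewrite exprn_ile1 // ltW.
  have hMq : M * q ^+ N <= M by rewrite -[leRHS]mulr1 ler_wpM2l.
  have hb : absC b <= L + M.
    by have := absC_sub b a; rewrite absC_dist; lra.
  have hs : 0 <= absC a + absC b by rewrite addr_ge0 ?absC_ge0.
  rewrite subr_sqr normrM (ger0_norm hs) mulrAC; apply: ler_pM => //.
    rewrite ler_norml; have := absC_sub a b; have := absC_sub b a; rewrite (absC_dist b).
    by move=> *; apply/andP; split; lra.
  by lra.
apply/cvgrPdist_le => e e0.
have cv : (fun N => M * (2 * L + M) * q ^+ N) @ \oo --> 0.
  rewrite -(mulr0 (M * (2 * L + M))); apply: (@cvgM _ _ \oo _ (fun=> _)); first exact: cvg_cst.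
  by apply: cvg_expr; rewrite ger0_norm.
move/cvgrPdist_le: cv => /(_ e e0); apply: filterS => N.
rewrite sub0r normrN => h; apply: le_trans (key N) _; exact: le_trans (ler_norm _) h.
Qed.

Lemma S2_nd c (x : R) : 0 <= x -> {homo S2 c x : n m / (n <= m)%N >-> n <= m}.
Proof.
move=> x0; apply: homo_leq => [|y z t|n] //; first exact: le_trans.
by rewrite S2S lerDl mulr_ge0 ?exprn_ge0 // absC_ge0.
Qed.

Lemma S2_le_Nf c f r N : pbd c -> is_ps c f -> 0 <= r < 1 -> S2 c (r ^+ 2) N <= Nf f r.
Proof.
move=> hc hf hr; have cv := parseval hc hf hr.
have := @nondecreasing_cvgn_le _ (S2 c (r ^+ 2)) (S2_nd c (sqr_ge0 r)).
by move=> /(_ (cvgP _ cv) N); rewrite (cvg_lim _ cv).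
Qed.

Lemma Nf_le c f r (K : R) : pbd c -> is_ps c f -> 0 <= r < 1 ->
  (forall N, S2 c (r ^+ 2) N <= K) -> Nf f r <= K.
Proof.
move=> hc hf hr h; apply: (cvg_ub (parseval hc hf hr)).
by apply: nearW.
Qed.

Lemma Nf_ge0 f r : 0 <= Nf f r.
Proof. by apply: avg_ge0 => t; exact: sqr_ge0. Qed.

Lemma Nf_mono c f r s : pbd c -> is_ps c f -> 0 <= r -> r <= s -> s < 1 -> Nf f r <= Nf f s.
Proof.
move=> hc hf r0 rs s1.
apply: (Nf_le hc hf); first by rewrite r0 (le_lt_trans rs).
move=> N; apply: le_trans (S2_le_Nf N hc hf _); last by rewrite (le_trans r0).
apply: ler_sum => n _; rewrite ler_wpM2l ?exprn_ge0 ?absC_ge0 // -!exprM.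
by rewrite lerXn2r // nnegrE // (le_trans r0).
Qed.

(** The difference series represents 0, and by Parseval its zero mean at radius 1/2 dominates each
    |c n - d n| ^ 2 / 4 ^ n. *)
Lemma ps_uniq c d f : pbd c -> pbd d -> is_ps c f -> is_ps d f -> c = d.
Proof.
move=> hc hd hf hg; apply/funext => n; apply/eqP; rewrite -subr_eq0 -absC_eq0.
have hb : pbd (fun n => c n - d n).
  have := pbdD hc (pbdZ (-1) hd); congr pbd.
  by apply/funext => k; rewrite mulN1r.
have h0 := is_psB hf hg.
have := S2_le_Nf n.+1 hb h0 (r := 2^-1); rewrite S2S.
have -> : Nf (fun w => f w - f w) 2^-1 = 0.
  by rewrite /Nf -[RHS](avg_cst 0); apply: eq_avg => t; rewrite subrr absC0 expr0n.
have p0 : 0 <= S2 (fun n => c n - d n) (2^-1 ^+ 2) n.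
  by apply: sumr_ge0 => i _; rewrite mulr_ge0 ?exprn_ge0 ?absC_ge0.
have p1 : 0 < 2^-1 ^+ 2 ^+ n :> R by rewrite !exprn_gt0.
have hh : 0 <= (2^-1 : R) < 1 by apply/andP; split; lra.
move=> /(_ hh) h.
have {}h : absC (c n - d n) ^+ 2 * 2^-1 ^+ 2 ^+ n <= 0 by lra.
by move: h; rewrite pmulr_lle0 // => h; rewrite -sqrf_eq0 eq_le sqr_ge0 h.
Qed.

End Parseval.

(** * Dirichlet energy *)

Section Energy.
Context {R : realType}.
Implicit Types (c d : nat -> C R) (f g : C R -> C R) (w h z : C R) (r K L : R).

(** Squared H^2 norm at most L and, for [dsum], Dirichlet integral at most K. As bounds on all
    partial sums they survive coefficientwise limits. *)
Definition lsum c L := forall N, \sum_(n < N) absC (c n) ^+ 2 <= L.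
Definition dsum c K := forall N, \sum_(n < N) n%:R * absC (c n) ^+ 2 <= K.

Lemma S2_1 c N : S2 c 1 N = \sum_(n < N) absC (c n) ^+ 2.
Proof. by apply: eq_bigr => n _; rewrite expr1n mulr1. Qed.

Lemma S2_le1 c (x : R) N : 0 <= x <= 1 -> S2 c x N <= S2 c 1 N.
Proof.
move=> /andP[x0 x1]; apply: ler_sum => n _; rewrite expr1n mulr1.
by rewrite -[leRHS]mulr1 ler_wpM2l ?exprn_ge0 ?absC_ge0 // exprn_ile1.
Qed.

Lemma sqr_01 r : 0 <= r < 1 -> 0 <= r ^+ 2 < 1.
Proof. by move=> /andP[r0 r1]; rewrite sqr_ge0 expr_lt1. Qed.

Lemma lsum_Nf f L r : analytic f -> lsum (coef f) L -> 0 <= r < 1 -> Nf f r <= L.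
Proof.
move=> af hL hr; apply: (Nf_le (coef_pbd af) (cauchy_ps af) hr) => N.
apply: le_trans (hL N); rewrite -S2_1; apply: S2_le1.
by have /andP[-> /ltW ->] := sqr_01 hr.
Qed.

Lemma cvg_sumr (T : Type) (F : set_system T) {FF : Filter F} n (u : 'I_n -> T -> R) (l : 'I_n -> R) :
  (forall i, u i @ F --> l i) -> (fun x => \sum_i u i x) @ F --> \sum_i l i.
Proof.
elim: n u l => [|n ih] u l h.
  by rewrite big_ord0; under eq_fun do rewrite big_ord0; exact: cvg_cst.
rewrite big_ord_recr; under eq_fun do rewrite big_ord_recr.
by apply: cvgD; [apply: (ih (fun i => u (widen_ord (leqnSn n) i))) => i|]; exact: h.
Qed.

Lemma cvg_poly_left (N : nat) (a : nat -> R) (p : nat -> nat) :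
  \sum_(n < N) a n * r ^+ p n @[r --> 1^'-] --> \sum_(n < N) a n.
Proof.
have -> : \sum_(n < N) a n = \sum_(n < N) a n * 1 ^+ p n.
  by apply: eq_bigr => n _; rewrite expr1n mulr1.
have h (n : 'I_N) : (fun r : R => a n * r ^+ p n) @ (1 : R) --> a n * 1 ^+ p n.
  apply: (@cvgM _ _ (nbhs (1 : R)) _ (fun=> a n)); first exact: cvg_cst.
  exact: exprn_continuous.
apply: cvg_at_left_filter; exact: (cvg_sumr h).
Qed.

Lemma near_left01 : \forall r \near (1 : R)^'-, 0 <= r < 1.
Proof.
near=> r; apply/andP; split; first by apply: ltW; near: r; exact: nbhs_left_gt.
by near: r; exact: nbhs_left_lt.
Unshelve. all: by end_near.
Qed.

Lemma Nf_lsum f L : analytic f -> (forall r, 0 <= r < 1 -> Nf f r <= L) -> lsum (coef f) L.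
Proof.
move=> af h N.
apply: (@cvg_ub _ _ _ _ _ _ _ (@cvg_poly_left N (fun n => absC (coef f n) ^+ 2) (fun n => (2 * n)%N))).
apply: filterS near_left01 => r hr; apply: le_trans (h r hr).
apply: le_trans (S2_le_Nf N (coef_pbd af) (cauchy_ps af) hr).
by apply: ler_sum => n _; rewrite exprM.
Qed.

Lemma one_sub_expr (x : R) n : 1 - x ^+ n = (1 - x) * \sum_(j < n) x ^+ j.
Proof. by rewrite -opprB subrX1 -mulNr opprB. Qed.

(** Termwise, 1 - x ^ n <= n (1 - x) with x = r ^ 2. The L produced is the supremum of the partial
    sums, the exact H^2 mass. *)
Lemma dsum_sup f K : analytic f -> dsum (coef f) K ->
  exists2 L, lsum (coef f) L & forall r, 0 <= r < 1 -> L - Nf f r <= K * (1 - r ^+ 2).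
Proof.
move=> af hK; set c := coef f.
have key r N : 0 <= r < 1 -> \sum_(n < N) absC (c n) ^+ 2 <= Nf f r + K * (1 - r ^+ 2).
  move=> hr; have /andP[x0 x1] := sqr_01 hr; set x := r ^+ 2 in x0 x1 *.
  apply: (@le_trans _ _ (S2 c x N + K * (1 - x))); last first.
    by rewrite lerD2r; exact: S2_le_Nf (coef_pbd af) (cauchy_ps af) hr.
  rewrite addrC -lerBlDr /S2 -sumrB.
  apply: (@le_trans _ _ ((\sum_(n < N) n%:R * absC (c n) ^+ 2) * (1 - x))); last first.
    by rewrite ler_wpM2r ?hK // subr_ge0 ltW.
  rewrite mulr_suml; apply: ler_sum => n _.
  rewrite -{1}[absC _ ^+ 2]mulr1 -mulrBr one_sub_expr mulrCA mulrC -mulrA.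
  rewrite [leRHS](_ : _ = absC (c n) ^+ 2 * ((1 - x) * n%:R)); last by ring.
  rewrite [leLHS](_ : _ = absC (c n) ^+ 2 * ((1 - x) * \sum_(j < n) x ^+ j)); last by ring.
  rewrite ler_wpM2l ?exprn_ge0 ?absC_ge0 // ler_wpM2l ?subr_ge0 ?(ltW x1) //.
  rewrite -[leRHS](_ : \sum_(j < n) 1 = _); last by rewrite sumr_const card_ord.
  by apply: ler_sum => j _; rewrite exprn_ile1 // ltW.
have h0 : 0 <= (0 : R) < 1 by rewrite lexx ltr01.
pose A := range (fun N => \sum_(n < N) absC (c n) ^+ 2).
have hA : has_sup A.
  split; first by exists (\sum_(n < 0) absC (c n) ^+ 2); exists 0%N.
  by exists (Nf f 0 + K * (1 - 0 ^+ 2)) => _ [N _ <-]; exact: key.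
exists (sup A).
  by move=> N; apply: sup_upper_bound => //; exists N.
move=> r hr; rewrite lerBlDr addrC; apply: ge_sup; first exact: hA.1.
by move=> _ [N _ <-]; exact: key.
Qed.

(** Divided by 1 - r ^ 2, the defect 1 - r ^ (2n) becomes a sum of n powers that tends to n as r ->
    1. Any bound L on the mass is accepted, so that several functions can be measured against the
    same L. *)
Lemma sup_dsum f K L : analytic f -> lsum (coef f) L ->
  (forall r, 0 <= r < 1 -> L - Nf f r <= K * (1 - r ^+ 2)) -> dsum (coef f) K.
Proof.
move=> af hL hK N; set c := coef f.
have key r : 0 <= r < 1 ->
    \sum_(n < N) absC (c n) ^+ 2 * (\sum_(j < n) (r ^+ 2) ^+ j) <= K.
  move=> hr; have /andP[x0 x1] := sqr_01 hr; have hKr := hK r hr.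
  set x := r ^+ 2 in x0 x1 hKr *.
  have h1 : Nf f r <= L - \sum_(n < N) absC (c n) ^+ 2 * (1 - x ^+ n).
    apply: (cvg_ub (parseval (coef_pbd af) (cauchy_ps af) hr)).
    exists N => // M /= NM.
    rewrite lerBrDr; apply: le_trans (hL M).
    rewrite -(subnKC NM) /S2 !big_split_ord /= addrAC; apply: lerD.
      rewrite -big_split /= le_eqVlt; apply/orP; left; apply/eqP.
      by apply: eq_bigr => i _; ring.
    apply: ler_sum => i _; rewrite -[leRHS]mulr1 ler_wpM2l ?exprn_ge0 ?absC_ge0 //.
    by rewrite exprn_ile1 // ltW.
  have hx : 0 < 1 - x by rewrite subr_gt0.
  rewrite -(ler_pM2r hx); apply: le_trans hKr.
  apply: (@le_trans _ _ (\sum_(n < N) absC (c n) ^+ 2 * (1 - x ^+ n))); last by lra.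
  rewrite mulr_suml le_eqVlt; apply/orP; left; apply/eqP; apply: eq_bigr => i _.
  by rewrite one_sub_expr; ring.
have cv : \sum_(n < N) absC (c n) ^+ 2 * (\sum_(j < n) (r ^+ 2) ^+ j) @[r --> (1 : R)^'-] -->
    \sum_(n < N) n%:R * absC (c n) ^+ 2.
  apply: (@cvg_sumr _ (1^'-) _ N (fun n r => absC (c n) ^+ 2 * (\sum_(j < n) (r ^+ 2) ^+ j))) => n.
  rewrite [n%:R * _]mulrC.
  apply: (@cvgM _ _ (1^'-) _ (fun=> absC (c n) ^+ 2)); first exact: cvg_cst.
  have -> : (fun r : R => \sum_(j < n) (r ^+ 2) ^+ j) =
      (fun r : R => \sum_(j < n) (fun=> 1) j * r ^+ ((fun j => (2 * j)%N) (nat_of_ord j))).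
    by apply/funext => r; apply: eq_bigr => j _; rewrite mul1r exprM.
  rewrite -[n%:R](_ : \sum_(j < n) (fun=> 1) (nat_of_ord j) = _).
    exact: (@cvg_poly_left n (fun=> 1) (fun j => (2 * j)%N)).
  by rewrite sumr_const card_ord.
by apply: (cvg_ub cv); apply: filterS near_left01.
Qed.

Lemma cont_analytic_circ f r : analytic f -> 0 <= r < 1 -> continuous (fun t => f (polarC r t)).
Proof. by move=> af; exact: cont_circ_ps (coef_pbd af) (cauchy_ps af). Qed.

(* With F = S h and g = B F: the mass lost from F to g is at most the mass lost from h to F,
   so multiplying by B at most doubles the Dirichlet integral. *)
Lemma dsum_mul (F h g : C R -> C R) K L : analytic F -> analytic h -> analytic g ->
  lsum (coef F) L -> (forall r, 0 <= r < 1 -> L - Nf F r <= K * (1 - r ^+ 2)) ->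
  (forall r, 0 <= r < 1 -> Nf h r <= L) ->
  (forall w, disc w -> absC (g w) <= absC (F w)) ->
  (forall w, disc w -> absC (F w) ^+ 2 - absC (g w) ^+ 2 <= absC (h w) ^+ 2 - absC (F w) ^+ 2) ->
  lsum (coef g) L /\ dsum (coef g) (2 * K).
Proof.
move=> aF ah ag hL hK hh gF gFh.
have dp r t : 0 <= r < 1 -> disc (polarC r t).
  by move=> /andP[r0 r1]; rewrite discE absC_polar_ge0.
have gL : lsum (coef g) L.
  apply: Nf_lsum => // r hr; apply: le_trans (lsum_Nf aF hL hr).
  apply: avg_le; [exact: cont_abs2P (cont_analytic_circ ag hr)|
    exact: cont_abs2P (cont_analytic_circ aF hr)|].
  by move=> t; rewrite lerXn2r ?nnegrE ?absC_ge0 // gF //; exact: dp.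
split => //; apply: (sup_dsum ag gL) => r hr.
have cF := cont_abs2P (cont_analytic_circ aF hr).
have cg := cont_abs2P (cont_analytic_circ ag hr).
have ch := cont_abs2P (cont_analytic_circ ah hr).
have : avg (fun t => absC (F (polarC r t)) ^+ 2 - absC (g (polarC r t)) ^+ 2) <=
    avg (fun t => absC (h (polarC r t)) ^+ 2 - absC (F (polarC r t)) ^+ 2).
  apply: avg_le; [exact: contBr cF cg|exact: contBr ch cF|].
  by move=> t; apply: gFh; exact: dp.
rewrite (avgB cF cg) (avgB ch cF) -![avg _]/(Nf _ r).
by have := hK r hr; have := hh r hr; lra.
Qed.

(* f = b g with b a Blaschke factor, 1 - |b|^2 <= C0 (1 - |w|^2) *)
Lemma dsum_div (f g : C R -> C R) (C0 K L : R) : analytic f -> analytic g -> 0 <= C0 ->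
  (forall w, disc w -> absC (f w) <= absC (g w)) ->
  (forall w, disc w -> absC (g w) ^+ 2 * (1 - C0 * (1 - absC w ^+ 2)) <= absC (f w) ^+ 2) ->
  lsum (coef f) L -> dsum (coef f) K -> lsum (coef g) L /\ dsum (coef g) K.
Proof.
move=> af ag C00 fg gf hL hK.
have dp r t : 0 <= r < 1 -> disc (polarC r t).
  by move=> /andP[r0 r1]; rewrite discE absC_polar_ge0.
have lg L' : lsum (coef f) L' -> lsum (coef g) L'.
  move=> hL'; apply: Nf_lsum => // r /andP[r0 r1].
  (* For r < s the mean of |g|^2 at r is at most the one at s, where the hypothesis compares it with
     f; letting s -> 1 removes the factor. *)
  have cv : Nf g r * (1 - C0 * (1 - s ^+ 2)) @[s --> (1 : R)^'-] --> Nf g r.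
    rewrite -[X in _ --> X]mulr1; apply: (@cvgM _ _ (1^'-) _ (fun=> Nf g r)); first exact: cvg_cst.
    have h : (fun s : R => 1 - C0 * (1 - s ^+ 2)) @ (1 : R) --> 1 - C0 * (1 - 1 ^+ 2).
      apply: cvgB; first exact: cvg_cst.
      apply: cvgM; first exact: cvg_cst.
      apply: cvgB; first exact: cvg_cst.
      exact: exprn_continuous.
    rewrite expr1n subrr mulr0 subr0 in h; exact: cvg_at_left_filter h.
  apply: (cvg_ub cv).
  have hs0 : \forall s \near (1 : R)^'-, r < s by exact: nbhs_left_gt.
  apply: filterS2 hs0 near_left01 => s rs hs; have /andP[s0 s1] := hs.
  have [neg|pos] := ltP (1 - C0 * (1 - s ^+ 2)) 0.
    apply: le_trans (_ : 0 <= _); first by rewrite nmulr_lle0 // Nf_ge0.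
    by apply: le_trans (hL' 0%N); rewrite big_ord0.
  apply: (@le_trans _ _ (Nf g s * (1 - C0 * (1 - s ^+ 2)))).
    rewrite ler_wpM2r //; apply: Nf_mono (coef_pbd ag) (cauchy_ps ag) r0 (ltW rs) s1.
  apply: le_trans (lsum_Nf af hL' hs); rewrite mulrC.
  have cg := cont_abs2P (cont_analytic_circ ag hs).
  rewrite -(avgZ _ cg); apply: avg_le; [exact: contMr (@contKr _ _) cg|
    exact: cont_abs2P (cont_analytic_circ af hs)|].
  move=> t; have := gf _ (dp s t hs); rewrite absC_polar_ge0 // mulrC; exact.
split; first exact: lg.
(* The exact mass L' of f also bounds the mass of g. As |f| <= |g|, the deficit of g from L' is the
   smaller one. *)
have [L' hL' hK'] := dsum_sup af hK.
apply: (sup_dsum ag (lg _ hL')) => r hr; apply: le_trans (hK' r hr).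
rewrite lerD2l lerN2; apply: avg_le; [exact: cont_abs2P (cont_analytic_circ af hr)|
    exact: cont_abs2P (cont_analytic_circ ag hr)|].
by move=> t; rewrite lerXn2r ?nnegrE ?absC_ge0 // fg //; exact: dp.
Qed.

End Energy.

(** * The area formula *)

Definition shiftr {R : realType} (a : R) (x : measurableTypeR R) : measurableTypeR R := x + a.

Lemma measurable_shiftr {R : realType} (a : R) : measurable_fun setT (@shiftr R a).
Proof.
apply: continuous_measurable_fun => x.
by apply: cvgD; [exact: cvg_id|exact: cvg_cst].
Qed.

HB.instance Definition _ {R : realType} (a : R) :=
  @isMeasurableFun.Build _ _ _ _ (@shiftr R a) (@measurable_shiftr R a).

(** * Rotation invariance of planar Lebesgue measure *)

Section Rotation.
Context {R : realType}.
Notation mu := (@lebesgue_measure R).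
Notation mu2 := (@lebesgue_measure R \x @lebesgue_measure R)%E.
Local Open Scope ereal_scope.

Lemma lebesgue_translate (a : R) (A : set R) : measurable A ->
  mu A = pushforward mu (shiftr a) A.
Proof.
move: A; apply: lebesgue_measure_unique => X [[x y] _ <-] /=.
rewrite /pushforward.
have -> : shiftr a @^-1` `]x, y]%classic = `](x - a)%R, (y - a)%R]%classic.
  apply/seteqP; split => t /=; rewrite /shiftr !in_itv /= => /andP[h1 h2];
    by apply/andP; split; lra.
rewrite !lebesgue_measure_itv /= !lte_fin ltrD2r; case: ifP => // _.
by rewrite -!EFinB; congr EFin; ring.
Qed.

Lemma integral_translate (a : R) (f : R -> \bar R) : measurable_fun setT f ->
  (forall x, 0 <= f x) -> \int[mu]_x f (x + a)%R = \int[mu]_x f x.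
Proof.
move=> mf f0.
transitivity (\int[mu]_(x in shiftr a @^-1` setT) (f \o shiftr a) x).
  by rewrite preimage_setT.
rewrite -ge0_integral_pushforward //=.
by apply: eq_measure_integral => //= A mA AS; exact/esym/lebesgue_translate.
Qed.

(** On each horizontal line the shear is a translation, so Tonelli reduces the claim to dimension
    one. *)
Lemma integral_shearx (k : R) (f : R * R -> \bar R) : measurable_fun setT f ->
  (forall p, 0 <= f p) -> \int[mu2]_p f (p.1 + k * p.2, p.2)%R = \int[mu2]_p f p.
Proof.
move=> mf f0.
have mg : measurable_fun setT (fun p : R * R => f (p.1 + k * p.2, p.2)%R).
  apply: measurableT_comp => //; apply: measurable_fun_pair; last exact: measurable_snd.
  apply: measurable_funD; first exact: measurable_fst.
  by apply: measurable_funM; [exact: measurable_cst|exact: measurable_snd].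
rewrite fubini_tonelli2; [|exact: mg|by move=> p; exact: f0].
rewrite [RHS]fubini_tonelli2; [|exact: mf|exact: f0].
apply: eq_integral => y _; rewrite /fubini_G /=.
rewrite (@integral_translate (k * y)%R (fun x => f (x, y))) //.
by apply: measurableT_comp => //; exact: pair2_measurable.
Qed.

Lemma integral_sheary (k : R) (f : R * R -> \bar R) : measurable_fun setT f ->
  (forall p, 0 <= f p) -> \int[mu2]_p f (p.1, p.2 + k * p.1)%R = \int[mu2]_p f p.
Proof.
move=> mf f0.
have mg : measurable_fun setT (fun p : R * R => f (p.1, p.2 + k * p.1)%R).
  apply: measurableT_comp => //; apply: measurable_fun_pair; first exact: measurable_fst.
  apply: measurable_funD; first exact: measurable_snd.
  by apply: measurable_funM; [exact: measurable_cst|exact: measurable_fst].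
rewrite fubini_tonelli1; [|exact: mg|by move=> p; exact: f0].
rewrite [RHS]fubini_tonelli1; [|exact: mf|exact: f0].
apply: eq_integral => x _; rewrite /fubini_F /=.
rewrite (@integral_translate (k * x)%R (fun y => f (x, y))) //.
by apply: measurableT_comp => //; exact: pair1_measurable.
Qed.

Definition rotR (c s : R) (p : R * R) : R * R :=
  (c * p.1 - s * p.2, s * p.1 + c * p.2)%R.

Lemma measurable_rot (c s : R) : measurable_fun setT (rotR c s).
Proof.
apply: measurable_fun_pair.
  apply: measurable_funB; apply: measurable_funM;
    by [exact: measurable_cst|exact: measurable_fst|exact: measurable_snd].
apply: measurable_funD; apply: measurable_funM;
  by [exact: measurable_cst|exact: measurable_fst|exact: measurable_snd].
Qed.

Lemma integral_rot_neq (c s : R) (f : R * R -> \bar R) : (c ^+ 2 + s ^+ 2 = 1)%R -> (c != -1)%R ->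
  measurable_fun setT f -> (forall p, 0 <= f p) ->
  \int[mu2]_p f (rotR c s p) = \int[mu2]_p f p.
Proof.
move=> cs c1 mf f0.
have hc : (1 + c != 0)%R by rewrite addrC -(opprK 1%R) subr_eq0.
(* For c = cos theta and s = sin theta this is - tan (theta / 2), hence the exclusion of c = -1. *)
pose k := (- (s / (1 + c)))%R.
have mg : measurable_fun setT (fun p : R * R => f (p.1 + k * p.2, p.2)%R).
  apply: measurableT_comp => //; apply: measurable_fun_pair; last exact: measurable_snd.
  apply: measurable_funD; first exact: measurable_fst.
  by apply: measurable_funM; [exact: measurable_cst|exact: measurable_snd].
have mh : measurable_fun setT (fun p : R * R => f (p.1 + k * (p.2 + s * p.1), (p.2 + s * p.1))%R).
  have hs : measurable_fun setT (fun p : R * R => (p.1, p.2 + s * p.1)%R).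
    apply: measurable_fun_pair; first exact: measurable_fst.
    apply: measurable_funD; first exact: measurable_snd.
    by apply: measurable_funM; [exact: measurable_cst|exact: measurable_fst].
  exact: (measurableT_comp mg hs).
(* a rotation by an angle other than pi is a product of three shears *)
rewrite -(integral_shearx k mf f0).
rewrite -(integral_sheary s mg (fun p => f0 _)) /=.
rewrite -(integral_shearx k mh (fun p => f0 _)) /=.
have ks : (k * s = c - 1)%R.
  rewrite /k mulNr mulrAC; apply/eqP; rewrite eqr_oppLR; apply/eqP.
  by apply: (mulIf hc); rewrite divfK //; lra.
have kc : (k * (1 + c) = - s)%R by rewrite /k mulNr divfK.
have e1 (x y : R) : (c * x - s * y = x + k * y + k * (y + s * (x + k * y)))%R.
  have -> : (x + k * y + k * (y + s * (x + k * y)) =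
      x * (1 + k * s) + y * (k * (1 + c) + k * (k * s - c + 1)))%R by ring.
  by rewrite kc ks; ring.
have e2 (x y : R) : (s * x + c * y = y + s * (x + k * y))%R.
  have -> : (y + s * (x + k * y) = s * x + y * (1 + k * s))%R by ring.
  by rewrite ks; ring.
by apply: eq_integral => -[x y] _; congr f; rewrite /rotR /= -e1 -e2.
Qed.

Lemma integral_rot (c s : R) (f : R * R -> \bar R) : (c ^+ 2 + s ^+ 2 = 1)%R ->
  measurable_fun setT f -> (forall p, 0 <= f p) ->
  \int[mu2]_p f (rotR c s p) = \int[mu2]_p f p.
Proof.
move=> cs mf f0; have [c1|c1] := eqVneq c (-1)%R; last exact: integral_rot_neq.
have s0 : s = 0%R.
  by apply/eqP; rewrite -sqrf_eq0; apply/eqP; move: cs; rewrite c1; lra.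
(* The half-turn is the quarter-turn applied twice. *)
have h01 : ((0 : R) ^+ 2 + 1 ^+ 2 = 1)%R by lra.
have n01 : ((0 : R) != -1)%R by rewrite eq_sym oppr_eq0 oner_eq0.
have mr : measurable_fun setT (fun p => f (rotR 0 1 p)).
  by apply: measurableT_comp => //; exact: measurable_rot.
rewrite -(integral_rot_neq h01 n01 mf f0) -(integral_rot_neq h01 n01 mr (fun p => f0 _)).
apply: eq_integral => -[x y] _; congr f; rewrite /rotR /= c1 s0.
by congr (_, _); ring.
Qed.

End Rotation.

(** * Size of the integral of |z|^(2n) over the disc *)

Section Area.
Context {R : realType}.
Notation mu := (@lebesgue_measure R).
Notation mu2 := (@lebesgue_measure R \x @lebesgue_measure R)%E.
Implicit Types (p : R * R) (g h : R * R -> R).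

Definition sqn (p : R * R) : R := p.1 ^+ 2 + p.2 ^+ 2.
Definition indisc (p : R * R) : bool := sqn p < 1.
Definition trunc g p : R := if indisc p then g p else 0.

Lemma sqn_ge0 p : 0 <= sqn p. Proof. by rewrite addr_ge0 // sqr_ge0. Qed.

Lemma measurable_sqn : measurable_fun setT sqn.
Proof.
by apply: measurable_funD; apply: measurable_funX; [exact: measurable_fst|exact: measurable_snd].
Qed.

Lemma measurable_trunc g : measurable_fun setT g -> measurable_fun setT (trunc g).
Proof.
move=> mg; apply: measurable_fun_ifT => //.
by apply: measurable_fun_ltr; [exact: measurable_sqn|exact: measurable_cst].
Qed.

Lemma measurable_truncE g : measurable_fun setT g -> measurable_fun setT (fun p => (trunc g p)%:E).
Proof. by move=> mg; apply/measurable_EFinP; exact: measurable_trunc. Qed.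

Lemma trunc_ge0 g p : (forall p, 0 <= g p) -> 0 <= trunc g p.
Proof. by move=> g0; rewrite /trunc; case: ifP. Qed.

Definition dint g : \bar R := (\int[mu2]_p (trunc g p)%:E)%E.
(** The exact value is pi / (n + 1). Finiteness of the Dirichlet integral only depends on the order
    1 / (n + 1), which [Kn_lo] and [Kn_hi] provide with the constants 1/16 and 8. *)
Definition Kn (n : nat) : \bar R := dint (fun p => sqn p ^+ n).

Lemma measurable_Kn n : measurable_fun setT (fun p => sqn p ^+ n).
Proof. by apply: measurable_funX; exact: measurable_sqn. Qed.

Lemma is_derive_Kn (y x : R) n :
  is_derive x 1 (fun x : R => (x ^+ 2 + y ^+ 2) ^+ n.+1 / (2 * n.+1%:R)) (x * (x ^+ 2 + y ^+ 2) ^+ n).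
Proof.
have h0 : is_derive x 1 (fun x : R => x ^+ 2) (2 * x).
  have h := @is_deriveX R R id 2 x 1 1 (is_derive_id x 1).
  have e : (2%:R * id x ^+ 1) *: (1 : R) = 2 * x by rewrite expr1 -[_ *: _]/(_ * _) mulr1.
  exact: is_derive_eq h e.
have h1 : is_derive x 1 (fun x : R => x ^+ 2 + y ^+ 2) (2 * x).
  have h := @is_deriveD _ _ _ (fun x : R => x ^+ 2) (cst (y ^+ 2)) x 1 _ _ h0 (is_derive_cst _ _ _).
  exact: is_derive_eq h (addr0 _).
have h2 : is_derive x 1 (fun x : R => (x ^+ 2 + y ^+ 2) ^+ n.+1)
    ((n.+1%:R * (x ^+ 2 + y ^+ 2) ^+ n) * (2 * x)).
  have -> : (fun x : R => (x ^+ 2 + y ^+ 2) ^+ n.+1) = (fun x : R => x ^+ 2 + y ^+ 2) ^+ n.+1.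
    by rewrite exprfctE.
  exact: (@is_deriveX R R (fun x : R => x ^+ 2 + y ^+ 2) n.+1 x 1 _ h1).
have h3 := @is_deriveM R R (fun x : R => (x ^+ 2 + y ^+ 2) ^+ n.+1) (cst (2 * n.+1%:R)^-1) x 1 _ _
  h2 (is_derive_cst _ _ _).
apply: is_derive_eq h3 _.
rewrite /= scaler0 add0r -[_ *: _]/((2 * n.+1%:R)^-1 * ((n.+1%:R * (x ^+ 2 + y ^+ 2) ^+ n) * (2 * x))).
by field; rewrite addrC natr1 pnatr_eq0.
Qed.

Lemma con_Kn (y a b : R) n : con a b (fun x => x * (x ^+ 2 + y ^+ 2) ^+ n).
Proof.
apply: cont_con; apply: contMr; first by move=> x; exact: cvg_id.
have c2 : continuous (fun x : R => x ^+ 2 + y ^+ 2).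
  by apply: contDr; [exact: exprn_continuous|exact: contKr].
move=> x; apply: (continuous_comp (f := fun x : R => x ^+ 2 + y ^+ 2) (g := fun u : R => u ^+ n)).
  exact: c2.
exact: exprn_continuous.
Qed.

Lemma itg_Kn (y b : R) n : 0 < b ->
  itg 0 b (fun x => x * (x ^+ 2 + y ^+ 2) ^+ n) =
  ((b ^+ 2 + y ^+ 2) ^+ n.+1 - y ^+ 2 ^+ n.+1) / (2 * n.+1%:R).
Proof.
move=> b0; rewrite (itg_FTC b0 (@con_Kn y 0 b n) (fun x _ => is_derive_Kn y x n)).
by rewrite expr0n /= add0r mulrBl.
Qed.

Lemma itg_KnN (y b : R) n : 0 < b ->
  itg (- b) 0 (fun x => - (x * (x ^+ 2 + y ^+ 2) ^+ n)) =
  ((b ^+ 2 + y ^+ 2) ^+ n.+1 - y ^+ 2 ^+ n.+1) / (2 * n.+1%:R).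
Proof.
move=> b0; have nb0 : - b < 0 by rewrite oppr_lt0.
under [itg _ _ _]eq_itg do rewrite -mulN1r.
rewrite itgZ; last exact: con_Kn.
rewrite (itg_FTC nb0 (@con_Kn y (- b) 0 n) (fun x _ => is_derive_Kn y x n)).
by rewrite expr0n /= add0r sqrrN; ring.
Qed.

(* the antiderivative of x (x^2 + y^2)^n stands in for polar coordinates *)
Lemma slice_lo (y : R) n : 0 <= y <= 2^-1 ->
  ((8 * n.+1%:R)^-1%:E <= \int[mu]_x (trunc (fun p => sqn p ^+ n) (x, y))%:E)%E.
Proof.
move=> /andP[y0 y1]; pose b := Num.sqrt (1 - y ^+ 2).
have y2 : y ^+ 2 <= 4^-1.
  rewrite (_ : 4^-1 = 2^-1 ^+ 2); last by rewrite exprVn -natrX.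
  by rewrite lerXn2r // nnegrE //; lra.
have b2 : b ^+ 2 = 1 - y ^+ 2 by rewrite sqr_sqrtr //; lra.
have b0 : 0 < b by rewrite sqrtr_gt0; lra.
have b1 : b <= 1.
  by rewrite -[leRHS]sqrtr1 ler_wsqrtr // gerBl sqr_ge0.
have mt : measurable_fun setT (fun x => (trunc (fun p => sqn p ^+ n) (x, y))%:E).
  by apply: measurableT_comp (measurable_truncE (measurable_Kn n)) _; exact: pair2_measurable.
have t0 x : (0 <= (trunc (fun p => sqn p ^+ n) (x, y))%:E)%E.
  by rewrite lee_fin trunc_ge0 // => p; rewrite exprn_ge0 // sqn_ge0.
(* The end b lies on the unit circle, outside [indisc], hence the half-open interval. *)
apply: (@le_trans _ _ (\int[mu]_(x in `[0%R, b[) (trunc (fun p => sqn p ^+ n) (x, y))%:E)%E); last first.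
  by apply: ge0_subset_integral.
have ic := con_integrable (@con_Kn y 0 b n).
have mc : measurable_fun `[0, b] (EFin \o (fun x => x * (x ^+ 2 + y ^+ 2) ^+ n)) by case/integrableP: ic.
(* As x < b <= 1, the factor x lowers the integrand and gives it an elementary antiderivative. *)
apply: (@le_trans _ _ (\int[mu]_(x in `[0%R, b[) (x * (x ^+ 2 + y ^+ 2) ^+ n)%:E)%E).
  rewrite integral_itv_bndo_bndc; last first.
    by apply: measurable_funS mc => //; apply: subset_itvl; rewrite bnd_simp.
  have fin : (\int[mu]_(x in `[0%R, b]) (x * (x ^+ 2 + y ^+ 2) ^+ n)%:E)%E \is a fin_num.
    exact: integrable_fin_num ic.
  rewrite -(fineK fin) lee_fin -[fine _]/(itg 0 b _) itg_Kn // b2 subrK expr1n.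
  rewrite ler_pdivlMr ?mulr_gt0 // invfM mulrACA mulVf ?pnatr_eq0 // mulr1.
  have : (y ^+ 2) ^+ n.+1 <= y ^+ 2.
    rewrite exprS -[leRHS]mulr1 ler_wpM2l ?sqr_ge0 // exprn_ile1 ?sqr_ge0 //; lra.
  by lra.
apply: ge0_le_integral => //.
- by move=> x; rewrite /= in_itv /= => /andP[x0 _]; rewrite lee_fin mulr_ge0 // exprn_ge0 // addr_ge0 // sqr_ge0.
- by apply: measurable_funS mc => //; apply: subset_itvl; rewrite bnd_simp.
- by apply: measurable_funS mt.
- move=> x; rewrite /= in_itv /= => /andP[x0 xb]; rewrite lee_fin /trunc /indisc /sqn /=.
  rewrite (_ : _ < 1); last first.
    have : x ^+ 2 < b ^+ 2 by rewrite ltrXn2r // nnegrE // ltW.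
    by rewrite b2; lra.
  rewrite -[leRHS]mul1r ler_wpM2r ?exprn_ge0 ?addr_ge0 ?sqr_ge0 //.
  exact: le_trans (ltW xb) b1.
Qed.

Lemma measurable_slice g (y : R) : measurable_fun setT g ->
  measurable_fun setT (fun x => (trunc g (x, y))%:E).
Proof.
by move=> mg; apply: measurableT_comp (measurable_truncE mg) _; exact: pair2_measurable.
Qed.

Lemma measurable_sliceF g : measurable_fun setT g -> (forall p, 0 <= g p) ->
  measurable_fun setT (fun y => \int[mu]_x (trunc g (x, y))%:E)%E.
Proof.
move=> mg g0; apply: (@measurable_fun_fubini_tonelli_G _ _ _ _ _ mu (fun p => (trunc g p)%:E)).
  exact: measurable_truncE.
by move=> p; rewrite lee_fin trunc_ge0.
Qed.

Lemma integral_itv_le (f : R -> \bar R) (a b M : R) : a <= b -> measurable_fun setT f ->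
  (forall x, (0 <= f x)%E) -> (forall x, a <= x <= b -> (f x <= M%:E)%E) ->
  (forall x, ~ (a <= x <= b) -> f x = 0%E) -> (\int[mu]_x f x <= (M * (b - a))%:E)%E.
Proof.
move=> ab mf f0 fM fz.
have -> : (\int[mu]_x f x)%E = (\int[mu]_(x in `[a, b]) f x)%E.
  rewrite [RHS]integral_mkcond; apply: eq_integral => x _; rewrite patchE.
  case: ifPn => //; rewrite notin_setE /= in_itv /= => /negP h.
  by apply: fz; apply/negP.
apply: (@le_trans _ _ (\int[mu]_(x in `[a, b]) (cst M%:E) x)%E).
  by apply: ge0_le_integral => //; exact: measurable_funS mf.
rewrite integral_cst //= lebesgue_measure_itv /= lte_fin.
case: ltP => [_|ba]; first by rewrite -EFinB -EFinM.
by rewrite mule0 lee_fin (_ : b = a) ?subrr ?mulr0 //; apply/le_anti; rewrite ab ba.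
Qed.

Lemma dint_slice g (M : R) : measurable_fun setT g -> (forall p, 0 <= g p) ->
  (forall y, y ^+ 2 < 1 -> (\int[mu]_x (trunc g (x, y))%:E <= M%:E)%E) ->
  (dint g <= (2 * M)%:E)%E.
Proof.
move=> mg g0 h; rewrite /dint fubini_tonelli2; first last.
- by move=> p; rewrite lee_fin trunc_ge0.
- exact: measurable_truncE.
rewrite /fubini_G /= (_ : 2 * M = M * (1 - (- 1))); last by ring.
have sl0 (y : R) : ~ (y ^+ 2 < 1) -> (\int[mu]_x (trunc g (x, y))%:E)%E = 0%E.
  move=> /negP; rewrite -leNgt => y1; apply: integral0_eq => x _.
  rewrite /trunc /indisc /sqn /= ltNge (le_trans y1) //.
  by rewrite lerDr sqr_ge0.
have M0 : 0 <= M.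
  rewrite -lee_fin; apply: le_trans (h 0 _); last by rewrite expr0n /= ltr01.
  by apply: integral_ge0 => x _; rewrite lee_fin trunc_ge0.
apply: integral_itv_le; first lra.
- exact: measurable_sliceF.
- by move=> y; apply: integral_ge0 => x _; rewrite lee_fin trunc_ge0.
- move=> y _; have [y1|/negP y1] := boolP (y ^+ 2 < 1); first exact: h.
  by rewrite sl0.
- move=> y hy; apply: sl0 => y1; apply: hy.
  by have := ltr_sqrt 1; rewrite -ler_norml -(ler_pXn2r (n := 2)) ?nnegrE // expr1n real_normK ?num_real // ltW.
Qed.

(** With the weight |x| the integrand has an elementary antiderivative in x, and likewise for |y| in
    [g2]. Since x^2 + y^2 <= |x| + |y| on the disc, the two together bound the integral of
    |z|^(2n+2). *)
Definition g1 (n : nat) (p : R * R) : R := `|p.1| * sqn p ^+ n.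
Definition g2 (n : nat) (p : R * R) : R := `|p.2| * sqn p ^+ n.

Lemma g1_ge0 n p : 0 <= g1 n p. Proof. by rewrite mulr_ge0 // exprn_ge0 // sqn_ge0. Qed.
Lemma g2_ge0 n p : 0 <= g2 n p. Proof. by rewrite mulr_ge0 // exprn_ge0 // sqn_ge0. Qed.
Lemma measurable_g1 n : measurable_fun setT (g1 n).
Proof.
apply: measurable_funM; last exact: measurable_Kn.
by apply: measurableT_comp; [apply: continuous_measurable_fun; exact: norm_continuous|exact: measurable_fst].
Qed.
Lemma measurable_g2 n : measurable_fun setT (g2 n).
Proof.
apply: measurable_funM; last exact: measurable_Kn.
by apply: measurableT_comp; [apply: continuous_measurable_fun; exact: norm_continuous|exact: measurable_snd].
Qed.

Lemma slice_hi (y : R) n : y ^+ 2 < 1 ->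
  (\int[mu]_x (trunc (g1 n) (x, y))%:E <= (n.+1%:R^-1)%:E)%E.
Proof.
move=> y2; pose b := Num.sqrt (1 - y ^+ 2).
have b2 : b ^+ 2 = 1 - y ^+ 2 by rewrite sqr_sqrtr //; lra.
have b0 : 0 < b by rewrite sqrtr_gt0; lra.
pose h x := `|x| * (x ^+ 2 + y ^+ 2) ^+ n.
have h0 x : 0 <= h x by rewrite mulr_ge0 // exprn_ge0 // addr_ge0 // sqr_ge0.
have ch : continuous h.
  apply: contMr; first exact: norm_continuous.
  move=> x; apply: (continuous_comp (f := fun x : R => x ^+ 2 + y ^+ 2) (g := fun u : R => u ^+ n)).
    by apply: contDr; [exact: exprn_continuous|exact: contKr].
  exact: exprn_continuous.
have ih : mu.-integrable `[- b, b] (EFin \o h) := con_integrable (@cont_con _ (- b) b h ch).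
have mg1 := measurable_g1 n.
apply: (@le_trans _ _ (\int[mu]_(x in `[(- b)%R, b]) (h x)%:E)%E).
  rewrite [leRHS]integral_mkcond; apply: ge0_le_integral => //.
  - by move=> x _; rewrite lee_fin trunc_ge0 // => p; rewrite /g1 mulr_ge0 // exprn_ge0 // sqn_ge0.
  - exact: measurable_slice.
  - apply/measurable_restrict => //.
    by rewrite setTI; case/integrableP: ih.
  move=> x _; rewrite patchE; case: ifPn => [_|].
    rewrite lee_fin /trunc; case: ifP => _ //; exact: h0.
  rewrite notin_setE /= in_itv /= => hx; rewrite /trunc ifF //; apply/negP.
  rewrite /indisc /sqn /= => hx1; apply: hx; rewrite -ler_norml.
  rewrite -(ler_pXn2r (n := 2)) ?nnegrE ?(ltW b0) // real_normK ?num_real // b2; lra.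
have fin : (\int[mu]_(x in `[(- b)%R, b]) (h x)%:E)%E \is a fin_num.
  exact: integrable_fin_num ih.
rewrite -(fineK fin) lee_fin -[fine _]/(itg (- b) b h).
rewrite (itg_split (c := 0)); [|lra|lra|exact: cont_con ch].
rewrite (@eq_itg _ (- b) 0 h (fun x => - (x * (x ^+ 2 + y ^+ 2) ^+ n))); last first.
  by move=> x /andP[_ x0]; rewrite /h ler0_norm // mulNr.
rewrite (@eq_itg _ 0 b h (fun x => x * (x ^+ 2 + y ^+ 2) ^+ n)); last first.
  by move=> x /andP[x0 _]; rewrite /h ger0_norm.
rewrite itg_KnN // itg_Kn // b2 subrK expr1n.
set X := (1 - _) / _; have : X <= (2 * n.+1%:R)^-1.
  rewrite /X ler_pdivrMr ?mulr_gt0 // mulVf ?mulf_neq0 ?pnatr_eq0 //.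
  by rewrite gerBl exprn_ge0 // sqr_ge0.
have -> : n.+1%:R^-1 = 2 * (2 * n.+1%:R)^-1 :> R by rewrite invfM mulrA divff ?mul1r.
by set Y := (_ * _)^-1; lra.
Qed.

Lemma dint_g1 n : (dint (g1 n) <= (2 * n.+1%:R^-1)%:E)%E.
Proof.
apply: dint_slice; [exact: measurable_g1|exact: g1_ge0|].
by move=> y hy; exact: slice_hi.
Qed.

Lemma dint_g2 n : dint (g2 n) = dint (g1 n).
Proof.
have m1 := measurable_truncE (measurable_g1 n).
have m2 := measurable_truncE (measurable_g2 n).
have p1 p : (0 <= (trunc (g1 n) p)%:E)%E by rewrite lee_fin; exact: trunc_ge0 (g1_ge0 n).
have p2 p : (0 <= (trunc (g2 n) p)%:E)%E by rewrite lee_fin; exact: trunc_ge0 (g2_ge0 n).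
rewrite /dint fubini_tonelli1; [|exact: m2|exact: p2].
rewrite [RHS]fubini_tonelli2; [|exact: m1|exact: p1].
apply: eq_integral => x _; apply: eq_integral => y _.
by rewrite /trunc /indisc /g1 /g2 /sqn /= [x ^+ 2 + _]addrC.
Qed.

Lemma dint_le g h : measurable_fun setT g -> measurable_fun setT h ->
  (forall p, 0 <= g p) -> (forall p, indisc p -> g p <= h p) -> (dint g <= dint h)%E.
Proof.
move=> mg mh g0 gh; apply: ge0_le_integral => //.
- by move=> p _; rewrite lee_fin trunc_ge0.
- exact: measurable_truncE.
- exact: measurable_truncE.
- by move=> p _; rewrite lee_fin /trunc; case: ifPn => // /gh.
Qed.

Lemma dintD g h : measurable_fun setT g -> measurable_fun setT h ->
  (forall p, 0 <= g p) -> (forall p, 0 <= h p) ->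
  dint (fun p => g p + h p) = (dint g + dint h)%E.
Proof.
move=> mg mh g0 h0; rewrite /dint -ge0_integralD //.
- by apply: eq_integral => p _; rewrite -EFinD /trunc; case: ifP => //; rewrite addr0.
- by move=> p _; rewrite lee_fin trunc_ge0.
- exact: measurable_truncE.
- by move=> p _; rewrite lee_fin trunc_ge0.
- exact: measurable_truncE.
Qed.

Lemma dintZ (k : R) g : measurable_fun setT g -> 0 <= k -> (forall p, 0 <= g p) ->
  dint (fun p => k * g p) = (k%:E * dint g)%E.
Proof.
move=> mg k0 g0; rewrite /dint -ge0_integralZl //.
- by apply: eq_integral => p _; rewrite -EFinM /trunc; case: ifP => //; rewrite mulr0.
- exact: measurable_truncE.
- by move=> p _; rewrite lee_fin trunc_ge0.
Qed.

Lemma Kn_hi n : (Kn n <= (8 / n.+1%:R)%:E)%E.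
Proof.
(* The case n = 0 is the area, at most that of the enclosing square; otherwise one factor |z|^2 is
   traded for |x| + |y|. *)
case: n => [|n].
  have : (Kn 0 <= (2 * 2)%:E)%E.
    apply: dint_slice; [exact: measurable_Kn|by move=> p; rewrite expr0|].
    move=> y _; rewrite [2](_ : _ = 1 * (1 - (- 1))); last by ring.
    apply: integral_itv_le; first lra.
    - by apply: measurable_slice; exact: measurable_Kn.
    - by move=> x; rewrite lee_fin trunc_ge0 // => p; rewrite expr0.
    - by move=> x _; rewrite lee_fin /trunc expr0; case: ifP.
    - move=> x hx; rewrite /trunc ifF //; apply/negP; rewrite /indisc /sqn /= => h.
      apply: hx; rewrite -ler_norml -(ler_pXn2r (n := 2)) ?nnegrE // expr1n real_normK ?num_real //.
      by have := sqr_ge0 y; lra.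
  by move/le_trans; apply; rewrite lee_fin; lra.
apply: (@le_trans _ _ (dint (g1 n) + dint (g2 n))%E).
  rewrite -dintD; [|exact: measurable_g1|exact: measurable_g2|exact: g1_ge0|exact: g2_ge0].
  apply: dint_le; [exact: measurable_Kn| |by move=> p; rewrite exprn_ge0 // sqn_ge0|].
    by apply: measurable_funD; [exact: measurable_g1|exact: measurable_g2].
  move=> p hp; rewrite /g1 /g2 -mulrDl exprS ler_wpM2r ?exprn_ge0 ?sqn_ge0 //.
  have aux (x : R) : x ^+ 2 < 1 -> x ^+ 2 <= `|x|.
    move=> x1; rewrite -real_normK ?num_real // expr2 -[leRHS]mulr1 ler_wpM2l //.
    by rewrite -(ler_pXn2r (n := 2)) ?nnegrE // expr1n real_normK ?num_real // ltW.
  have := sqr_ge0 p.1; have := sqr_ge0 p.2; move: hp; rewrite /indisc /sqn => hp ? ?.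
  by apply: lerD; apply: aux; lra.
rewrite dint_g2; apply: (@le_trans _ _ ((2 * n.+1%:R^-1)%:E + (2 * n.+1%:R^-1)%:E)%E).
  by apply: leeD; exact: dint_g1.
rewrite -EFinD lee_fin -mulrDl ler_pdivlMr // mulrAC ler_pdivrMr //.
rewrite -(natr1 n.+1) -[n.+1%:R]natr1; have : 0 <= n%:R :> R by []; set x := n%:R; lra.
Qed.

Lemma Kn_lo n : ((16 * n.+1%:R)^-1%:E <= Kn n)%E.
Proof.
have t0 p : (0 <= (trunc (fun p => sqn p ^+ n) p)%:E)%E.
  by rewrite lee_fin trunc_ge0 // => q; rewrite exprn_ge0 // sqn_ge0.
rewrite /Kn /dint fubini_tonelli2 //; last by apply: measurable_truncE; exact: measurable_Kn.
rewrite /fubini_G /=.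
have ms : measurable_fun setT (fun y => \int[mu]_x (trunc (fun p => sqn p ^+ n) (x, y))%:E)%E.
  by apply: measurable_sliceF; [exact: measurable_Kn|move=> p; rewrite exprn_ge0 // sqn_ge0].
apply: (@le_trans _ _ (\int[mu]_(y in `[0%R, (2^-1)%R]) (\int[mu]_x (trunc (fun p => sqn p ^+ n) (x, y))%:E))%E); last first.
  by apply: ge0_subset_integral => // y _; apply: integral_ge0 => x _; exact: t0.
apply: (@le_trans _ _ (\int[mu]_(y in `[0%R, (2^-1)%R]) (cst (8 * n.+1%:R)^-1%:E) y)%E).
  rewrite integral_cst //= lebesgue_measure_itv /= lte_fin ifT; last by lra.
  rewrite -EFinB -EFinM lee_fin subr0 -invfM.
  by rewrite (_ : 8 * n.+1%:R * 2 = 16 * n.+1%:R) //; ring.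
apply: ge0_le_integral => //.
- by move=> y _; rewrite lee_fin invr_ge0 mulr_ge0.
- exact: measurable_funS ms.
- by move=> y /=; rewrite in_itv /=; exact: slice_lo.
Qed.

End Area.

(** * Sigma-finiteness of a product measure *)

Section ProductSigmaFinite.
Context d1 d2 (T1 : measurableType d1) (T2 : measurableType d2) (R : realType).
Variable m1 : {sigma_finite_measure set T1 -> \bar R}.
Variable m2 : {sigma_finite_measure set T2 -> \bar R}.
Lemma sigma_finite_prod : sigma_finite setT (m1 \x m2)%E.
Proof.
have [F TF Foo] := sigma_finiteT m1.
have [G TG Goo] := sigma_finiteT m2.
exists (fun n => let p := odflt (0, 0)%N (unpickle n) in F p.1 `*` G p.2).
  apply/esym/seteqP; split => // -[x y] _.
  have : setT x by []. rewrite TF => -[i _ Fi].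
  have : setT y by []. rewrite TG => -[j _ Gj].
  by exists (pickle (i, j)) => //; rewrite pickleK.
move=> n /=; set p := odflt _ _; have [mF fF] := Foo p.1; have [mG fG] := Goo p.2.
split; first exact: measurableX.
by rewrite product_measure1E // lte_mul_pinfty // ge0_fin_numE.
Qed.
(* The library's canonical structure on m1 \x m2 requires finite measures. *)
Definition prodsf : {sigma_finite_measure set (T1 * T2)%type -> \bar R} := 
  HB.pack_for (@SigmaFiniteMeasure.type _ (T1 * T2)%type R) (m1 \x m2)%E
    (@Measure_isSigmaFinite.Build _ _ _ (m1 \x m2)%E sigma_finite_prod).
End ProductSigmaFinite.

(** * The area integral of |F|^2 through rotation averages *)

Section Averaging.
Context {R : realType}.
Notation mu := (@lebesgue_measure R).
Notation mu2 := (@lebesgue_measure R \x @lebesgue_measure R)%E.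
Implicit Types (p : R * R) (g h : R * R -> R) (c : nat -> C R) (F : C R -> C R).

Definition toC (p : R * R) : C R := mkC p.1 p.2.
Definition psi F p : R := absC (F (toC p)) ^+ 2.
Definition rotavg F p : R := avg (fun t => absC (F (eC t * toC p)) ^+ 2).

Lemma absC_toC p : absC (toC p) ^+ 2 = sqn p.
Proof. by rewrite absC2. Qed.

Lemma indiscE p : indisc p = (absC (toC p) < 1).
Proof.
by rewrite /indisc -absC_toC expr_lt1 ?absC_ge0.
Qed.

Lemma toC_rot t p : toC (rotR (cos t) (sin t) p) = eC t * toC p.
Proof. by apply: C_eq; rewrite /toC /eC /rotR !CE /=; ring. Qed.

Lemma sqn_rot t p : sqn (rotR (cos t) (sin t) p) = sqn p.
Proof. by rewrite -!absC_toC toC_rot absCM absC_eC mul1r. Qed.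

Lemma measurable_toCX n : measurable_fun setT (fun p => reC (toC p ^+ n)) /\
  measurable_fun setT (fun p => imC (toC p ^+ n)).
Proof.
elim: n => [|n [hr hi]].
  by split; [exact: (@measurable_cst _ _ _ _ _ (1 : R))|exact: (@measurable_cst _ _ _ _ _ (0 : R))].
split.
  rewrite (_ : (fun _ => _) = (fun p : R * R => p.1 * reC (toC p ^+ n) - p.2 * imC (toC p ^+ n))).
    by apply: measurable_funB; apply: measurable_funM.
  by apply/funext => p; rewrite exprS reCM.
rewrite (_ : (fun _ => _) = (fun p : R * R => p.1 * imC (toC p ^+ n) + p.2 * reC (toC p ^+ n))).
  by apply: measurable_funD; apply: measurable_funM.
by apply/funext => p; rewrite exprS imCM.
Qed.

Lemma measurable_psumC c N : measurable_fun setT (fun p => reC (psum c N (toC p))) /\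
  measurable_fun setT (fun p => imC (psum c N (toC p))).
Proof.
elim: N => [|N [hr hi]].
  by split; under eq_fun do rewrite /psum big_ord0; [exact: (@measurable_cst _ _ _ _ _ (0 : R))|exact: (@measurable_cst _ _ _ _ _ (0 : R))].
have [kr ki] := measurable_toCX N.
split.
  rewrite (_ : (fun _ => _) = (fun p : R * R => reC (psum c N (toC p)) +
     (reC (c N) * reC (toC p ^+ N) - imC (c N) * imC (toC p ^+ N)))).
    apply: measurable_funD => //; apply: measurable_funB; apply: measurable_funM => //.
  by apply/funext => p; rewrite psumS reCD reCM.
rewrite (_ : (fun _ => _) = (fun p : R * R => imC (psum c N (toC p)) +
     (reC (c N) * imC (toC p ^+ N) + imC (c N) * reC (toC p ^+ N)))).
  by apply: measurable_funD => //; apply: measurable_funD; apply: measurable_funM => //.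
by apply/funext => p; rewrite psumS imCD imCM.
Qed.

Lemma measurable_psi_poly c N : measurable_fun setT (psi (psum c N)).
Proof.
have [hr hi] := measurable_psumC c N.
rewrite (_ : psi _ = (fun p => reC (psum c N (toC p)) ^+ 2 + imC (psum c N (toC p)) ^+ 2)).
  by apply: measurable_funD; apply: measurable_funX.
by apply/funext => p; rewrite /psi absC2.
Qed.

Lemma measurable_trunc_cvg (u : nat -> R * R -> R) g :
  (forall N, measurable_fun setT (u N)) ->
  (forall p, indisc p -> u N p @[N --> \oo] --> g p) ->
  measurable_fun setT (trunc g).
Proof.
move=> mu_ ug; apply: (@measurable_fun_cvg _ _ _ _ (fun N => trunc (u N))).
  by move=> N; exact: measurable_trunc.
move=> p _; rewrite /trunc; case: ifPn => [/ug //|_]; exact: cvg_cst.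
Qed.

Lemma measurable_trunc_psi c F : is_ps c F -> measurable_fun setT (trunc (psi F)).
Proof.
move=> hF; apply: (@measurable_trunc_cvg (fun N => psi (psum c N))).
  exact: measurable_psi_poly.
move=> p; rewrite indiscE => hp; rewrite /psi.
have h := @cvg_absC R _ \oo _ _ _ (hF (toC p) hp).
by under eq_fun do rewrite expr2; rewrite expr2; apply: cvgM; exact: h.
Qed.

Lemma rotavg_cvg c F p : pbd c -> is_ps c F -> indisc p ->
  S2 c (sqn p) N @[N --> \oo] --> rotavg F p.
Proof.
move=> hc hF; rewrite indiscE => hp; set z := toC p in hp *.
(* The phase of z, set to 1 at z = 0. It is absorbed into the coefficients without changing their
   moduli, so that Parseval applies at radius |z|. *)
pose r := absC z; pose om : C R := if z == 0 then 1 else z / rC r.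
have zE : z = om * rC r.
  rewrite /om; case: eqP => [z0|/eqP z0]; first by rewrite mul1r /r z0 absC0.
  by rewrite divfK // -absC_eq0 absC_rC normr_eq0 absC_eq0.
have aom : absC om = 1.
  rewrite /om; case: eqP => [_|/eqP z0]; first exact: absC1.
  by rewrite absCM absCV absC_rC ger0_norm ?absC_ge0 // divff // absC_eq0.
pose d n := c n * om ^+ n.
have ad n : absC (d n) = absC (c n) by rewrite absCM absCX aom expr1n mulr1.
have hd : pbd d by move=> s /hc[M MP]; exists M => n; rewrite ad.
have hG : is_ps d (fun w => F (om * w)).
  move=> w dw; have dow : disc (om * w) by rewrite discE absCM aom mul1r.
  rewrite (_ : (fun N => psum d N w) = (fun N => psum c N (om * w))); first exact: hF.
  by apply/funext => N; apply: eq_bigr => n _; rewrite /d exprMn mulrA.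
have hr : 0 <= r < 1 by rewrite absC_ge0.
have := parseval hd hG hr.
rewrite (_ : S2 d (r ^+ 2) = S2 c (sqn p)); last first.
  apply/funext => N; apply: eq_bigr => n _; rewrite ad /r /z.
  by rewrite absC_toC.
rewrite (_ : Nf _ r = rotavg F p) //.
apply: eq_avg => t; congr (absC (F _) ^+ 2).
rewrite polarCE -/z [in RHS]zE; ring.
Qed.

Lemma S2_ge0 c (x : R) N : 0 <= x -> 0 <= S2 c x N.
Proof. by move=> x0; apply: sumr_ge0 => i _; rewrite mulr_ge0 ?exprn_ge0 ?absC_ge0. Qed.

Lemma S2_le_rotavg c F p N : pbd c -> is_ps c F -> indisc p -> S2 c (sqn p) N <= rotavg F p.
Proof.
move=> hc hF hp; have cv := rotavg_cvg hc hF hp.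
have := @nondecreasing_cvgn_le _ (S2 c (sqn p)) (S2_nd c (sqn_ge0 p)).
by move=> /(_ (cvgP _ cv) N); rewrite (cvg_lim _ cv).
Qed.

Lemma measurable_S2 c N : measurable_fun setT (fun p => S2 c (sqn p) N).
Proof.
elim: N => [|N ih].
  by under eq_fun do rewrite /S2 big_ord0; exact: (@measurable_cst _ _ _ _ _ (0 : R)).
under eq_fun do rewrite S2S.
by apply: measurable_funD => //; apply: measurable_funM => //; exact: measurable_Kn.
Qed.

Lemma measurable_trunc_rotavg c F : pbd c -> is_ps c F -> measurable_fun setT (trunc (rotavg F)).
Proof.
move=> hc hF; apply: (@measurable_trunc_cvg (fun N p => S2 c (sqn p) N)).
  exact: measurable_S2.
by move=> p hp; exact: rotavg_cvg.
Qed.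

(** The rotated integrand as a function of the point and the angle jointly, for Tonelli; it is 0 for
    angles outside [0, 2 pi]. *)
Let G F (q : (R * R) * R) : \bar R :=
  if (0 <= q.2 <= 2 * pi) then (trunc (psi F) (rotR (cos q.2) (sin q.2) q.1))%:E else 0%E.

Let measurable_G c F : is_ps c F -> measurable_fun setT (G F).
Proof.
move=> hF; apply: measurable_fun_ifT.
- have mle1 : measurable_fun setT (fun q : (R * R) * R => 0 <= q.2).
    by apply: measurable_fun_ler; [exact: measurable_cst|exact: measurable_snd].
  have mle2 : measurable_fun setT (fun q : (R * R) * R => q.2 <= 2 * pi).
    by apply: measurable_fun_ler; [exact: measurable_snd|exact: measurable_cst].
  exact: measurable_and.
- apply/measurable_EFinP.
  apply: (measurableT_comp (measurable_trunc_psi hF)).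
  have mx : measurable_fun setT (fun q : (R * R) * R => q.1.1).
    by apply: measurableT_comp; [exact: measurable_fst|exact: measurable_fst].
  have my : measurable_fun setT (fun q : (R * R) * R => q.1.2).
    by apply: measurableT_comp; [exact: measurable_snd|exact: measurable_fst].
  have mc : measurable_fun setT (fun q : (R * R) * R => cos q.2).
    by apply: measurableT_comp; [apply: continuous_measurable_fun; exact: continuous_cos|exact: measurable_snd].
  have ms : measurable_fun setT (fun q : (R * R) * R => sin q.2).
    by apply: measurableT_comp; [apply: continuous_measurable_fun; exact: continuous_sin|exact: measurable_snd].
  apply: measurable_fun_pair.
    by apply: measurable_funB; apply: measurable_funM.
  by apply: measurable_funD; apply: measurable_funM.
- exact: measurable_cst.
Qed.

(** Each angle contributes the same integral by rotation invariance. Exchanging the integrals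
    replaces |F|^2 by its mean over the circle through p, which is the role polar coordinates would
    have. *)
Lemma dint_rotavg c F : pbd c -> is_ps c F ->
  ((2 * pi)%:E * dint (psi F) = \int[mu2]_p (trunc (fun p => 2 * pi * rotavg F p) p)%:E)%E.
Proof.
move=> hc hF.
have mG := measurable_G hF.
have psi0 p : 0 <= psi F p by exact: sqr_ge0.
have G0 q : (0 <= G F q)%E.
  by rewrite /G; case: ifP => // _; rewrite lee_fin trunc_ge0.
have Tn : (\int[mu2]_x \int[mu]_y G F (x, y) = \int[mu]_y \int[mu2]_x G F (x, y))%E.
  exact: (@fubini_tonelli _ _ _ _ R (prodsf mu mu) mu (G F) mG G0).
move: Tn.
have -> : (\int[mu]_y \int[mu2]_x G F (x, y) = (2 * pi)%:E * dint (psi F))%E.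
  transitivity (\int[mu]_(y in `[0%R, (2 * pi)%R]) (cst (dint (psi F))) y)%E.
    rewrite [RHS]integral_mkcond; apply: eq_integral => y _; rewrite patchE.
    have [hy|hy] := boolP (0 <= y <= 2 * pi).
      rewrite mem_set; last by rewrite /= in_itv.
      transitivity (\int[mu2]_p (trunc (psi F) (rotR (cos y) (sin y) p))%:E)%E.
        by apply: eq_integral => p _; rewrite /G /= hy.
      rewrite /dint.
      apply: (@integral_rot R (cos y) (sin y) (fun p => (trunc (psi F) p)%:E)).
      - exact: cos2Dsin2.
      - by apply/measurable_EFinP; exact: measurable_trunc_psi hF.
      - by move=> p; rewrite lee_fin trunc_ge0.
    rewrite memNset; last by rewrite /= in_itv; exact/negP.
    by apply: integral0_eq => p _; rewrite /G /= (negbTE hy).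
  rewrite integral_cst //= lebesgue_measure_itv /= lte_fin twopi_gt0 -EFinB subr0.
  by rewrite muleC.
move=> <-; apply: eq_integral => p _.
transitivity (\int[mu]_(y in `[0%R, (2 * pi)%R]) (trunc (psi F) (rotR (cos y) (sin y) p))%:E)%E.
  rewrite [RHS]integral_mkcond; apply: eq_integral => y _; rewrite patchE /G /=.
  have [hy|hy] := boolP (0 <= y <= 2 * pi).
    by rewrite mem_set //= in_itv.
  by rewrite memNset //= in_itv; exact/negP.
have [hp|hp] := boolP (indisc p); last first.
  rewrite /trunc (negbTE hp) integral0_eq // => y _.
  by rewrite /indisc sqn_rot -/(indisc p) (negbTE hp).
pose f := fun t => absC (F (eC t * toC p)) ^+ 2.
have cf : continuous f.
  apply: cont_abs2P => t.
  apply: (continuous_comp (f := fun t => eC t * toC p) (g := F)).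
    by apply: contM; [exact: cont_eC|exact: contK].
  by apply: ps_cont hc hF _; rewrite discE absCM absC_eC mul1r -indiscE.
transitivity (\int[mu]_(y in `[0%R, (2 * pi)%R]) (f y)%:E)%E.
  apply: eq_integral => y _; congr EFin.
  by rewrite /trunc /indisc sqn_rot -/(indisc p) hp /psi toC_rot.
have ih : mu.-integrable `[0, 2 * pi] (EFin \o f) := con_integrable (@cont_con R 0 (2 * pi) f cf).
have fin : (\int[mu]_(x in `[0%R, (2 * pi)%R]) (f x)%:E)%E \is a fin_num.
  exact: integrable_fin_num ih.
rewrite -(fineK fin); congr EFin; rewrite -[LHS]/(itg 0 (2 * pi) f).
by rewrite /trunc hp /rotavg /avg mulrA divff ?mul1r // gt_eqF // twopi_gt0.
Qed.

Lemma dint_S2 c N : dint (fun p => S2 c (sqn p) N) = (\sum_(n < N) (absC (c n) ^+ 2)%:E * Kn n)%E.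
Proof.
elim: N => [|N ih].
  rewrite big_ord0 /dint integral0_eq // => p _.
  by rewrite /trunc /S2 big_ord0; case: ifP.
rewrite big_ord_recr /= -ih /Kn -dintZ; last 3 first.
- exact: measurable_Kn.
- exact: sqr_ge0.
- by move=> p; rewrite exprn_ge0 // sqn_ge0.
rewrite -dintD.
- by congr dint; apply/funext => p; rewrite S2S.
- exact: measurable_S2.
- by apply: measurable_funM => //; exact: measurable_Kn.
- by move=> p; rewrite S2_ge0 // sqn_ge0.
- by move=> p; rewrite mulr_ge0 ?exprn_ge0 ?sqn_ge0 ?absC_ge0.
Qed.

(** The rotation average dominates the partial sums of its expansion, and [Kn_lo] bounds their
    integrals from below, whence the constant 16. *)
Lemma area_lower c F : pbd c -> is_ps c F -> (dint (psi F) < +oo)%E ->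
  exists K, forall N, \sum_(n < N) absC (c n) ^+ 2 / n.+1%:R <= K.
Proof.
move=> hc hF fin.
have d0 : (0 <= dint (psi F))%E.
  by apply: integral_ge0 => p _; rewrite lee_fin trunc_ge0 // => q; exact: sqr_ge0.
have fn : dint (psi F) \is a fin_num by rewrite ge0_fin_numE.
exists (16 * fine (dint (psi F))) => N.
have h : ((2 * pi)%:E * dint (fun p => S2 c (sqn p) N) <= (2 * pi)%:E * dint (psi F))%E.
  rewrite (dint_rotavg hc hF) -dintZ; last 3 first.
  - exact: measurable_S2.
  - exact: twopi_ge0.
  - by move=> p; rewrite S2_ge0 // sqn_ge0.
  apply: ge0_le_integral => //.
  - by move=> p _; rewrite lee_fin trunc_ge0 // => q; rewrite mulr_ge0 ?twopi_ge0 // S2_ge0 // sqn_ge0.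
  - by apply: measurable_truncE; apply: measurable_funM => //; exact: measurable_S2.
  - apply/measurable_EFinP.
    rewrite (_ : trunc _ = (fun p => 2 * pi * trunc (rotavg F) p)).
      by apply: measurable_funM => //; exact: measurable_trunc_rotavg hc hF.
    by apply/funext => p; rewrite /trunc; case: ifP => //; rewrite mulr0.
  move=> p _; rewrite lee_fin /trunc; case: ifPn => // hp.
  by rewrite ler_wpM2l ?twopi_ge0 // S2_le_rotavg.
have {}h : (dint (fun p => S2 c (sqn p) N) <= dint (psi F))%E.
  by move: h; rewrite lee_pmul2l // ?lte_fin ?twopi_gt0.
have : ((\sum_(n < N) absC (c n) ^+ 2 / (16 * n.+1%:R))%:E <= dint (psi F))%E.
  apply: le_trans h; rewrite dint_S2 -sumEFin; apply: lee_sum => n _.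
  by rewrite EFinM lee_wpmul2l ?lee_fin ?sqr_ge0 // Kn_lo.
rewrite -(fineK fn) lee_fin => hh; rewrite mulrC -ler_pdivrMr //; apply: le_trans hh.
rewrite mulr_suml le_eqVlt; apply/orP; left; apply/eqP; apply: eq_bigr => n _.
by rewrite invfM mulrCA mulrC mulrA.
Qed.

(** Monotone convergence of the partial sums to the rotation average, each integral being bounded
    through [Kn_hi]. *)
Lemma area_upper c F (K : R) : pbd c -> is_ps c F ->
  (forall N, \sum_(n < N) absC (c n) ^+ 2 / n.+1%:R <= K) -> (dint (psi F) < +oo)%E.
Proof.
move=> hc hF hK.
pose u N p : \bar R := (trunc (fun p => 2 * pi * S2 c (sqn p) N) p)%:E.
have S20 N p : 0 <= 2 * pi * S2 c (sqn p) N by rewrite mulr_ge0 ?twopi_ge0 // S2_ge0 // sqn_ge0.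
have mS N : measurable_fun setT (fun p => 2 * pi * S2 c (sqn p) N).
  by apply: measurable_funM => //; exact: measurable_S2.
have cv : (\int[mu2]_p u N p)%E @[N --> \oo] --> (\int[mu2]_p limn (u ^~ p))%E.
  apply: cvg_monotone_convergence => //.
  - by move=> N; apply: measurable_truncE.
  - by move=> N p _; rewrite lee_fin trunc_ge0.
  - move=> p _ N M NM; rewrite lee_fin /trunc; case: ifP => // _.
    by rewrite ler_wpM2l ?twopi_ge0 //; apply: S2_nd => //; exact: sqn_ge0.
have limE : (\int[mu2]_p limn (u ^~ p) = (2 * pi)%:E * dint (psi F))%E.
  rewrite (dint_rotavg hc hF); apply: eq_integral => p _; apply/cvg_lim => //.
  apply: cvg_EFin; first exact: nearW.
  rewrite /u /trunc /=; case: ifPn => hp; last exact: cvg_cst.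
  by apply: cvgM; [exact: cvg_cst|exact: rotavg_cvg].
have ub N : (\int[mu2]_p u N p <= (2 * pi * (8 * K))%:E)%E.
  rewrite -[leLHS]/(dint (fun p => 2 * pi * S2 c (sqn p) N)) dintZ; last 3 first.
  - exact: measurable_S2.
  - exact: twopi_ge0.
  - by move=> p; rewrite S2_ge0 // sqn_ge0.
  rewrite [leRHS]EFinM lee_wpmul2l ?lee_fin ?twopi_ge0 // dint_S2.
  apply: (@le_trans _ _ (\sum_(n < N) absC (c n) ^+ 2 * (8 / n.+1%:R))%:E).
    rewrite -sumEFin; apply: lee_sum => n _.
    by rewrite [leRHS]EFinM lee_wpmul2l ?lee_fin ?sqr_ge0 // Kn_hi.
  rewrite lee_fin; apply: le_trans (ler_wpM2l _ (hK N)); last by [].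
  rewrite mulr_sumr le_eqVlt; apply/orP; left; apply/eqP; apply: eq_bigr => n _.
  by rewrite mulrCA.
have : ((2 * pi)%:E * dint (psi F) <= (2 * pi * (8 * K))%:E)%E.
  rewrite -limE -(cvg_lim _ cv) //; apply: lime_le.
    by apply/cvg_ex; exists (\int[mu2]_p limn (u ^~ p))%E.
  exact: nearW.
move=> h; rewrite ltNge; apply/negP; rewrite leye_eq => /eqP e; move: h.
by rewrite e mulry gtr0_sg ?twopi_gt0 // mul1e leye_eq.
Qed.

End Averaging.

(** * Finiteness of the Dirichlet integral in terms of coefficients *)

Section DirichletCoef.
Context {R : realType}.
Notation mu2 := (@lebesgue_measure R \x @lebesgue_measure R)%E.
Implicit Types (c : nat -> C R) (f : C R -> C R).

Lemma dco_sum c N : \sum_(n < N) absC (dco c n) ^+ 2 / n.+1%:R =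
  \sum_(n < N.+1) n%:R * absC (c n) ^+ 2.
Proof.
rewrite big_ord_recl mul0r add0r; apply: eq_bigr => n _.
by rewrite /dco absCM absC_nat lift0 exprMn mulrAC expr2 mulfK //.
Qed.

Lemma dirichlet_integralE f : analytic f ->
  dirichlet_integral f = (pi^-1%:E * dint (psi (pser (dco (coef f)))))%E.
Proof.
move=> af; rewrite /dirichlet_integral; congr (_ * _)%E.
rewrite integral_mkcond; apply: eq_integral => p _; rewrite patchE /trunc.
have [hp|hp] := boolP (indisc p).
  have dp : disc (mkC p.1 p.2) by rewrite discE -indiscE.
  rewrite mem_set //; congr (absC _ ^+ 2)%:E; rewrite derive1E.
  by have [_ <-] := ps_deriv (coef_pbd af) (cauchy_ps af) dp.
by rewrite memNset // => dp; move: hp; rewrite indiscE => /negP; exact.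
Qed.

Lemma dirichletP f : analytic f ->
  (dirichlet_integral f < +oo)%E <-> exists K, dsum (coef f) K.
Proof.
move=> af; rewrite dirichlet_integralE //.
have hc := dco_pbd (coef_pbd af); have hF := pser_ps hc.
have d0 : (0 <= dint (psi (pser (dco (coef f)))))%E.
  by apply: integral_ge0 => p _; rewrite lee_fin trunc_ge0 // => q; exact: sqr_ge0.
have -> : (pi^-1%:E * dint (psi (pser (dco (coef f)))) < +oo)%E <->
    (dint (psi (pser (dco (coef f)))) < +oo)%E.
  split => h; last by rewrite lte_mul_pinfty // lee_fin invr_ge0 pi_ge0.
  rewrite ltNge leye_eq; apply/negP => /eqP e; move: h.
  by rewrite e mulry gtr0_sg ?invr_gt0 ?pi_gt0 // mul1e ltxx.
split=> [fin|[K hK]].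
  have [K hK] := area_lower hc hF fin; exists K => -[|N].
    by rewrite big_ord0; have := hK 0%N; rewrite big_ord0.
  by rewrite -dco_sum.
by apply: (area_upper hc hF (K := K)) => N; rewrite dco_sum.
Qed.

End DirichletCoef.

(** * Division by an inner function *)

Section InnerDivision.
Context {R : realType}.
Notation mu := (@lebesgue_measure R).
Implicit Types (c d : nat -> C R) (f g h F S : C R -> C R) (w z : C R) (r s L M : R).

Lemma pbd_dil c r : 0 <= r <= 1 -> pbd c -> pbd (fun n => c n * rC r ^+ n).
Proof.
move=> /andP[r0 r1] hc s hs; have [M MP] := hc s hs; exists M => n.
apply: le_trans (MP n); have /andP[s0 _] := hs.
rewrite absCM absCX absC_rC ger0_norm // ler_wpM2r ?exprn_ge0 ?(ltW s0) //.
by rewrite -[leRHS]mulr1 ler_wpM2l ?absC_ge0 // exprn_ile1.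
Qed.

Lemma disc_dil r w : 0 <= r <= 1 -> disc w -> disc (rC r * w).
Proof.
move=> /andP[r0 r1]; rewrite !discE absCM absC_rC ger0_norm // => w1.
by apply: le_lt_trans w1; rewrite -[leRHS]mul1r ler_wpM2r ?absC_ge0.
Qed.

Lemma is_ps_dil c f r : 0 <= r <= 1 -> is_ps c f ->
  is_ps (fun n => c n * rC r ^+ n) (fun w => f (rC r * w)).
Proof.
move=> hr hf w dw; have := hf _ (disc_dil hr dw).
rewrite (_ : (fun N => psum c N (rC r * w)) = (fun N => psum (fun n => c n * rC r ^+ n) N w)) //.
by apply/funext => N; apply: eq_bigr => i _; rewrite exprMn mulrA.
Qed.

(** The left side is twice the real inner product of h and its dilation p on the circle of radius s.
    Its terms are |c n|^2 r^(2n) s^(2n), those of the mean of |h|^2 at radius r s. *)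
Lemma polarization h (r s : R) : analytic h -> 0 <= r <= 1 -> 0 <= s < 1 ->
  let p := fun w => h (rC (r ^+ 2) * w) in
  Nf h s + Nf p s - Nf (fun w => h w - p w) s = 2 * Nf h (r * s).
Proof.
move=> ah hr hs p; have /andP[r0 r1] := hr; have /andP[s0 s1] := hs.
have hx : 0 <= r ^+ 2 <= 1 by rewrite sqr_ge0 exprn_ile1.
have hc := coef_pbd ah; have cs := cauchy_ps ah.
have hd := pbd_dil hx hc; have ds := is_ps_dil hx cs.
move: (coef h) hc cs hd ds => c hc cs hd ds.
pose d := (fun n => c n * rC (r ^+ 2) ^+ n); rewrite -/d in hd ds.
have he : pbd (fun n => c n - d n).
  have := pbdD hc (pbdZ (-1) hd); congr pbd.
  by apply/funext => k; rewrite mulN1r.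
have es := is_psB cs ds.
have hrs : 0 <= r * s < 1.
  rewrite mulr_ge0 //=; apply: le_lt_trans s1; rewrite -[leRHS]mul1r ler_wpM2r //.
have c1 := parseval hc cs hs; have c2 := parseval hd ds hs.
have c3 := parseval he es hs; have c4 := parseval hc cs hrs.
have l1 : S2 c (s ^+ 2) N + S2 d (s ^+ 2) N - S2 (fun n => c n - d n) (s ^+ 2) N
    @[N --> \oo] --> Nf h s + Nf p s - Nf (fun w => h w - p w) s.
  by apply: cvgB; [apply: cvgD; [exact: c1|exact: c2]|exact: c3].
have l2 : 2 * S2 c ((r * s) ^+ 2) N @[N --> \oo] --> 2 * Nf h (r * s).
  by apply: (@cvgM _ _ \oo _ (fun=> 2)); [exact: cvg_cst|exact: c4].
have e : (fun N => S2 c (s ^+ 2) N + S2 d (s ^+ 2) N - S2 (fun n => c n - d n) (s ^+ 2) N) =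
    (fun N => 2 * S2 c ((r * s) ^+ 2) N).
  apply/funext => N; rewrite /S2 mulr_sumr -big_split -sumrB; apply: eq_bigr => n _; rewrite [GRing.add _ _]/=.
  have -> : c n - d n = c n * rC (1 - (r ^+ 2) ^+ n).
    by rewrite rCB rCX mulrBr mulr1.
  rewrite /d !absCM -rCX !absC_rC !exprMn !real_normK ?num_real //.
  ring.
by rewrite e in l1; exact: cvg_unique l1 l2.
Qed.

Lemma reC_cj w z : 2 * reC (w * cjC z) = absC w ^+ 2 + absC z ^+ 2 - absC (w - z) ^+ 2.
Proof. by rewrite !absC2 !reCB !imCB !CE; ring. Qed.

Lemma reC_cj_le2 w z : 2 * reC (w * cjC z) <= absC w ^+ 2 + absC z ^+ 2.
Proof. by rewrite reC_cj gerBl sqr_ge0. Qed.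

(* weighted splitting 2 Re (h p~) = 2 Re (|u|^2 h p~) + 2 (1 - |u|^2) Re (h p~) *)
Lemma weighted_cross (u a b : C R) (e P : R) : 0 < e -> absC b <= P -> absC u <= 1 ->
  2 * reC (a * cjC b) <= absC (u * a) ^+ 2 + absC b ^+ 2
    + 2 * P * (e * absC a ^+ 2 + (4 * e)^-1 * (1 - absC u ^+ 2) ^+ 2).
Proof.
move=> e0 bP u1.
have u0 := absC_ge0 u.
have u2 : absC u ^+ 2 <= 1 by rewrite exprn_ile1.
have h1 := reC_cj_le2 (u * a) (u * b).
have e1 : reC (u * a * cjC (u * b)) = absC u ^+ 2 * reC (a * cjC b).
  by rewrite absC2 /cjC !CE; ring.
have h2 : absC (u * b) ^+ 2 <= absC b ^+ 2.
  by rewrite absCM exprMn -[leRHS]mul1r ler_wpM2r // exprn_ge0 ?absC_ge0.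
set k := 1 - absC u ^+ 2; have k0 : 0 <= k by rewrite subr_ge0.
have h3 : reC (a * cjC b) <= absC a * P.
  apply: le_trans (ler_norm _) _; apply: le_trans (reC_le _) _.
  by rewrite absCM absC_cj ler_wpM2l ?absC_ge0.
have P0 : 0 <= P := le_trans (absC_ge0 _) bP.
have h4 : k * absC a <= e * absC a ^+ 2 + (4 * e)^-1 * k ^+ 2.
  rewrite -subr_ge0; move: (k) => y.
  have -> : e * absC a ^+ 2 + (4 * e)^-1 * y ^+ 2 - y * absC a =
     (4 * e)^-1 * (2 * e * absC a - y) ^+ 2 by field; rewrite gt_eqF.
  by rewrite mulr_ge0 ?sqr_ge0 // invr_ge0 mulr_ge0 // ltW.
have h5 : k * reC (a * cjC b) <= P * (e * absC a ^+ 2 + (4 * e)^-1 * k ^+ 2).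
  apply: le_trans (ler_wpM2l P0 h4); rewrite mulrCA [P * _]mulrC.
  by rewrite ler_wpM2l.
move: h1; rewrite e1 => h1.
have -> : 2 * reC (a * cjC b) = 2 * (absC u ^+ 2 * reC (a * cjC b)) + 2 * (k * reC (a * cjC b)).
  by rewrite /k; ring.
lra.
Qed.

Lemma avg_bounded_cvg0 (u : nat -> R -> R) : (forall n, continuous (u n)) ->
  (forall n t, `|u n t| <= 1) ->
  {ae mu, forall t, u n t @[n --> \oo] --> 0} -> avg (u n) @[n --> \oo] --> 0.
Proof.
move=> cu u1 u0.
pose D := `[0%R, (2 * pi)%R]%classic : set R.
have [_ _ h] : [/\ mu.-integrable D (cst 0%E),
   [sequence \int[mu]_(x in D) `|(u n x)%:E - cst 0 x|]_n @ \oo --> 0 &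
   [sequence \int[mu]_(x in D) (u n x)%:E]_n @ \oo --> \int[mu]_(x in D) (cst 0 x)]%E.
  apply: (@dominated_convergence _ _ _ mu D _ (fun n x => (u n x)%:E) (cst 0%E) (cst 1%E)).
  - exact: measurable_itv.
  - move=> n; apply/measurable_EFinP; apply: measurable_funS (measurableT) _ _ => //.
    exact: continuous_measurable_fun.
  - exact: measurable_cst.
  - apply: (@filterS _ _ (ae_filter_ringOfSetsType mu) _ _ _ u0) => t ht _; apply: cvg_EFin; first exact: nearW.
    exact: ht.
  - exact: (@con_integrable R 0 (2 * pi) (fun=> 1) (@con_cst R 0 (2 * pi) 1)).
  - by apply: nearW => t n _; rewrite lee_fin.
have : fine (\int[mu]_(x in D) (u n x)%:E)%E @[n --> \oo] --> fine (\int[mu]_(x in D) cst 0 x)%E.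
  by apply: fine_cvg; rewrite integral0 in h *; exact: h.
rewrite integral0 /= => hf.
by rewrite -(mulr0 (2 * pi)^-1); apply: (@cvgM _ _ \oo _ (fun=> (2 * pi)^-1)); [exact: cvg_cst|exact: hf].
Qed.

Lemma hardy2_Nf h : hardy2 h -> exists M, forall r, 0 <= r < 1 -> Nf h r <= M.
Proof.
move=> [ah [M hM]]; exists M => r hr; have := hM r hr.
have ch := cont_abs2P (cont_analytic_circ ah hr).
have ih := @con_integrable R 0 (2 * pi) _ (@cont_con R 0 (2 * pi) _ ch).
have fin : (\int[mu]_(x in `[0%R, (2 * pi)%R]) (absC (h (polarC r x)) ^+ 2)%:E)%E \is a fin_num.
  exact: integrable_fin_num ih.
by rewrite -(fineK fin) -EFinM lee_fin.
Qed.

(** The radial limits of S have modulus 1 almost everywhere. A sequence of radii is used because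
    dominated convergence runs along sequences; the outer square is the form in which
    [weighted_cross] leaves the defect. *)
Lemma inner_boundary S : inner S -> avg (fun t =>
  (1 - absC (S (polarC (1 - n.+2%:R^-1) t)) ^+ 2) ^+ 2) @[n --> \oo] --> 0.
Proof.
move=> [aS S1 Sae].
have hs n : 0 <= (1 - n.+2%:R^-1 : R) < 1.
  by rewrite subr_ge0 invf_le1 ?ltr0n // ler1n /= ltrBlDr ltrDl invr_gt0 ltr0n.
apply: (avg_bounded_cvg0 (u := fun n t => (1 - absC (S (polarC (1 - n.+2%:R^-1) t)) ^+ 2) ^+ 2)).
- move=> n.
  have c0 := cont_abs2P (cont_analytic_circ aS (hs n)).
  have c1 := contBr (@contKr R 1) c0.
  have c2 := contMr c1 c1; exact: c2.
- move=> n t; rewrite ger0_norm ?sqr_ge0 //.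
  have a0 : 0 <= absC (S (polarC (1 - n.+2%:R^-1) t)) ^+ 2 <= 1.
    rewrite sqr_ge0 exprn_ile1 ?absC_ge0 // S1 // discE absC_polar_ge0; by have /andP[] := hs n.
  by rewrite exprn_ile1 //; lra.
have sc : (1 - n.+2%:R^-1 : R) @[n --> \oo] --> (1 : R)^'-.
  have cv : (1 - n.+2%:R^-1 : R) @[n --> \oo] --> (1 : R).
    rewrite -[X in _ --> X]subr0; apply: cvgB; first exact: cvg_cst.
    have := @cvg_harmonic R; rewrite -cvg_shiftS; exact.
  move=> P /cv [N _ hN]; exists N => // n nN; apply: (hN n nN).
  by have /andP[] := hs n.
apply: (@filterS _ _ (ae_filter_ringOfSetsType mu) _ _ _ Sae) => t [l l1 Sl].
have h1 : absC (S (polarC (1 - n.+2%:R^-1) t)) @[n --> \oo] --> absC l.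
  have Sc := @cvg_comp _ _ _ (fun n : nat => (1 - n.+2%:R^-1 : R)) (fun r => S (polarC r t)) \oo _ _ sc Sl.
  exact: (@cvg_absC R _ \oo _ _ _ Sc).
have -> : (0 : R) = (1 - absC l * absC l) * (1 - absC l * absC l).
  by rewrite (_ : absC l = 1) ?mulr1 ?subrr ?mul0r.
have h2 : (1 - absC (S (polarC (1 - n.+2%:R^-1) t)) * absC (S (polarC (1 - n.+2%:R^-1) t)))
   @[n --> \oo] --> 1 - absC l * absC l.
  by apply: cvgB; [exact: cvg_cst|apply: cvgM; exact: h1].
under eq_fun do rewrite !expr2; exact: (cvgM h2 h2).
Qed.

(** Pairing h with a bounded dilation p avoids boundary values of h. In [weighted_cross] the defect
    1 - |S|^2 splits into a part proportional to e, controlled by the H^2 bound M of h, and a part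
    that vanishes as s -> 1. *)
Lemma inner_Nf S h F L : inner S -> hardy2 h -> analytic F ->
  (forall z, disc z -> F z = S z * h z) -> lsum (coef F) L ->
  forall r, 0 <= r < 1 -> Nf h r <= L.
Proof.
move=> iS hh aF FE hL r0 hr0; have [ah _] := hh.
have [M hM] := hardy2_Nf hh; have [aS S1 _] := iS.
have M0 : 0 <= M.
  have h0 : 0 <= (0 : R) < 1 by rewrite lexx ltr01.
  exact: le_trans (Nf_ge0 _ _) (hM 0 h0).
have /andP[r00 r01] := hr0.
(* Since r0 < r, the radius r s exceeds r0 once s is close to 1. *)
pose r := (1 + r0) / 2; have hr : 0 <= r <= 1 by rewrite /r; lra.
have r1 : r < 1 by rewrite /r; lra.
have r0r : r0 < r by rewrite /r; lra.
pose p := fun w => h (rC (r ^+ 2) * w).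
have hx : 0 <= r ^+ 2 <= 1 by rewrite sqr_ge0 exprn_ile1 //; lra.
have ap : analytic p := ps_analytic (pbd_dil hx (coef_pbd ah)) (is_ps_dil hx (cauchy_ps ah)).
have x1 : r ^+ 2 < 1 by rewrite expr_lt1 //; lra.
have [P0 hP0] := ps_disc_bounded (coef_pbd ah) (cauchy_ps ah) x1.
pose P := Num.max P0 1.
have P1 : 0 < P by rewrite /P lt_max ltr01 orbT.
have hP w : disc w -> absC (p w) <= P.
  move=> dw; apply: (@le_trans _ _ P0); last by rewrite /P le_max lexx.
  apply: hP0; rewrite absCM absC_rC ger0_norm ?sqr_ge0 //.
  by rewrite -[leRHS]mulr1 ler_wpM2l ?sqr_ge0 // ltW.
apply/ler_addgt0Pr => e' e'0.
(* This makes 2 P e M at most e'; M + 1 is used because M may be 0, and P was taken at least 1 for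
   the same division. *)
pose e := e' / (2 * P * (M + 1)) / 2.
have e0 : 0 < e by rewrite /e !divr_gt0 // !mulr_gt0 // ltr_wpDl.
pose A s := avg (fun t => (1 - absC (S (polarC s t)) ^+ 2) ^+ 2).
have key s : 0 <= s < 1 -> Nf h (r * s) <= L + 2 * P * (e * M + (4 * e)^-1 * A s).
  move=> hs; have /andP[s0 s1] := hs.
  have dp t : disc (polarC s t) by rewrite discE absC_polar_ge0.
  have pol := polarization ah hr hs.
  have cS := cont_abs2P (cont_analytic_circ aS hs).
  have cF := cont_abs2P (cont_analytic_circ aF hs).
  have ch := cont_abs2P (cont_analytic_circ ah hs).
  have cp := cont_abs2P (cont_analytic_circ ap hs).
  have ahp : analytic (fun w => h w - p w).
    by move=> w dw; apply: derivCB; [exact: ah|exact: ap].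
  have chp := cont_abs2P (cont_analytic_circ ahp hs).
  have c1 := contBr (@contKr R 1) cS.
  have cA := contMr c1 c1.
  have cE := contDr (contMr (@contKr R e) ch) (contMr (@contKr R (4 * e)^-1) cA).
  have le : Nf h s + Nf p s - Nf (fun w => h w - p w) s <=
      Nf F s + Nf p s + 2 * P * (e * Nf h s + (4 * e)^-1 * A s).
    rewrite /Nf -(avgD ch cp) -(avgB (contDr ch cp) chp) -(avgD cF cp).
    rewrite -(avgZ e ch) /A.
    have -> : avg (fun t => (1 - absC (S (polarC s t)) ^+ 2) ^+ 2) =
        avg (fun t => (1 - absC (S (polarC s t)) ^+ 2) * (1 - absC (S (polarC s t)) ^+ 2)).
      by apply: eq_avg => t; rewrite expr2.
    rewrite -(avgZ (4 * e)^-1 cA) -(avgD (contMr (@contKr R e) ch) (contMr (@contKr R (4 * e)^-1) cA)).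
    rewrite -(avgZ (2 * P) cE) -(avgD (contDr cF cp) (contMr (@contKr R (2 * P)) cE)).
    apply: avg_le; [exact: contBr (contDr ch cp) chp|
      exact: contDr (contDr cF cp) (contMr (@contKr R (2 * P)) cE)|].
    move=> t; have := weighted_cross (h (polarC s t)) e0 (hP _ (dp t)) (S1 _ (dp t)).
    by rewrite reC_cj -FE // -expr2.
  (* Polarization yields two copies of [Nf h (r * s)]; one of them pays for the mass of p. *)
  have n1 : Nf p s <= Nf h (r * s).
    have -> : Nf p s = Nf h (r ^+ 2 * s).
      apply: eq_avg => t; rewrite /p !polarCE mulrA -rCM; congr (absC (h _) ^+ 2).
    apply: Nf_mono (coef_pbd ah) (cauchy_ps ah) _ _ _.
    - by rewrite mulr_ge0 // sqr_ge0.
    - by rewrite ler_wpM2r // expr2 -[leRHS]mulr1 ler_wpM2l //; lra.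
    - by nra.
  have n2 := lsum_Nf aF hL hs; have n3 := hM s hs.
  have n4 : 2 * P * (e * Nf h s + (4 * e)^-1 * A s) <= 2 * P * (e * M + (4 * e)^-1 * A s).
    by rewrite ler_wpM2l ?mulr_ge0 ?(ltW P1) // lerD2r ler_wpM2l // ltW.
  move: pol le; rewrite /= -/p => -> le; lra.
have cvA := inner_boundary iS.
have cvB : L + 2 * P * (e * M + (4 * e)^-1 * A (1 - n.+2%:R^-1)) @[n --> \oo] -->
    L + 2 * P * (e * M + (4 * e)^-1 * 0).
  apply: cvgD; first exact: cvg_cst.
  apply: (@cvgM _ _ \oo _ (fun=> 2 * P)); first exact: cvg_cst.
  apply: cvgD; first exact: cvg_cst.
  by apply: (@cvgM _ _ \oo _ (fun=> (4 * e)^-1)); first exact: cvg_cst.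
have cvs : r * (1 - n.+2%:R^-1 : R) @[n --> \oo] --> r.
  rewrite -[X in _ --> X]mulr1; apply: (@cvgM _ _ \oo _ (fun=> r)); first exact: cvg_cst.
  rewrite -[X in _ --> X]subr0; apply: cvgB; first exact: cvg_cst.
  have := @cvg_harmonic R; rewrite -cvg_shiftS; exact.
have fin : L + 2 * P * (e * M + (4 * e)^-1 * 0) <= L + e'.
  rewrite mulr0 addr0 lerD2l /e.
  have -> : 2 * P * (e' / (2 * P * (M + 1)) / 2 * M) = e' * (M / (M + 1) / 2).
    by field; rewrite !gt_eqF // ltr_wpDl.
  rewrite -[leRHS]mulr1 ler_wpM2l ?(ltW e'0) //.
  have : M / (M + 1) <= 1 by rewrite ler_pdivrMr ?ltr_wpDl //; lra.
  lra.
apply: le_trans fin; rewrite -(cvg_lim _ cvB) //; apply: limr_ge; first exact: cvgP cvB.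
near=> n.
have hs : 0 <= (1 - n.+2%:R^-1 : R) < 1.
  by rewrite subr_ge0 invf_le1 ?ltr0n // ler1n /= ltrBlDr ltrDl invr_gt0 ltr0n.
apply: le_trans (key _ hs).
apply: Nf_mono (coef_pbd ah) (cauchy_ps ah) r00 _ _.
  by apply: ltW; near: n; exact: cvgr_gt cvs _ r0r.
have /andP[h0 h1] := hs; apply: le_lt_trans r1.
by rewrite -[leRHS]mulr1 ler_wpM2l ?(ltW h1) //; have /andP[] := hr.
Unshelve. all: by end_near.
Qed.

End InnerDivision.

(** * Singular inner functions and Blaschke factors *)

Section SingularFormula.
Context {R : realType}.
Implicit Types (w z v : C R) (f : C R -> R).

Lemma continuous_measurable_borelC f : continuous f ->
  measurable_fun (setT : set (@borelC R)) (f : @borelC R -> R).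
Proof.
move=> cf; apply: (measurability _ (RGenOInfty.measurableE R)) => _ [_ [a ->]] <-.
apply: measurableI => //; apply: sub_sigma_algebra.
by apply: open_comp => [x _|]; [exact: cf|exact: interval_open].
Qed.

Lemma measurable_circle : measurable (circle : set (@borelC R)).
Proof.
have h := continuous_measurable_borelC (@cont_absC R).
have := h measurableT _ (measurable_set1 (1 : R)).
by rewrite setTI (_ : _ @^-1` _ = circle).
Qed.

Definition poisson w v : R := (1 - absC w ^+ 2) / absC (v - w) ^+ 2.

Lemma poissonE w v : circle v -> disc w -> reC ((v + w) / (v - w)) = poisson w v.
Proof.
move=> v1 w1; have vw : v - w != 0.
  rewrite -absC_gt0; have := absC_sub v w; rewrite (_ : absC v = 1) //.
  by apply: lt_le_trans; rewrite subr_gt0.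
have h : (v + w) / (v - w) = (v + w) * cjC (v - w) * rC (absC (v - w) ^+ 2)^-1.
  by rewrite rCV -mulC_cj invfM; field; rewrite -?absC_eq0 ?absC_cj ?absC_eq0 vw.
have v2 : reC v ^+ 2 + imC v ^+ 2 = 1 by rewrite -absC2 (_ : absC v = 1) ?expr1n.
rewrite h /poisson reCM imC_mk reC_mk mulr0 subr0; congr (_ / _).
by rewrite -v2 !absC2 !CE; ring.
Qed.

Lemma absC_circle_sub_ge w v : circle v -> 1 - absC w <= absC (v - w).
Proof. by move=> v1; have := absC_sub v w; rewrite (_ : absC v = 1). Qed.

Lemma poisson_bounds w v : circle v -> disc w -> 0 <= poisson w v <= 2 / (1 - absC w).
Proof.
move=> v1 /discE w1; have h := absC_circle_sub_ge w v1; have w0 := absC_ge0 w.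
have h0 : 0 < absC (v - w) by apply: lt_le_trans h; rewrite subr_gt0.
rewrite divr_ge0 ?exprn_ge0 ?absC_ge0 ?subr_ge0 ?exprn_ile1 ?(ltW w1) //=.
rewrite ler_pdivrMr ?exprn_gt0 // mulrAC ler_pdivlMr ?subr_gt0 //.
have := ler_pM (_ : 0 <= 1 - absC w) (_ : 0 <= 1 - absC w) h h.
rewrite !subr_ge0 (ltW w1) => /(_ isT isT) hh.
apply: (@le_trans _ _ (2 * ((1 - absC w) * (1 - absC w)))); last by rewrite ler_pM2l // expr2.
have -> : (1 - absC w ^+ 2) * (1 - absC w) = (1 + absC w) * ((1 - absC w) * (1 - absC w)) by ring.
rewrite ler_wpM2r ?mulr_ge0 ?subr_ge0 ?(ltW w1) //; lra.
Qed.

Lemma measurable_poisson w : disc w ->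
  measurable_fun (circle : set (@borelC R)) (poisson w : @borelC R -> R).
Proof.
move=> w1; apply: measurable_funM; first exact: measurable_cst.
have h : measurable_fun (circle : set (@borelC R)) (fun v : @borelC R => absC ((v : C R) - w) ^+ 2).
  apply: measurable_funTS; apply: continuous_measurable_borelC => v.
  have h1 : absC (u - w) @[u --> v] --> absC (v - w).
    apply: (@cvg_absC R _ (nbhs v) _ (fun u => u - w)).
    by apply: cvgB; [exact: cvg_id|exact: cvg_cst].
  have h2 := cvgM h1 h1; exact: h2.
apply: (@measurable_comp _ _ _ _ _ _ (`]0%R, +oo[%classic : set R) (fun x : R => x^-1) _ _ _ _ _ h).
- exact: measurable_itv.
- move=> _ [v v1 <-]; rewrite /= in_itv /= andbT exprn_gt0 //.
  by apply: lt_le_trans (absC_circle_sub_ge w v1); rewrite subr_gt0.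
- apply: open_continuous_measurable_fun; first exact: interval_open.
  move=> x; rewrite inE /= in_itv /= andbT => x0.
  by apply: inv_continuous; rewrite gt_eqF.
Qed.

Lemma integral_point_masses (a : nat -> {nonneg R}) (lam : nat -> C R) (f : @borelC R -> R) :
  (forall k, circle (lam k)) -> measurable_fun (circle : set (@borelC R)) f ->
  (forall v, circle v -> 0 <= f v) ->
  (\int[point_masses a lam]_(v in (circle : set (@borelC R))) (f v)%:E =
   \sum_(k <oo) ((a k)%:num * f (lam k))%:E)%E.
Proof.
move=> lam1 mf f0; have mc := measurable_circle.
have mE : measurable_fun (circle : set (@borelC R)) (fun v => (f v)%:E) by exact/measurable_EFinP.
rewrite /point_masses ge0_integral_measure_series //.
apply: eq_eseriesr => k _; rewrite ge0_integral_mscale // integral_dirac //.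
by rewrite diracE mem_set ?mul1e // EFinM.
Qed.

(** The exponent u is the Poisson integral of the measure. The kernel is at most 2 / (1 - |w|) on
    the circle, so finite mass keeps the extended integral finite and [fine] loses nothing. *)
Lemma singular_inner_abs (a : nat -> {nonneg R}) (lam : nat -> C R) w :
  (forall k, circle (lam k)) -> (\sum_(0 <= k <oo) (a k)%:num%:E < +oo)%E -> disc w ->
  exists2 u, absC (singular_inner (point_masses a lam) w) = expR (- u) &
    forall N, \sum_(k < N) (a k)%:num * poisson w (lam k) <= u.
Proof.
move=> lam1 afin w1; rewrite /singular_inner absC_expC reCN reC_mk.
have p0 v : circle v -> 0 <= poisson w v by move=> v1; have /andP[] := poisson_bounds v1 w1.
set I := Rintegral _ _ _; exists I => // N.
have IE : I = fine (\sum_(k <oo) ((a k)%:num * poisson w (lam k))%:E)%E.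
  rewrite /I /Rintegral -integral_point_masses //; last exact: measurable_poisson.
  congr fine; apply: eq_integral => v; rewrite inE => v1.
  by rewrite poissonE.
have t0 k : 0 <= (a k)%:num * poisson w (lam k) by rewrite mulr_ge0 // p0.
have s0 : (0 <= \sum_(k <oo) ((a k)%:num * poisson w (lam k))%:E)%E.
  by apply: nneseries_ge0 => k _ _; rewrite lee_fin.
have fin : (\sum_(k <oo) ((a k)%:num * poisson w (lam k))%:E)%E \is a fin_num.
  rewrite ge0_fin_numE //.
  apply: (@le_lt_trans _ _ ((2 / (1 - absC w))%:E * \sum_(0 <= k <oo) (a k)%:num%:E)%E).
    rewrite -nneseriesZl; last by move=> k _; rewrite lee_fin.
    apply: lee_nneseries => [k _ _|k _]; first by rewrite lee_fin.
    rewrite -EFinM lee_fin mulrC ler_wpM2r //.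
    by have /andP[] := poisson_bounds (lam1 k) w1.
  by rewrite lte_mul_pinfty // lee_fin divr_ge0 // subr_ge0 ltW.
rewrite IE -lee_fin fineK // -sumEFin.
rewrite -(big_mkord xpredT (fun k => ((a k)%:num * poisson w (lam k))%:E)).
by apply: nneseries_lim_ge => k _ _; rewrite lee_fin.
Qed.

(** No unimodular normalisation, as only finite products are formed. *)
Definition blaschke z w : C R := (w - z) / (1 - cjC z * w).

Lemma blaschke_den z w : disc z -> disc w -> 0 < absC (1 - cjC z * w).
Proof.
move=> /discE z1 /discE w1.
have := absC_sub 1 (cjC z * w); rewrite absC1 absCM absC_cj; apply: lt_le_trans.
by rewrite subr_gt0 mulr_ilt1 ?absC_ge0.
Qed.

Lemma blaschke_lossE z w : disc z -> disc w -> 1 - absC (blaschke z w) ^+ 2 =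
  (1 - absC z ^+ 2) * (1 - absC w ^+ 2) / absC (1 - cjC z * w) ^+ 2.
Proof.
move=> z1 w1; have d0 := blaschke_den z1 w1.
by rewrite -moebius_id absCM absCV expr_div_n mulrBl divff // gt_eqF ?exprn_gt0.
Qed.

Lemma blaschke_le1 z w : disc z -> disc w -> absC (blaschke z w) <= 1.
Proof.
move=> z1 w1; have d0 := blaschke_den z1 w1; have h := blaschke_lossE z1 w1.
have : 0 <= 1 - absC (blaschke z w) ^+ 2.
  by rewrite h divr_ge0 ?sqr_ge0 // mulr_ge0 // subr_ge0 exprn_ile1 ?absC_ge0 ?ltW.
by rewrite subr_ge0 expr_le1 ?absC_ge0.
Qed.

(* (1 - |z|^2) (v - w) = (1 - z~w) (v - z) - (w - z) (1 - z~v), and |1 - z~v| = |v - z| on the circle *)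
Lemma blaschke_loss_le z w v : disc z -> disc w -> circle v ->
  1 - absC (blaschke z w) ^+ 2 <=
  4 * (absC (v - z) ^+ 2 / (1 - absC z ^+ 2)) * poisson w v.
Proof.
move=> z1 w1 v1; have d0 := blaschke_den z1 w1.
have v2 : absC v = 1 by exact: v1.
have q0 : 0 < 1 - absC z ^+ 2 by rewrite subr_gt0 expr_lt1 ?absC_ge0.
have vw0 : 0 < absC (v - w).
  by apply: lt_le_trans (absC_circle_sub_ge w v1); rewrite subr_gt0.
have e1 : absC (1 - cjC z * v) = absC (v - z).
  have e : absC (1 - cjC z * v) ^+ 2 = absC (v - z) ^+ 2.
    apply/eqP; rewrite -subr_eq0 moebius_id v2 expr1n subrr mulr0 //.
  by apply/eqP; move/eqP: e; rewrite eqrXn2 ?absC_ge0.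
have e2 : rC (1 - absC z ^+ 2) * (v - w) =
    (1 - cjC z * w) * (v - z) - (w - z) * (1 - cjC z * v).
  have -> : rC (1 - absC z ^+ 2) = 1 - z * cjC z by rewrite rCB mulC_cj.
  ring.
have b1 : absC (w - z) <= absC (1 - cjC z * w).
  have := blaschke_le1 z1 w1; rewrite absCM absCV ler_pdivrMr // mul1r; exact.
(* Both terms of the decomposition are at most |1 - z~w| |v - z|; the 2 becomes the 4 of the
   statement after squaring. *)
have key : (1 - absC z ^+ 2) * absC (v - w) <= 2 * (absC (1 - cjC z * w) * absC (v - z)).
  have <- : absC (rC (1 - absC z ^+ 2) * (v - w)) = (1 - absC z ^+ 2) * absC (v - w).
    by rewrite absCM absC_rC ger0_norm // ltW.
  rewrite e2; apply: le_trans (absCB _ _) _; rewrite !absCM e1.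
  by rewrite mulr2n mulrDl !mul1r lerD2l ler_wpM2r ?absC_ge0.
have key2 : ((1 - absC z ^+ 2) * absC (v - w)) ^+ 2 <= 4 * (absC (1 - cjC z * w) * absC (v - z)) ^+ 2.
  have -> : 4 * (absC (1 - cjC z * w) * absC (v - z)) ^+ 2 = (2 * (absC (1 - cjC z * w) * absC (v - z))) ^+ 2 by ring.
  by rewrite lerXn2r // nnegrE ?mulr_ge0 ?absC_ge0 // ltW.
rewrite blaschke_lossE // /poisson ler_pdivrMr ?exprn_gt0 //.
set p := absC (v - w) in vw0 key key2 *; set q := 1 - absC z ^+ 2 in q0 key key2 *.
have k0 : 0 <= 1 - absC w ^+ 2 by rewrite subr_ge0 exprn_ile1 ?absC_ge0 // ltW.
set d := absC (1 - _) in key2 *; set x := absC (v - z) in key2 *.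
have -> : 4 * (x ^+ 2 / q) * ((1 - absC w ^+ 2) / p ^+ 2) * d ^+ 2 =
    (1 - absC w ^+ 2) * (4 * (d * x) ^+ 2 / (q * p ^+ 2)).
  by field; rewrite !gt_eqF.
rewrite mulrC ler_wpM2l // ler_pdivlMr ?mulr_gt0 ?exprn_gt0 //.
by apply: le_trans key2; rewrite le_eqVlt; apply/orP; left; apply/eqP; ring.
Qed.

End SingularFormula.

(** * Total loss of the Blaschke factors against the singular inner function *)

Section BlaschkeLoss.
Context {R : realType}.
Variables (J : set nat) (Z : nat -> C R) (Zk : nat -> set nat) (lam : nat -> C R)
  (a : nat -> {nonneg R}).
Hypothesis ZJ : forall n, J n -> disc (Z n).
Hypothesis ZkJ : \bigcup_k Zk k = J.
Hypothesis lam1 : forall k, circle (lam k).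
Hypothesis aE : (forall k, ((a k)%:num%:E = 2%:E *
    \esum_(n in Zk k)
      (absC (lam k - Z n) ^+ 2 / (1 - absC (Z n) ^+ 2))%:E)%E).
Hypothesis afin : (\sum_(0 <= k <oo) (a k)%:num%:E < +oo)%E.

Let q k n : R := absC (lam k - Z n) ^+ 2 / (1 - absC (Z n) ^+ 2).

Let q_ge0 k n : J n -> 0 <= q k n.
Proof.
move=> /ZJ /discE z1.
by rewrite divr_ge0 ?sqr_ge0 // subr_ge0 exprn_ile1 ?absC_ge0 // ltW.
Qed.

Let ZkP k n : Zk k n -> J n.
Proof. by move=> h; rewrite -ZkJ; exists k. Qed.

Lemma block_sum k N : 2 * \sum_(n < N | (n : nat) \in Zk k) q k n <= (a k)%:num.
Proof.
rewrite -lee_fin aE EFinM lee_wpmul2l ?lee_fin // -sumEFin.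
rewrite -(big_mkord (fun n => n \in Zk k) (fun n => (q k n)%:E)).
have q0 n : n \in Zk k -> (0 <= (q k n)%:E)%E.
  by rewrite inE lee_fin => /ZkP; exact: q_ge0.
have := nneseries_esum q0; rewrite (_ : [set x | _] = Zk k); last first.
  by apply/seteqP; split => n /=; rewrite inE.
by move=> <-; apply: nneseries_lim_ge => n _; exact: q0.
Qed.

(** Here s is twice the exponent of |S|. A zero in block k is charged to the Poisson kernel at
    [lam k], with constant 4 q, and the sum of q over the block is at most a k / 2; the charges add
    up to at most 2 sum a_k P, hence at most s. *)
Lemma blaschke_total_loss w : disc w ->
  exists2 s, absC (singular_inner (point_masses a lam) w) ^+ 2 = expR (- s) &
    forall N, \sum_(n < N | (n : nat) \in J) (1 - absC (blaschke (Z n) w) ^+ 2) <= s.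
Proof.
move=> w1; have [u uE hu] := singular_inner_abs lam1 afin w1.
exists (2 * u); first by rewrite uE -expRM_natl -mulrN.
move=> N.
(* A block containing n; the default 0, taken for n outside J, is harmless. Only finitely many
   blocks meet the first N indices, which gives the bound K on block numbers. *)
pose kap n := xget 0%N [set k | Zk k n].
have kapP n : n \in J -> Zk (kap n) n.
  rewrite inE -ZkJ => -[k _ hk]; exact: (@xgetPex _ 0%N [set k | Zk k n] (ex_intro _ k hk)).
pose K := (\max_(n < N) kap n).+1.
pose t k n := if n \in Zk k then 4 * q k n * poisson w (lam k) else 0.
have P0 k : 0 <= poisson w (lam k) by have /andP[] := poisson_bounds (lam1 k) w1.
have t0 k n : 0 <= t k n.
  rewrite /t; case: ifP => //; rewrite inE => /ZkP h.
  by apply: mulr_ge0 (P0 k); apply: mulr_ge0 (q_ge0 k h).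
apply: (@le_trans _ _ (\sum_(n < N | (n : nat) \in J) \sum_(k < K) t k n)).
  apply: ler_sum => n nJ; have hk := kapP n nJ.
  have kK : (kap n < K)%N by rewrite ltnS; exact: (leq_bigmax n).
  apply: (@le_trans _ _ (t (kap n) n)).
    rewrite /t mem_set //; apply: blaschke_loss_le => //.
    by apply: ZJ; rewrite inE in nJ.
  by rewrite (bigD1 (Ordinal kK)) //= lerDl sumr_ge0.
rewrite exchange_big /=.
apply: le_trans (ler_wpM2l (_ : 0 <= 2) (hu K)) => //; rewrite mulr_sumr.
apply: ler_sum => k _; apply: (@le_trans _ _ (2 * (2 * \sum_(n < N | (n : nat) \in Zk k) q k n) * poisson w (lam k))).
  rewrite mulrA -natrM mulr_sumr mulr_suml.
  rewrite [leLHS]big_mkcond [leRHS]big_mkcond /=; apply: ler_sum => n _.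
  rewrite /t; case: ifPn => nJ; case: ifPn => nk //.
  by move: nJ; rewrite !inE in nk *; move/negP; case; rewrite inE; exact: ZkP nk.
by rewrite -mulrA ler_wpM2l // ler_wpM2r // block_sum.
Qed.

End BlaschkeLoss.

(** * Division by linear factors *)

Section Division.
Context {R : realType}.
Implicit Types (c d : nat -> C R) (f g k : C R -> C R) (w z : C R).

Lemma coef_pser c : pbd c -> coef (pser c) = c.
Proof.
move=> hc; have ap := ps_analytic hc (pser_ps hc).
exact: ps_uniq (coef_pbd ap) hc (cauchy_ps ap) (pser_ps hc).
Qed.

Lemma coef_ext f g : analytic f -> analytic g -> (forall w, disc w -> f w = g w) ->
  coef f = coef g.
Proof.
move=> af ag fg.
exact: ps_uniq (coef_pbd af) (coef_pbd ag) (is_ps_ext (cauchy_ps af) fg) (cauchy_ps ag).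
Qed.

Lemma analytic_mul f g : analytic f -> analytic g -> analytic (fun w => f w * g w).
Proof. by move=> af ag w dw; apply: derivCM; [exact: af|exact: ag]. Qed.

Lemma analytic_sub f g : analytic f -> analytic g -> analytic (fun w => f w - g w).
Proof. by move=> af ag w dw; apply: derivCB; [exact: af|exact: ag]. Qed.

Lemma analytic_linear z : analytic (fun w => w - z).
Proof. by move=> w _; apply: derivCB; [exact: derivC_id|exact: derivC_cst]. Qed.

(** The coefficients of (w - z) k when d are those of k. *)
Definition linco z d n : C R := (if n is m.+1 then d m else 0) - z * d n.

Lemma linco_ps z d k : pbd d -> is_ps d k ->
  pbd (linco z d) /\ is_ps (linco z d) (fun w => (w - z) * k w).
Proof.
move=> hd hk.
pose s n : C R := if n is m.+1 then d m else 0.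
have hs : pbd s.
  move=> r hr; have [M MP] := hd r hr; have /andP[r0 r1] := hr.
  exists `|M| => -[|n]; first by rewrite /s absC0 mul0r.
  rewrite /s exprSr mulrA; apply: le_trans (_ : `|M| * r <= _); last first.
    by rewrite -[leRHS]mulr1 ler_wpM2l // ltW.
  by rewrite ler_wpM2r ?(ltW r0) //; apply: le_trans (MP n) (ler_norm _).
have ks : is_ps s (fun w => w * k w).
  move=> w dw; rewrite -cvg_shiftS.
  have -> : (fun N => psum s N.+1 w) = (fun N => w * psum d N w).
    apply/funext => N; rewrite /psum big_ord_recl mul0r add0r mulr_sumr.
    by apply: eq_bigr => i _; rewrite lift0 /= exprS mulrCA.
  by apply: (@cvgM _ _ \oo _ (fun=> w)); [exact: cvg_cst|exact: hk].
have H := is_psB ks (@is_psZ _ z _ _ hk); split.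
  have := pbdD hs (pbdZ (-1) (pbdZ z hd)); congr pbd.
  by apply/funext => n; rewrite mulN1r.
by apply: is_ps_ext H _ => w _; rewrite mulrBl.
Qed.

Lemma coef_linear z f k : analytic f -> analytic k ->
  (forall w, disc w -> f w = (w - z) * k w) -> coef f = linco z (coef k).
Proof.
move=> af ak fk; have [h1 h2] := linco_ps z (coef_pbd ak) (cauchy_ps ak).
apply: ps_uniq (coef_pbd af) h1 (cauchy_ps af) _.
by apply: is_ps_ext h2 _ => w dw; rewrite fk.
Qed.

Lemma divACA (x u v y : R) : x / u * (y / v) = y * (x / (u * v)).
Proof. by rewrite invfM; ring. Qed.

(** The recurrence d n = c n.+1 + z d n.+1, iterated upwards, gives a geometric series in |z|; its
    tail vanishes as d m = O(r ^ -m) for some r > |z|. The bound sees f only through M, so that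
    quotients of a bounded family are bounded together. *)
Lemma div_bound z f k (M : R) : disc z -> analytic f -> analytic k ->
  (forall w, disc w -> f w = (w - z) * k w) ->
  (forall n, absC (coef f n) <= M) -> forall n, absC (coef k n) <= M / (1 - absC z).
Proof.
move=> /discE z1 af ak fk hM n; have z0 := absC_ge0 z.
have cE := coef_linear af ak fk; set c := coef f in hM cE; set d := coef k in cE *.
have M0 : 0 <= M := le_trans (absC_ge0 _) (hM 0%N).
have step m : absC (d m) <= M + absC z * absC (d m.+1).
  have -> : d m = c m.+1 + z * d m.+1 by rewrite cE /linco subrK.
  by apply: le_trans (absCD _ _) _; rewrite absCM lerD2r.
have iter m : absC (d n) <= M * \sum_(j < m) absC z ^+ j + absC z ^+ m * absC (d (n + m)%N).
  elim: m => [|m ih]; first by rewrite big_ord0 mulr0 add0r expr0 mul1r addn0.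
  have h := ler_wpM2l (exprn_ge0 m z0) (step (n + m)%N).
  apply: le_trans ih _; rewrite big_ord_recr exprSr addnS mulrDr -addrA lerD2l.
  by apply: le_trans h _; rewrite mulrDr mulrA [absC z ^+ m * M]mulrC.
have [r /andP[zr r1]] : exists r, absC z < r < 1 by exists ((1 + absC z) / 2); lra.
have r0 : 0 < r := le_lt_trans z0 zr; have hr : 0 < r < 1 by rewrite r0.
have [M' MP] := coef_pbd ak hr.
have q1 : `|absC z / r| < 1.
  have h0 : 0 <= absC z / r by rewrite divr_ge0 // ltW.
  by rewrite ger0_norm // ltr_pdivrMr // mul1r.
have cv : M / (1 - absC z) + M' / r ^+ n * (absC z / r) ^+ m @[m --> \oo] --> M / (1 - absC z).
  rewrite -[X in _ --> X]addr0 -[X in _ --> _ + X](mulr0 (M' / r ^+ n)).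
  apply: cvgD; first exact: cvg_cst.
  by apply: (@cvgM _ _ \oo _ (fun=> M' / r ^+ n)); [exact: cvg_cst|exact: cvg_expr].
rewrite -(cvg_lim _ cv) //; apply: limr_ge; first exact: cvgP cv.
apply: nearW => m; apply: le_trans (iter m) _; apply: lerD.
  by rewrite ler_wpM2l // geo_sum_le // z0.
have := MP (n + m)%N; rewrite exprD => h.
have -> : M' / r ^+ n * (absC z / r) ^+ m = absC z ^+ m * (M' / (r ^+ n * r ^+ m)).
  by rewrite expr_div_n divACA.
by rewrite ler_wpM2l ?exprn_ge0 // ler_pdivlMr // mulr_gt0 // exprn_gt0.
Qed.

(** The case M = 0 of [div_bound], for the difference f - g. *)
Lemma linear_cancel z f g : disc z -> analytic f -> analytic g ->
  (forall w, disc w -> (w - z) * f w = (w - z) * g w) -> forall w, disc w -> f w = g w.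
Proof.
move=> z1 af ag fg.
pose u := fun w => f w - g w; have au : analytic u := analytic_sub af ag.
have a0 : analytic (fun _ : C R => 0) by move=> w _; exact: derivC_cst.
have c0 n : coef (fun _ : C R => 0) n = 0.
  have h : is_ps (fun _ : nat => 0 : C R) (fun=> 0).
    move=> w _.
    have -> : (fun N => psum (fun _ : nat => 0 : C R) N w) = (fun=> 0); last exact: cvg_cst.
    by apply/funext => N; rewrite /psum big1 // => i _; rewrite mul0r.
  have hb : pbd (fun _ : nat => 0 : C R) by apply: (@bounded_pbd _ _ 0) => m; rewrite absC0.
  by rewrite (ps_uniq (coef_pbd a0) hb (cauchy_ps a0) h).
have b n : absC (coef u n) <= 0 / (1 - absC z).
  apply: (div_bound z1 a0 au) => [w dw|m]; last by rewrite c0 absC0.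
  by rewrite /u mulrBr fg // subrr.
move=> w dw; apply/eqP; rewrite -subr_eq0 -/(u w); apply/eqP.
apply: cvg_uniqC (cauchy_ps au dw) _.
have -> : (fun N => psum (coef u) N w) = (fun=> 0); last exact: cvg_cst.
apply/funext => N; rewrite /psum big1 // => i _.
have : coef u i = 0.
  by apply/eqP; rewrite -absC_eq0 eq_le absC_ge0 andbT (le_trans (b i)) // mul0r.
by move=> ->; rewrite mul0r.
Qed.

(** The quotient has the coefficients d i = sum_j c (i + j + 1) z ^ j, which satisfy c =
    [linco z d]: the equation of index 0 is f z = 0, the others hold by splitting off the term j =
    0. *)
Lemma div_exists z f : disc z -> analytic f -> f z = 0 ->
  exists2 k, analytic k & forall w, disc w -> f w = (w - z) * k w.
Proof.
move=> z1 af fz; set c := coef f; have hc : pbd c := coef_pbd af; have z0 := absC_ge0 z.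
have hs i : pbd (fun j => c (i + j.+1)%N).
  elim: i => [|i ih]; first exact: pbd_shift hc.
  have := pbd_shift ih; congr pbd; apply/funext => j; by rewrite -addSnnS.
pose d i := pser (fun j => c (i + j.+1)%N) z.
have dS i : d i = c i.+1 + z * d i.+1.
  apply: cvg_uniqC (pser_ps (hs i) z1) _; rewrite -cvg_shiftS.
  have -> : (fun N => psum (fun j => c (i + j.+1)%N) N.+1 z) =
     (fun N => c i.+1 + z * psum (fun j => c (i.+1 + j.+1)%N) N z).
    apply/funext => N; rewrite /psum big_ord_recl expr0 mulr1 addn1 mulr_sumr; congr (_ + _).
    by apply: eq_bigr => j _; rewrite lift0 exprS mulrCA addSnnS.
  apply: cvgD; first exact: cvg_cst.
  by apply: (@cvgM _ _ \oo _ (fun=> z)); [exact: cvg_cst|exact: pser_ps (hs i.+1) _ z1].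
have d0 : c 0%N = - (z * d 0%N).
  apply/eqP; rewrite -addr_eq0; apply/eqP; rewrite -fz.
  symmetry; apply: cvg_uniqC (cauchy_ps af z1) _; rewrite -cvg_shiftS.
  have -> : (fun N => psum c N.+1 z) = (fun N => c 0%N + z * psum (fun j => c (0 + j.+1)%N) N z).
    apply/funext => N; rewrite /psum big_ord_recl expr0 mulr1 mulr_sumr; congr (_ + _).
    by apply: eq_bigr => j _; rewrite lift0 exprS mulrCA.
  apply: cvgD; first exact: cvg_cst.
  by apply: (@cvgM _ _ \oo _ (fun=> z)); [exact: cvg_cst|exact: pser_ps (hs 0%N) _ z1].
have hd : pbd d.
  move=> r' /andP[r'0 r'1]; have z1' : absC z < 1 by [].
  have [r [r'r zr r1]] : exists r, [/\ r' <= r, absC z < r & r < 1].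
    exists (Num.max r' ((1 + absC z) / 2)); rewrite le_max lt_max gt_max lexx r'1.
    by split => //=; [apply/orP; right; lra|lra].
  have r0 : 0 < r := le_lt_trans z0 zr; have hr : 0 < r < 1 by rewrite r0.
  have [M MP] := hc r hr.
  have hq : 0 <= absC z / r < 1 by rewrite divr_ge0 ?(ltW r0) //= ltr_pdivrMr // mul1r.
  have M0 : 0 <= M by apply: le_trans (MP 0%N); rewrite expr0 mulr1 absC_ge0.
  exists (M / r * (1 - absC z / r)^-1) => i.
  apply: (@le_trans _ _ (absC (d i) * r ^+ i)).
    by rewrite ler_wpM2l ?absC_ge0 // lerXn2r // ?nnegrE ?(ltW r'0) ?(ltW r0).
  rewrite -ler_pdivlMr ?exprn_gt0 //.
  apply: (cvg_ub (@cvg_absC _ _ \oo _ _ _ (pser_ps (hs i) z1))); apply: nearW => N /=.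
  apply: le_trans (absC_sum _ _ _) _; rewrite ler_pdivlMr ?exprn_gt0 // mulr_suml.
  apply: (@le_trans _ _ (\sum_(j < N) M / r * (absC z / r) ^+ j)); last first.
    by rewrite -mulr_sumr ler_wpM2l ?divr_ge0 ?(ltW r0) // geo_sum_le.
  apply: ler_sum => j _; rewrite absCM absCX.
  have := MP (i + j.+1)%N; rewrite exprD exprS => h.
  have -> : M / r * (absC z / r) ^+ j = absC z ^+ j * (M / (r * r ^+ j)).
    by rewrite expr_div_n divACA.
  rewrite mulrAC mulrC ler_wpM2l ?exprn_ge0 // ler_pdivlMr ?mulr_gt0 ?exprn_gt0 //.
  by rewrite -mulrA.
have cE : c = linco z d.
  by apply/funext => -[|n]; rewrite /linco ?sub0r // dS addrK.
have hk := pser_ps hd; exists (pser d); first exact: ps_analytic hd hk.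
have [_ h2] := linco_ps z hd hk; rewrite -cE in h2.
by move=> w dw; exact: is_ps_fun_uniq (cauchy_ps af) h2 w dw.
Qed.

End Division.

(** * Limits and the extremal function *)

Section Normal.
Context {R : realType}.
Implicit Types (c d : nat -> C R) (f g k : C R -> C R) (w z p : C R) (M L K : R).

Lemma pser_tail c M w N : (forall n, absC (c n) <= M) -> disc w ->
  absC (pser c w - psum c N w) <= M * absC w ^+ N / (1 - absC w).
Proof.
move=> hM /discE w1; have w0 := absC_ge0 w.
have M0 : 0 <= M := le_trans (absC_ge0 _) (hM 0%N).
have cv := pser_ps (bounded_pbd hM) w1.
have cv' : absC (psum c (k + N) w - psum c N w) @[k --> \oo] --> absC (pser c w - psum c N w).
  have h : psum c (k + N) w - psum c N w @[k --> \oo] --> pser c w - psum c N w.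
    by apply: cvgB; [rewrite -(cvg_shiftn N) in cv; exact: cv|exact: cvg_cst].
  exact: (@cvg_absC R _ \oo _ _ _ h).
apply: (cvg_ub cv'); apply: nearW => k; rewrite addnC.
apply: (@le_trans _ _ (\sum_(i < k) M * absC w ^+ (N + i))).
  elim: k => [|k ih]; first by rewrite addn0 subrr absC0 big_ord0.
  rewrite addnS psumS big_ord_recr /= addrAC; apply: le_trans (absCD _ _) _.
  by apply: lerD ih _; rewrite absCM absCX ler_wpM2r ?exprn_ge0.
have -> : \sum_(i < k) M * absC w ^+ (N + i) = M * absC w ^+ N * \sum_(i < k) absC w ^+ i.
  by rewrite mulr_sumr; apply: eq_bigr => i _; rewrite exprD mulrA.
by rewrite ler_wpM2l ?mulr_ge0 ?exprn_ge0 // geo_sum_le // w0.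
Qed.

(** * Coefficientwise limits along an ultrafilter *)

Section Ultra.
Context (U : set_system nat) (UU : UltraFilter U).

Lemma ultra_lim (u : nat -> R) M : (forall j, `|u j| <= M) -> exists l : R, u @ U --> l.
Proof.
move=> hM; have hu : U (u @^-1` `[- M, M]%classic).
  rewrite (_ : _ @^-1` _ = setT); first exact: filterT.
  by apply/seteqP; split => // j _; rewrite /= in_itv /= -ler_norml.
have [l [_ hl]] := @segment_compact R (- M) M (u @ U) _ hu.
exists l => B nB; have [//|hB] := in_ultra_setVsetC (u @^-1` B) UU.
by have [x [nBx Bx]] := hl (~` B) B hB nB.
Qed.

Lemma ultra_limC (u : nat -> C R) M : (forall j, absC (u j) <= M) -> exists l : C R, u @ U --> l.
Proof.
move=> hM.
have [a ha] := @ultra_lim (fun j => reC (u j)) M (fun j => le_trans (reC_le _) (hM j)).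
have [b hb] := @ultra_lim (fun j => imC (u j)) M (fun j => le_trans (imC_le _) (hM j)).
exists (mkC a b); have FU : Filter U by exact: _.
have := @cvg_mkC R _ U FU _ _ _ _ ha hb.
by have -> : (fun x => mkC (reC (u x)) (imC (u x))) = u by apply/funext => j; rewrite -mkCE.
Qed.

(** One ultrafilter serves all n at once, in place of a diagonal extraction. *)
Lemma ultra_lim_coef (c : nat -> nat -> C R) M : (forall j n, absC (c j n) <= M) ->
  exists d, forall n, c j n @[j --> U] --> d n.
Proof.
move=> hM; have h n : exists l : C R, c j n @[j --> U] --> l by exact: (@ultra_limC (c ^~ n) M).
by have [d hd] := choice h; exists d.
Qed.

Lemma ultra_coef_le (c : nat -> nat -> C R) d M : (forall j n, absC (c j n) <= M) ->
  (forall n, c j n @[j --> U] --> d n) -> forall n, absC (d n) <= M.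
Proof.
by move=> hM hd n; apply: (cvg_ub (@cvg_absC R _ U _ _ _ (hd n))); apply: nearW => j; exact: hM.
Qed.

Lemma ultra_psum (c : nat -> nat -> C R) d N w : 
  (forall n, c j n @[j --> U] --> d n) -> psum (c j) N w @[j --> U] --> psum d N w.
Proof.
move=> hd; elim: N => [|N ih].
  have -> : (fun j => psum (c j) 0 w) = (fun=> 0).
    by apply/funext => j; rewrite /psum big_ord0.
  by rewrite /psum big_ord0; exact: cvg_cst.
have -> : (fun j => psum (c j) N.+1 w) = (fun j => psum (c j) N w + c j N * w ^+ N).
  by apply/funext => j; rewrite psumS.
rewrite psumS; have h : c j N * w ^+ N @[j --> U] --> d N * w ^+ N.
  by apply: (@cvgM _ _ U _ (fun j => c j N) (fun=> w ^+ N)); [exact: hd|exact: cvg_cst].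
exact: (@cvgD _ _ _ U _ _ _ _ _ ih h).
Qed.

(** The tails of the series are small uniformly in j, and finite partial sums pass to the limit. *)
Lemma ultra_pser (c : nat -> nat -> C R) d M w : (forall j n, absC (c j n) <= M) ->
  (forall n, c j n @[j --> U] --> d n) -> disc w ->
  pser (c j) w @[j --> U] --> pser d w.
Proof.
move=> hM hd w1; apply/cvgCP => e e0; have dM := ultra_coef_le hM hd.
have M0 : 0 <= M := le_trans (absC_ge0 _) (dM 0%N); have w0 := absC_ge0 w.
have /discE w1' := w1.
have cv : M / (1 - absC w) * absC w ^+ N @[N --> \oo] --> 0.
  rewrite -(mulr0 (M / (1 - absC w))).
  apply: (@cvgM _ _ \oo _ (fun=> M / (1 - absC w))); first exact: cvg_cst.
  by apply: cvg_expr; rewrite ger0_norm.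
have e3 : 0 < e / 3 by rewrite divr_gt0.
have /cvgrPdist_lt /(_ _ e3) [N _ hN] := cv.
have tl : M * absC w ^+ N / (1 - absC w) < e / 3.
  have := hN N (leqnn N); rewrite /= sub0r normrN mulrAC; apply: le_lt_trans; exact: ler_norm.
have /cvgCP /(_ _ e3) := @ultra_psum c d N w hd; apply: filterS => j hj.
have t1 := pser_tail N (hM j) w1; have t2 := pser_tail N dM w1.
have -> : pser (c j) w - pser d w = (pser (c j) w - psum (c j) N w) +
    (psum (c j) N w - psum d N w) - (pser d w - psum d N w) by ring.
apply: le_lt_trans (absCB _ _) _; apply: le_lt_trans (lerD (absCD _ _) (lexx _)) _.
lra.
Qed.

Lemma ultra_sum_le (c : nat -> nat -> C R) d (x : nat -> R) L N :
  (forall n, c j n @[j --> U] --> d n) ->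
  (forall j, \sum_(n < N) x n * absC (c j n) ^+ 2 <= L) -> \sum_(n < N) x n * absC (d n) ^+ 2 <= L.
Proof.
move=> hd hL.
apply: (@cvg_ub _ _ U _ (fun j => \sum_(n < N) x n * absC (c j n) ^+ 2)); last exact: nearW.
apply: (@cvg_sumr _ _ U _ N (fun n j => x n * absC (c j n) ^+ 2) (fun n => x n * absC (d n) ^+ 2)) => n.
apply: (@cvgM _ _ U _ (fun=> x n)); first exact: cvg_cst.
have h := @cvg_absC R _ U _ _ _ (hd n).
by under eq_fun do rewrite expr2; rewrite expr2; apply: cvgM; exact: h.
Qed.

End Ultra.

(** * Admissible functions: norm bounds and prescribed zeros *)

Section Admissible.
Variables (J : set nat) (Z : nat -> C R) (L K : R).
Hypothesis ZJ : forall n, J n -> disc (Z n).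

(* Multiplicities are counted by vanishing to the order of the first N terms of the sequence,
   so that admissibility for all N prescribes the zeros with multiplicity. *)
Definition seqfac n w : C R := if n \in J then w - Z n else 1.
Definition seqprod N w : C R := \prod_(n < N) seqfac n w.

Definition admissible N f := [/\ analytic f, lsum (coef f) L, dsum (coef f) K &
  exists2 k, analytic k & forall w, disc w -> f w = seqprod N w * k w].

Lemma analytic_zfac n : analytic (seqfac n).
Proof.
move=> w dw; rewrite /seqfac; case: (n \in J); first exact: (@analytic_linear R (Z n) w dw).
exact: derivC_cst.
Qed.

Lemma zprodS N w : seqprod N.+1 w = seqprod N w * seqfac N w.
Proof. by rewrite /seqprod big_ord_recr. Qed.

(** B depends on N and M only, which allows the quotients of a whole sequence of functions to pass
    to the limit. *)
Lemma zprod_bound N M : exists B, forall f k, analytic f -> analytic k ->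
  (forall w, disc w -> f w = seqprod N w * k w) ->
  (forall n, absC (coef f n) <= M) -> forall n, absC (coef k n) <= B.
Proof.
elim: N => [|N [B hB]].
  exists M => f k af ak fk hM n; rewrite -(coef_ext af ak) // => w dw.
  by rewrite fk // /seqprod big_ord0 mul1r.
have [NJ|NJ] := boolP (N \in J); last first.
  exists B => f k af ak fk; apply: (hB f) => // w dw.
  by rewrite fk // zprodS /seqfac (negbTE NJ) mulr1.
exists (B / (1 - absC (Z N))) => f k af ak fk hM.
pose k' := fun w => (w - Z N) * k w.
have ak' : analytic k' := analytic_mul (@analytic_linear R (Z N)) ak.
have b' : forall n, absC (coef k' n) <= B.
  by apply: (hB f) => // w dw; rewrite fk // zprodS /seqfac NJ mulrA.
by apply: (div_bound _ ak' ak) => //; apply: ZJ; rewrite inE in NJ.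
Qed.

Lemma lsum_coef_le c n : lsum c L -> absC (c n) <= 1 + L.
Proof.
move=> /(_ n.+1); rewrite big_ord_recr /= => h.
have h0 : 0 <= \sum_(i < n) absC (c i) ^+ 2 by apply: sumr_ge0 => i _; exact: sqr_ge0.
have : absC (c n) <= 1 + absC (c n) ^+ 2 by have := sqr_ge0 (absC (c n) - 1); nra.
lra.
Qed.

Lemma pser_coef k w : analytic k -> disc w -> pser (coef k) w = k w.
Proof. by move=> ak; exact: is_ps_fun_uniq (pser_ps (coef_pbd ak)) (cauchy_ps ak) w. Qed.

(** Each N is below almost all j, so the limit is divisible by every [seqprod N]: the quotients have
    uniformly bounded coefficients and converge along the same ultrafilter. The lower bounds b are
    variable to accommodate maximising sequences. *)
Lemma admissible_limit p (f : nat -> C R -> C R) (b : nat -> R) (b0 : R) : disc p ->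
  (forall j N, (N <= j)%N -> admissible N (f j)) -> (forall j, b j <= absC (f j p)) ->
  b j @[j --> \oo] --> b0 ->
  exists2 g, forall N, admissible N g & b0 <= absC (g p).
Proof.
move=> p1 hf hb bb.
have [U [UU oU]] := ultraFilterLemma (F := \oo).
have FU : Filter U by exact: _.
have af j : analytic (f j) by have [] := hf j 0%N (leq0n j).
have lf j : lsum (coef (f j)) L by have [] := hf j 0%N (leq0n j).
have df j : dsum (coef (f j)) K by have [] := hf j 0%N (leq0n j).
have cM j n : absC (coef (f j) n) <= 1 + L := lsum_coef_le n (lf j).
have [c hc] := ultra_lim_coef UU cM.
have hcp : pbd c := bounded_pbd (ultra_coef_le UU cM hc).
have ag : analytic (pser c) := ps_analytic hcp (pser_ps hcp).
exists (pser c); last first.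
  have cv1 := @cvg_absC R _ U FU _ _ (ultra_pser UU cM hc p1).
  have cv2 : b @ U --> b0 by apply: cvg_trans bb; exact: cvg_app.
  rewrite -subr_ge0 -oppr_le0 opprB.
  apply: (@cvg_ub _ _ U _ (fun j => b j - absC (pser (coef (f j)) p))).
    by apply: cvgB; [exact: cv2|exact: cv1].
  by apply: nearW => j; rewrite subr_le0 (pser_coef (af j) p1); exact: hb.
move=> N; split; [exact: ag| | |]; rewrite ?(coef_pser hcp).
- move=> n; have h := @ultra_sum_le U UU (fun j => coef (f j)) c (fun=> 1) L n hc.
  under eq_bigr do rewrite -[_ ^+ 2]mul1r; apply: h => j.
  by under eq_bigr do rewrite mul1r; exact: lf.
- by move=> n; apply: (@ultra_sum_le U UU (fun j => coef (f j)) c (fun i => i%:R) K n hc) => j; exact: df.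
have [B hB] := zprod_bound N (1 + L).
have hk j : exists k, (N <= j)%N -> analytic k /\ forall w, disc w -> f j w = seqprod N w * k w.
  case: (leqP N j) => [Nj|_]; last by exists (fun=> 0).
  by have [_ _ _ [k ak fk]] := hf j N Nj; exists k.
have [k {}hk] := choice hk.
(* For j < N there may be no quotient; the default 0 keeps the bound, and the ultrafilter does not
   see these finitely many j. *)
pose d j n := if (N <= j)%N then coef (k j) n else 0.
have dB j n : absC (d j n) <= `|B|.
  rewrite /d; case: ifP => [Nj|_]; last by rewrite absC0.
  have [ak fk] := hk j Nj; apply: le_trans (ler_norm _).
  exact: (hB (f j) (k j) (af j) ak fk (cM j)).
have [e he] := ultra_lim_coef UU dB.
have hep : pbd e := bounded_pbd (ultra_coef_le UU dB he).
exists (pser e); first exact: ps_analytic hep (pser_ps hep).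
move=> w dw; apply: (@cvg_uniqC R _ U _ (fun j => pser (coef (f j)) w)).
  have h := ultra_pser UU cM hc dw; exact: h.
have h1 := ultra_pser UU dB he dw.
have cv : seqprod N w * pser (d j) w @[j --> U] --> seqprod N w * pser e w.
  by apply: (@cvgM _ _ U _ (fun=> seqprod N w)); [exact: cvg_cst|exact: h1].
apply: cvg_trans cv; apply: near_eq_cvg.
have : \oo [set j | (N <= j)%N] by exists N.
move=> /oU; apply: filterS => j Nj /=; have [ak fk] := hk j Nj.
rewrite (pser_coef (af j) dw) (fk w dw); congr (_ * _).
have -> : d j = coef (k j) by apply/funext => n; rewrite /d Nj.
exact: pser_coef.
Qed.

End Admissible.

End Normal.

(** * The extremal function *)

Section Extremal.
Context {R : realType}.
Implicit Types (f g k : C R -> C R) (w z p : C R).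
Variables (J : set nat) (Z : nat -> C R) (L K : R).
Hypothesis ZJ : forall n, J n -> disc (Z n).
Notation zfac := (seqfac J Z).
Notation zprod := (seqprod J Z).
Notation adm := (admissible J Z L K).

Lemma analytic_zfac_prod (s : seq nat) : analytic (fun w => \prod_(n <- s) zfac n w).
Proof.
elim: s => [|n s ih].
  have -> : (fun w => \prod_(n <- [::]) zfac n w) = (fun=> 1).
    by apply/funext => w; rewrite big_nil.
  by move=> w _; exact: derivC_cst.
have -> : (fun w => \prod_(i <- n :: s) zfac i w) = (fun w => zfac n w * \prod_(i <- s) zfac i w).
  by apply/funext => w; rewrite big_cons.
exact: analytic_mul (@analytic_zfac R J Z n) ih.
Qed.

Lemma zprod_split N N' w : (N <= N')%N ->
  zprod N' w = zprod N w * \prod_(n <- index_iota N N') zfac n w.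
Proof.
move=> NN'; rewrite /seqprod -!(big_mkord xpredT (fun n => zfac n w)).
exact: big_cat_nat (leq0n N) NN'.
Qed.

Lemma admissible_le N N' f : (N <= N')%N -> adm N' f -> adm N f.
Proof.
move=> NN' [af lf df [k ak fk]]; split; [exact: af|exact: lf|exact: df|].
exists (fun w => \prod_(n <- index_iota N N') zfac n w * k w).
  exact: analytic_mul (@analytic_zfac_prod (index_iota N N')) ak.
by move=> w dw; rewrite fk // (zprod_split w NN') mulrA.
Qed.

Lemma zprod_cancel N f g : analytic f -> analytic g ->
  (forall w, disc w -> zprod N w * f w = zprod N w * g w) -> forall w, disc w -> f w = g w.
Proof.
elim: N f g => [|N ih] f g af ag fg w dw.
  by have := fg w dw; rewrite /seqprod !big_ord0 !mul1r.
have h : forall w, disc w -> zfac N w * f w = zfac N w * g w.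
  apply: ih; [exact: analytic_mul (@analytic_zfac R J Z N) af|
    exact: analytic_mul (@analytic_zfac R J Z N) ag|].
  by move=> v dv; have := fg v dv; rewrite !zprodS !mulrA.
have [NJ|NJ] := boolP (N \in J); last first.
  by have := h w dw; rewrite /seqfac (negbTE NJ) !mul1r.
apply: (@linear_cancel R (Z N) f g _ af ag) dw; first by apply: ZJ; rewrite inE in NJ.
by move=> v dv; have := h v dv; rewrite /seqfac NJ.
Qed.

Lemma admissible_bounded g p : disc p -> adm 0 g -> absC (g p) <= (1 + L) / (1 - absC p).
Proof.
move=> p1 [ag lg _ _]; have h n := lsum_coef_le n lg.
have := pser_tail 0 h p1; rewrite (pser_coef ag p1) /psum big_ord0 subr0 expr0 mulr1.
exact.
Qed.

(** The sequence f provides, by a first limit, a competitor with value at least del at p; a second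
    limit, of a maximising sequence, attains the supremum. *)
Lemma extremal_exists p (del : R) (f : nat -> C R -> C R) : disc p -> 0 < del ->
  (forall j N, (N <= j)%N -> adm N (f j)) -> (forall j, del <= absC (f j p)) ->
  exists g, [/\ forall N, adm N g, 0 < absC (g p) &
    forall g', (forall N, adm N g') -> absC (g' p) <= absC (g p)].
Proof.
move=> p1 d0 hf fd.
have [g0 hg0 g0d] := admissible_limit ZJ p1 hf fd (cvg_cst del).
pose A := [set absC (g p) | g in [set g | forall N, adm N g]].
have hA : has_sup A.
  split; first by exists (absC (g0 p)); exists g0.
  by exists ((1 + L) / (1 - absC p)) => _ [g hg <-]; exact: admissible_bounded p1 (hg 0%N).
have hs j : exists g, (forall N, adm N g) /\ sup A - j.+1%:R^-1 <= absC (g p).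
  have e0 : 0 < (j.+1%:R^-1 : R) by rewrite invr_gt0 ltr0n.
  have [_ [g hg <-] /ltW hle] := sup_adherent e0 hA.
  by exists g.
have [h hh] := choice hs.
have cv : sup A - j.+1%:R^-1 @[j --> \oo] --> sup A.
  rewrite -[X in _ --> X]subr0; apply: cvgB; [exact: cvg_cst|exact: cvg_harmonic].
have [g hg gA] := admissible_limit ZJ p1 (fun j N _ => (hh j).1 N) (fun j => (hh j).2) cv.
exists g; split; first exact: hg.
- apply: lt_le_trans d0 _; apply: le_trans g0d _; apply: le_trans gA.
  by apply: sup_upper_bound => //; exists g0.
- by move=> g' hg'; apply: le_trans gA; apply: sup_upper_bound => //; exists g'.
Qed.

(** The condition on Z concerns the indices from N on only. With N = 0 the lemma excludes zeros
    outside Z; with N past the last occurrence of z it excludes excess multiplicity at z. *)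
Lemma extremal_no_extra_zero p g : disc p -> (forall N, adm N g) -> 0 < absC (g p) ->
  (forall g', (forall N, adm N g') -> absC (g' p) <= absC (g p)) ->
  forall z N k, disc z -> (forall n, (N <= n)%N -> J n -> Z n <> z) ->
  analytic k -> (forall w, disc w -> g w = zprod N w * k w) -> k z <> 0.
Proof.
move=> p1 hg gp gmax z N k z1 zN ak gk kz.
(* The extra factor w - z has to be split off beside the prescribed zeros at every level N'. It is
   found at the common level [maxn N N'], where the factors between N and that level do not vanish
   at z. *)
have ext N' : exists2 k', analytic k' & forall w, disc w -> g w = zprod N' w * ((w - z) * k' w).
  have NM : (N <= maxn N N')%N by rewrite leq_maxl.
  have NM' : (N' <= maxn N N')%N by rewrite leq_maxr.
  have [_ _ _ [k2 ak2 gk2]] := hg (maxn N N').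
  pose rst a b w := \prod_(n <- index_iota a b) zfac n w.
  have hk : forall w, disc w -> k w = rst N (maxn N N') w * k2 w.
    apply: (zprod_cancel (N := N)); first exact: ak.
      exact: analytic_mul (@analytic_zfac_prod (index_iota N (maxn N N'))) ak2.
    by move=> w dw; rewrite -gk // gk2 // (zprod_split w NM) mulrA.
  have k2z : k2 z = 0.
    have := hk z z1; rewrite kz => /esym/eqP; rewrite mulf_eq0 => /orP[|/eqP //].
    rewrite /rst prodf_seq_eq0 => /hasP[n]; rewrite mem_index_iota => /andP[Nn _] /=.
    rewrite /seqfac; case: ifPn => nJ; last by rewrite oner_eq0.
    by rewrite subr_eq0 => /eqP e; case: (zN n Nn _ (esym e)); rewrite inE in nJ.
  have [k3 ak3 k23] := div_exists z1 ak2 k2z.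
  exists (fun w => rst N' (maxn N N') w * k3 w).
    exact: analytic_mul (@analytic_zfac_prod (index_iota N' (maxn N N'))) ak3.
  move=> w dw; rewrite gk2 // (zprod_split w NM') k23 // -/(rst _ _ _); ring.
pose den w := 1 - cjC z * w.
have aden : analytic den.
  move=> w _; apply: derivCB; first exact: derivC_cst.
  by apply: derivCM; [exact: derivC_cst|exact: derivC_id].
have hext N' : exists k', analytic k' /\ forall w, disc w -> g w = zprod N' w * ((w - z) * k' w).
  by have [k' ak' gk'] := ext N'; exists k'.
have [kk hkk] := choice hext.
(* This is g divided by the Blaschke factor of z. The quotients [kk] are chosen level by level;
   [same] shows that they all describe this one function. *)
pose g' w := den w * (zprod 0 w * kk 0%N w).
have az N' : analytic (zprod N').
  have -> : zprod N' = (fun w => \prod_(n <- index_iota 0 N') zfac n w).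
    by apply/funext => w; rewrite /seqprod -(big_mkord xpredT (fun n => zfac n w)).
  exact: analytic_zfac_prod.
have akk N' : analytic (kk N') := (hkk N').1.
have azk N' : analytic (fun w => zprod N' w * kk N' w) := analytic_mul (az N') (akk N').
have ag' : analytic g' := analytic_mul aden (azk 0%N).
have ag : analytic g by have [] := hg 0%N.
have same N' : forall w, disc w -> zprod N' w * kk N' w = zprod 0 w * kk 0%N w.
  apply: (@linear_cancel R z _ _ z1 (azk N') (azk 0%N)) => w dw.
  by rewrite mulrCA -(hkk N').2 // (hkk 0%N).2 // mulrCA.
have g'E N' w : disc w -> g' w = zprod N' w * (den w * kk N' w).
  by move=> dw; rewrite /g' -(same N') // mulrCA.
have bg w : disc w -> g w = blaschke z w * g' w.
  move=> dw; rewrite (hkk 0%N).2 // /g' /blaschke.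
  have d0 : den w != 0 by rewrite -absC_gt0; exact: blaschke_den.
  rewrite -/(den w) [RHS]mulrA (divfK d0); exact: mulrCA.
have [_ lg dg _] := hg 0%N.
have q0 : 0 < 1 - absC z by rewrite subr_gt0; exact: z1.
(* The constant for [dsum_div]: it bounds (1 - |z|^2) / |1 - z~w|^2, since |1 - z~w| >= 1 - |z|. *)
have C00 : 0 <= (1 - absC z ^+ 2) / (1 - absC z) ^+ 2.
  by rewrite divr_ge0 ?sqr_ge0 // subr_ge0 exprn_ile1 ?absC_ge0 // ltW.
have gle w : disc w -> absC (g w) <= absC (g' w).
  move=> dw; rewrite bg // absCM -[leRHS]mul1r ler_wpM2r ?absC_ge0 //.
  exact: blaschke_le1.
have gge w : disc w -> absC (g' w) ^+ 2 *
    (1 - (1 - absC z ^+ 2) / (1 - absC z) ^+ 2 * (1 - absC w ^+ 2)) <= absC (g w) ^+ 2.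
  move=> dw; rewrite bg // absCM exprMn mulrC ler_wpM2r ?sqr_ge0 //.
  have := blaschke_lossE z1 dw => h.
  rewrite lerBlDl -lerBlDr h mulrAC ler_wpM2r //.
    by rewrite subr_ge0 exprn_ile1 ?absC_ge0 // ltW.
  have z2 : 0 <= 1 - absC z ^+ 2 by rewrite subr_ge0 exprn_ile1 ?absC_ge0 // ltW.
  have d0 := blaschke_den z1 dw.
  rewrite ler_wpM2l // lef_pV2 ?posrE ?exprn_gt0 // lerXn2r ?nnegrE ?absC_ge0 ?(ltW q0) //.
  have := absC_sub 1 (cjC z * w); rewrite absC1 absCM absC_cj; apply: le_trans.
  by rewrite lerB // -[leRHS]mulr1 ler_wpM2l ?absC_ge0 //; apply: ltW.
have [lg' dg'] := dsum_div ag ag' C00 gle gge lg dg.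
have hg' N' : adm N' g'.
  split; [exact: ag'|exact: lg'|exact: dg'|].
  by exists (fun w => den w * kk N' w); [exact: analytic_mul aden (akk N')|exact: g'E].
have := gmax g' hg'; rewrite leNgt => /negP; apply.
have b1 : absC (blaschke z p) < 1.
  have h := blaschke_lossE z1 p1.
  have : 0 < 1 - absC (blaschke z p) ^+ 2.
    rewrite h divr_gt0 ?exprn_gt0 ?blaschke_den // mulr_gt0 // subr_gt0 expr_lt1 ?absC_ge0 //.
  by rewrite subr_gt0 expr_lt1 ?absC_ge0.
have g'p : 0 < absC (g' p) := lt_le_trans gp (gle p p1).
by rewrite bg // absCM -[ltRHS]mul1r ltr_pM2r.
Qed.

End Extremal.

(** * Zero sets *)

Section ZeroSet.
Context {R : realType}.
Implicit Types (f g k : C R -> C R) (w z p : C R).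

Lemma card_set_seq (s : seq nat) : uniq s -> ([set` s] #= `I_(size s))%card.
Proof.
move=> us; apply/card_set_bijP; exists (fun n => index n s); split.
- by move=> n /= ns; rewrite index_mem.
- by move=> m n; rewrite !inE /= => ms ns e; rewrite -(nth_index 0%N ms) e nth_index.
- move=> i /= hi; exists (nth 0%N s i); first exact: mem_nth.
  by rewrite index_uniq.
Qed.

Lemma zero_set_of_extremal (J : set nat) (Z : nat -> C R) (L K : R) p g : disc_sequence J Z ->
  disc p -> (forall N, admissible J Z L K N g) -> 0 < absC (g p) ->
  (forall g', (forall N, admissible J Z L K N g') -> absC (g' p) <= absC (g p)) ->
  dirichlet_zero_set J Z.
Proof.
move=> [ZJ Zfin] p1 hg gp gmax.
have nz := extremal_no_extra_zero ZJ p1 hg gp gmax.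
have [ag _ dg _] := hg 0%N.
exists g; split.
- by split; [exact: ag|apply/(dirichletP ag); exists K].
- move=> n0 Jn0; set z := Z n0; have z1 : disc z by exact: ZJ.
  (* With N past all occurrences of z, the factors of [seqprod N] vanishing at z are exactly as many
     as the multiplicity. *)
  have [N hN] : exists N, forall n, occurrences J Z z n -> (n < N)%N.
    have /finite_seqP[s hs] := Zfin z; exists (\max_(i <- s) i).+1 => n.
    by rewrite hs /= => ns; rewrite ltnS; exact: (@leq_bigmax_seq _ s xpredT id n ns).
  pose P n := (n \in J) && (Z n == z).
  have PE n : P n -> occurrences J Z z n by move=> /andP[+ /eqP]; rewrite inE.
  have [_ _ _ [k ak gk]] := hg N.
  pose s1 := [seq n <- index_iota 0 N | P n].
  pose s2 := [seq n <- index_iota 0 N | ~~ P n].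
  exists (size s1).
    have <- : [set` s1] = occurrences J Z z.
      apply/seteqP; split => n /=.
        by rewrite mem_filter => /andP[/PE].
      move=> hn; rewrite mem_filter mem_index_iota (hN n hn) andbT.
      by have [Jn Zn] := hn; rewrite /P mem_set //= Zn eqxx.
    by apply: card_set_seq; rewrite filter_uniq // iota_uniq.
  pose rest w := \prod_(n <- s2) seqfac J Z n w.
  have arest : analytic rest := @analytic_zfac_prod R J Z s2.
  exists (fun w => rest w * k w); split; first exact: analytic_mul arest ak.
    move=> /eqP; rewrite mulf_eq0 => /orP[|/eqP]; last first.
      apply: (nz z N k z1 _ ak gk) => n Nn Jn Zn.
      by have := hN n (conj Jn Zn); rewrite ltnNge Nn.
    rewrite /rest prodf_seq_eq0 => /hasP[n]; rewrite mem_filter => /andP[Pn _] /=.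
    rewrite /seqfac; case: ifPn => nJ; last by rewrite oner_eq0.
    by rewrite subr_eq0 eq_sym => zn; move: Pn; rewrite /P nJ zn.
  move=> w dw; rewrite gk // mulrA; congr (_ * _).
  rewrite /seqprod -(big_mkord xpredT (fun n => seqfac J Z n w)).
  have -> : \prod_(0 <= n < N) seqfac J Z n w = \prod_(n <- s1) seqfac J Z n w * rest w.
    by rewrite (bigID P) /rest /s1 /s2 !big_filter.
  have -> : \prod_(n <- s1) seqfac J Z n w = (w - z) ^+ size s1; last by [].
  rewrite big_seq (eq_bigr (fun=> w - z)).
    by rewrite -big_seq big_const_seq count_predT iter_mulr_1.
  by move=> n; rewrite mem_filter => /andP[/andP[nJ /eqP <-] _]; rewrite /seqfac nJ.
- move=> z z1 hz.
  apply: (nz z 0%N g z1 _ ag) => [n _ Jn|w _]; first exact: hz.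
  by rewrite /seqprod big_ord0 mul1r.
Qed.

(** The Weierstrass product inequality, written with the losses 1 - x i. *)
Lemma prod_ge (I : Type) (s : seq I) (x : I -> R) : (forall i, 0 <= x i <= 1) ->
  1 - \sum_(i <- s) (1 - x i) <= \prod_(i <- s) x i.
Proof.
move=> hx; elim: s => [|i s ih]; first by rewrite !big_nil subr0.
have /andP[x0 x1] := hx i.
have s0 : 0 <= \sum_(j <- s) (1 - x j).
  by apply: sumr_ge0 => j _; rewrite subr_ge0; have /andP[] := hx j.
have p1 : \prod_(j <- s) x j <= 1 by exact: prodr_ile1.
by rewrite !big_cons; nra.
Qed.

(** Past some N0 the remaining losses add up to less than 1/2, so later factors multiply to at least
    1/2 and the product up to N0 decides. *)
Lemma prod_lower (x : nat -> R) (s : R) : (forall n, 0 < x n <= 1) ->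
  (forall N, \sum_(n < N) (1 - x n) <= s) ->
  exists2 del, 0 < del & forall N, del <= \prod_(n < N) x n.
Proof.
move=> hx hs.
have hx' n : 0 <= x n <= 1 by have /andP[/ltW -> ->] := hx n.
pose T N := \sum_(n < N) (1 - x n).
have hA : has_sup (range T) by split; [exists (T 0%N), 0%N|exists s => _ [N _ <-]; exact: hs].
have h2 : 0 < (2^-1 : R) by rewrite invr_gt0.
have [_ [N0 _ <-] hN0] := sup_adherent h2 hA.
have P0 N : 0 < \prod_(n < N) x n by apply: prodr_gt0 => n _; have /andP[] := hx n.
exists ((\prod_(n < N0) x n) / 2); first by rewrite divr_gt0.
move=> N.
have [NN|NN] := leqP N N0.
  apply: (@le_trans _ _ (\prod_(n < N0) x n)).
    by rewrite ler_pdivrMr // ler_peMr ?(ltW (P0 N0)) // ler1n.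
  rewrite -!(big_mkord xpredT x) (big_cat_nat (leq0n N) NN) /=.
  rewrite -[leRHS]mulr1 ler_wpM2l //; last by apply: prodr_ile1.
  by rewrite big_mkord ltW.
have TN : T N <= sup (range T) by apply: sup_upper_bound => //; exists N.
move: TN hN0; rewrite /T -!(big_mkord xpredT (fun n => 1 - x n)).
rewrite (big_cat_nat (leq0n N0) (ltnW NN)) /= => TN hN0.
rewrite -!(big_mkord xpredT x) (big_cat_nat (leq0n N0) (ltnW NN)) /=.
rewrite ler_wpM2l //; first by rewrite big_mkord ltW.
by apply: le_trans (prod_ge (index_iota N0 N) hx'); lra.
Qed.

(** On a short horizontal segment starting at z0 each [Z n] excludes at most one abscissa; countable
    sets are null while the segment is not. *)
Lemma avoid_countable (Z : nat -> C R) (z0 : C R) (e : R) : 0 < e ->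
  exists2 p, absC (p - z0) < e & forall n, p <> Z n.
Proof.
move=> e0; pose A : set R := range (fun n => reC (Z n - z0)).
have cA : countable A := sub_countable (card_image_le _ _) (countableP setT).
have : exists2 t, `]0%R, e[%classic t & ~ A t.
  apply: contrapT => h.
  have sub : `]0%R, e[%classic `<=` A.
    by move=> t ht; apply: contrapT => At; apply: h; exists t.
  have := countable_lebesgue_measure0 (sub_countable (subset_card_le sub) cA).
  rewrite lebesgue_measure_itv /= lte_fin e0 -EFinB subr0 => -[] e'.
  by rewrite e' ltxx in e0.
move=> [t]; rewrite /= in_itv /= => /andP[t0 te] At.
exists (z0 + rC t); first by rewrite addrC addKr absC_rC gtr0_norm.
by move=> n e'; apply: At; exists n => //; rewrite -e' addrC addKr.
Qed.

(** * Finite Blaschke products *)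

Definition bfac (J : set nat) (Z : nat -> C R) n w : C R := if n \in J then blaschke (Z n) w else 1.
Definition bprod (J : set nat) (Z : nat -> C R) N w : C R := \prod_(n < N) bfac J Z n w.

Section BlaschkeProduct.
Variables (J : set nat) (Z : nat -> C R).
Hypothesis ZJ : forall n, J n -> disc (Z n).

Lemma bfac_le1 n w : disc w -> 0 <= absC (bfac J Z n w) <= 1.
Proof.
move=> dw; rewrite absC_ge0 /bfac; case: ifPn => nJ; last by rewrite absC1 lexx.
by rewrite blaschke_le1 //; apply: ZJ; rewrite inE in nJ.
Qed.

Lemma absC_bprod N w : absC (bprod J Z N w) = \prod_(n < N) absC (bfac J Z n w).
Proof. by rewrite /bprod (big_morph absC (@absCM R) (@absC1 R)). Qed.

Lemma bprod_le1 N w : disc w -> absC (bprod J Z N w) <= 1.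
Proof. by move=> dw; rewrite absC_bprod; apply: prodr_ile1 => n _; exact: bfac_le1. Qed.

Lemma bprod_loss N w : disc w -> 1 - absC (bprod J Z N w) ^+ 2 <=
  \sum_(n < N | (n : nat) \in J) (1 - absC (blaschke (Z n) w) ^+ 2).
Proof.
move=> dw; rewrite absC_bprod -prodrXl.
have hx (n : 'I_N) : 0 <= absC (bfac J Z n w) ^+ 2 <= 1.
  by have /andP[h0 h1] := bfac_le1 n dw; rewrite sqr_ge0 exprn_ile1.
rewrite lerBlDl -lerBlDr; apply: le_trans (prod_ge (index_enum 'I_N) hx).
rewrite lerD2l lerN2 [leRHS]big_mkcond; apply: ler_sum => n _.
by rewrite /bfac; case: ifP => // _; rewrite absC1 expr1n subrr.
Qed.

Lemma bprod_zprod N : exists2 k, analytic k &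
  forall w, disc w -> bprod J Z N w = seqprod J Z N w * k w.
Proof.
elim: N => [|N [k ak hk]].
  exists (fun=> 1) => [w _|w _]; first exact: derivC_cst.
  by rewrite /bprod /seqprod !big_ord0 mulr1.
have [NJ|NJ] := boolP (N \in J); last first.
  exists k => // w dw; rewrite /bprod big_ord_recr /= -/(bprod J Z N w) hk // zprodS.
  by rewrite /bfac /seqfac (negbTE NJ) !mulr1.
have ZN : disc (Z N) by apply: ZJ; rewrite inE in NJ.
exists (fun w => k w * (1 - cjC (Z N) * w)^-1).
  apply: analytic_mul ak _ => w dw.
  apply: derivCV; first by rewrite -absC_gt0 blaschke_den.
  apply: derivCB; first exact: derivC_cst.
  by apply: derivCM; [exact: derivC_cst|exact: derivC_id].
move=> w dw; rewrite /bprod big_ord_recr /= -/(bprod J Z N w) hk // zprodS.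
by rewrite /bfac /seqfac NJ /blaschke; ring.
Qed.

Lemma bprod_lower p s : disc p -> (forall n, J n -> p <> Z n) ->
  (forall N, \sum_(n < N | (n : nat) \in J) (1 - absC (blaschke (Z n) p) ^+ 2) <= s) ->
  exists2 del, 0 < del & forall N, del <= absC (bprod J Z N p).
Proof.
move=> p1 pZ hs.
have [||del d0 hd] := @prod_lower (fun n => absC (bfac J Z n p)) s.
- move=> n; have /andP[_ ->] := bfac_le1 n p1; rewrite andbT absC_gt0 /bfac.
  case: ifPn => nJ; last exact: oner_neq0.
  rewrite inE in nJ; rewrite /blaschke mulf_neq0 //.
    by rewrite subr_eq0; apply/eqP; exact: pZ.
  by rewrite invr_eq0 -absC_gt0 blaschke_den //; exact: ZJ.
- move=> N; apply: le_trans (hs N); rewrite [leRHS]big_mkcond; apply: ler_sum => n _.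
  have /andP[b0 b1] := bfac_le1 n p1; move: b0 b1.
  rewrite /bfac; case: ifP => _; last by rewrite absC1 subrr.
  by move=> b0 b1; rewrite lerD2l lerN2 expr2 -[leRHS]mul1r ler_wpM2r.
by exists del => // N; rewrite absC_bprod.
Qed.

End BlaschkeProduct.

End ZeroSet.

(* The blocks [Zk k] of the partition may be empty, which covers partitions
   into finitely many pieces. *)
Theorem theorem3p5 (R : realType) (J : set nat) (Z : nat -> C R)
    (Zk : nat -> set nat) (lambda : nat -> C R) (a : nat -> {nonneg R}) :
  disc_sequence J Z ->
  \bigcup_k Zk k = J ->
  trivIset setT Zk ->
  (forall k, circle (lambda k)) ->
  (forall k, ((a k)%:num%:E = 2%:E *
    \esum_(n in Zk k)
      (absC (lambda k - Z n) ^+ 2 / (1 - absC (Z n) ^+ 2))%:E)%E) ->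
  (\sum_(0 <= k <oo) (a k)%:num%:E < +oo)%E ->
  inner_factor (singular_inner (point_masses a lambda)) ->
  dirichlet_zero_set J Z.
Proof.
move=> hZ ZkJ _ lam1 aE afin [iS [F [[aF dF] [z0 z01 Fz0] [h hh FE]]]].
have [ZJ _] := hZ; have [ah _] := hh.
have loss := blaschke_total_loss ZJ ZkJ lam1 aE afin.
set S := singular_inner _ in iS FE loss.
have [K hK] := (dirichletP aF).1 dF.
have [L hL hLK] := dsum_sup aF hK.
(* The same L, found for F, bounds the means of |h|^2; this is where S being inner is used. *)
have hNf := inner_Nf iS hh aF FE hL.
pose f N w := bprod J Z N w * F w.
have hf N : admissible J Z L (2 * K) N (f N).
  have [k ak hk] := bprod_zprod ZJ N.
  have af : analytic (f N).
    have az : analytic (fun w => seqprod J Z N w * k w * F w).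
      apply: analytic_mul aF; apply: analytic_mul ak.
      have -> : seqprod J Z N = (fun w => \prod_(n <- index_iota 0 N) seqfac J Z n w).
        by apply/funext => w; rewrite /seqprod -(big_mkord xpredT (fun n => seqfac J Z n w)).
      exact: analytic_zfac_prod.
    have hz := cauchy_ps az.
    apply: ps_analytic (coef_pbd az) (is_ps_ext hz _) => w dw.
    by rewrite /f hk.
  have [lf df] : lsum (coef (f N)) L /\ dsum (coef (f N)) (2 * K).
    apply: (dsum_mul aF ah af hL hLK hNf) => w dw.
      by rewrite /f absCM -[leRHS]mul1r ler_wpM2r ?absC_ge0 ?bprod_le1.
    have [s sE hs] := loss w dw.
    have b := le_trans (bprod_loss ZJ N dw) (hs N).
    have b0 := sqr_ge0 (absC (bprod J Z N w)).
    rewrite /f absCM exprMn FE // absCM exprMn sE.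
    set H := absC (h w) ^+ 2; have H0 : 0 <= H by exact: sqr_ge0.
    have e1 : expR (- s) * (1 + s) <= 1.
      by rewrite expRN mulrC ler_pdivrMr ?expR_gt0 // mul1r expR_ge1Dx.
    have e0 := expR_ge0 (- s).
    set e := expR (- s) in e0 e1 *; set B := absC _ ^+ 2 in b b0 *.
    (* From 1 - B <= s and e (1 + s) <= 1; multiplied by |h|^2 it is the pointwise inequality
       required by [dsum_mul]. *)
    have h1 : e * (1 - B) <= 1 - e by nra.
    have h2 : H * (e * (1 - B)) <= H * (1 - e) by rewrite ler_wpM2l.
    lra.
  split; [exact: af|exact: lf|exact: df|].
  exists (fun w => k w * F w); first exact: analytic_mul ak aF.
  by move=> w dw; rewrite /f hk // mulrA.
(* F stays nonzero near z0 by continuity, and a point off the countable set of values of Z is chosen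
   there. *)
have [p p1 [Fp pZ]] : exists2 p, disc p & F p <> 0 /\ forall n, p <> Z n.
  have Fz : 0 < absC (F z0) by rewrite absC_gt0; exact/eqP.
  have /contC_P /(_ _ Fz) [d d0 hd] := ps_cont (coef_pbd aF) (cauchy_ps aF) z01.
  have m0 : 0 < Num.min d (1 - absC z0) by rewrite lt_min d0 subr_gt0.
  have [p hp pZ] := avoid_countable Z z0 m0; exists p.
    move: hp; rewrite lt_min => /andP[_ hp]; have := absC_sub p z0.
    by rewrite discE; lra.
  split=> // Fp; move: hp; rewrite lt_min => /andP[/hd + _].
  by rewrite Fp absC_dist subr0 ltxx.
(* The finite total loss at p keeps the values at p of the functions [f N] away from 0, so the
   extremal problem has a nonzero competitor. *)
have [s _ hs] := loss p p1.
have [del d0 hd] := bprod_lower ZJ p1 (fun n _ => pZ n) hs.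
have Fp0 : 0 < absC (F p) by rewrite absC_gt0; exact/eqP.
have hfp j : del * absC (F p) <= absC (f j p).
  by rewrite /f absCM ler_wpM2r ?absC_ge0.
have [g [hg gp gmax]] := extremal_exists ZJ p1 (mulr_gt0 d0 Fp0)
  (fun j N Nj => admissible_le Nj (hf j)) hfp.
exact: zero_set_of_extremal hZ p1 hg gp gmax.
Qed.
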